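(* For $1<p<\infty$ and $0<s<\infty$ let $C_{s,p}$ denote the optimal (smallest) constant such that $$\big\|\,(|P_+f|^s+|P_-f|^s)^{1/s}\,\big\|_{L^p(\mathbf{T})}\le C_{s,p}\,\|f\|_{L^p(\mathbf{T})}\qquad\text{for all complex-valued } f\in L^p(\mathbf{T}).$$ Then for every $1<p<\infty$, $$\lim_{s\to\infty}C_{s,p}=\frac{1}{\sin\frac{\pi}{p}}.$$
   Context: $\mathbf{T}=\{z\in\mathbf{C}:|z|=1\}$ is the unit circle with arc-length measure, and $L^p(\mathbf{T})$ is the complex Lebesgue space. For $f\in L^p(\mathbf{T})$, $\hat f(n)=\frac1{2\pi}\int_0^{2\pi}f(e^{it})e^{-int}\,dt$. For $1<p<\infty$ the Riesz projection $P_+$ on $L^p(\mathbf{T})$ is the bounded operator given by $P_+f(\zeta)=\sum_{n\ge 0}\hat f(n)\zeta^n$, and $P_-=I-P_+$ is the co-analytic projection, $P_-f(\zeta)=\sum_{n\le -1}\hat f(n)\zeta^n$. *)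

(* Defs.v *)
From mathcomp Require Import all_boot all_order all_algebra.
From mathcomp Require Import all_classical all_reals all_analysis.
From mathcomp Require Import complex.

Set Implicit Arguments.
Unset Strict Implicit.
Unset Printing Implicit Defensive.

Import Order.TTheory GRing.Theory Num.Theory.
Import numFieldNormedType.Exports.

Local Open Scope classical_set_scope.
Local Open Scope ring_scope.
Local Open Scope complex_scope.

(* The real-valued modulus of a complex number (`|z| itself lives in R[i]). *)
Definition cabs (R : realType) (z : R[i]) : R := ComplexField.Normc.normc z.

Definition circle (R : realType) : Type := {z : R[i] | cabs z == 1}.

Definition cis (R : realType) (t : R) : R[i] := cos t +i* sin t.

Lemma cabs_cis (R : realType) (t : R) : cabs (cis t) == 1.
Proof. by rewrite /cabs /= cos2Dsin2 sqrtr1. Qed.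

Definition expi (R : realType) (t : R) : circle R :=
  exist (fun z => cabs z == 1) (cis t) (cabs_cis t).

(* Functions on the circle are integrated through the parametrization
   t |-> e^{it}, 0 <= t <= 2 pi: arc length is the image of this measure. *)
Definition arc_measure (R : realType)
    : {measure set (measurableTypeR R) -> \bar R} :=
  mrestr (@lebesgue_measure R) (measurable_itv `[0, 2 * pi]%R).

(* (\int_T |h|^p)^(1/p), for a real-valued h *)
Definition Lpnorm (R : realType) (p : R) (h : circle R -> R) : \bar R :=
  Lnorm (@arc_measure R) p%:E (fun t => (h (expi t))%:E).

(* Elements of L^p(T) are represented by functions rather than by classes of
   functions up to almost everywhere equality. *)
Definition in_Lp (R : realType) (p : R) (f : circle R -> R[i]) : Prop :=
  [/\ measurable_fun setT (fun t => complex.Re (f (expi t))),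
      measurable_fun setT (fun t => complex.Im (f (expi t)))
    & (Lpnorm p (fun z => cabs (f z)) < +oo)%E].

Definition cintegral (R : realType) (g : R -> R[i]) : R[i] :=
  Rintegral (@arc_measure R) setT (fun t => complex.Re (g t)) +i*
  Rintegral (@arc_measure R) setT (fun t => complex.Im (g t)).

Definition fourier_coef (R : realType) (f : circle R -> R[i]) (n : int)
    : R[i] :=
  ((2 * pi)^-1)%:C * cintegral (fun t => f (expi t) * cis (- (n%:~R * t))).

Definition analytic_sum (R : realType) (f : circle R -> R[i]) (N : nat)
    (z : circle R) : R[i] :=
  \sum_(0 <= n < N) fourier_coef f n%:Z * (sval z) ^+ n.

(* [riesz_plus p f] is the sum in L^p(T) of the series
   \sum_(n >= 0) fourier_coef f n * z ^+ n, which converges in norm for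
   1 < p < +oo and f in L^p(T); it is determined up to a null set, and one
   representative is chosen. *)
Definition riesz_plus (R : realType) (p : R) (f : circle R -> R[i])
    : circle R -> R[i] :=
  xget (fun _ => 0) [set g | in_Lp p g /\
    Lpnorm p (fun z => cabs (analytic_sum f N z - g z)) @[N --> \oo]
      --> 0%E].

Definition riesz_minus (R : realType) (p : R) (f : circle R -> R[i])
    : circle R -> R[i] :=
  fun z => f z - riesz_plus p f z.

Definition riesz_bound (R : realType) (s p C : R) : Prop :=
  forall f : circle R -> R[i], in_Lp p f ->
    (Lpnorm p (fun z => ((cabs (riesz_plus p f z) `^ s
                          + cabs (riesz_minus p f z) `^ s) `^ s^-1)%R)
     <= C%:E * Lpnorm p (fun z => cabs (f z)))%E.

(* C_{s,p}, as an extended real: +oo if no constant is admissible. *)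
Definition riesz_const (R : realType) (s p : R) : \bar R :=
  ereal_inf [set C%:E | C in riesz_bound s p].

(* Main.v *)
(* Put a = (1 / sin (pi / p)) ^ p.  Since max(x, y) <= (x^s + y^s)^(1/s) <= 2^(1/s) max(x, y), it
   suffices to show that max(|P+ f|, |P- f|) has L^p norm at most |f|_p / sin (pi / p), and that no
   smaller constant works for |P+ f| alone.

   Upper bound.  For complex w, z one has max(|w|, |z|)^p <= a |w + conj z|^p - b Psi (w z) with b >= 0
   and Psi v = |v|^(p/2) cos (p/2 arg v), suitably signed and truncated so as to be subharmonic in v.
   With w = P+ f and conj z = P- f the product w z is analytic and vanishes at 0, so that
   Psi (w z) has nonnegative mean.  Fejer means reduce this to polynomials, for which the mean value
   inequality follows from the maximum principle.

   Lower bound.  Put F = (1 - rho z)^(-1/p) and f = F + c conj (z F) with c = - cos (pi / p), so that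
   P+ f = F.  As rho -> 1 the mass of |F|^p concentrates near z = 1, where arg F is close to
   +- pi / (2 p) and hence |f| is close to sin (pi / p) |F|. *)
Require Import Defs.
From mathcomp Require Import all_boot all_order all_algebra.
From mathcomp Require Import all_classical all_reals all_analysis.
From mathcomp Require Import measurable_realfun complex ring lra.
Set Implicit Arguments.
Unset Strict Implicit.
Unset Printing Implicit Defensive.
Import Order.TTheory GRing.Theory Num.Theory.
Import numFieldNormedType.Exports.
Local Open Scope classical_set_scope.
Local Open Scope ring_scope.

(** * Differentiation in one variable *)

(** Equality in the pointwise bound occurs at |z| / |w| = |cos (pi / p)|, at an angle where
    [Psi (w z)] vanishes. For the test function |P- f| / |P+ f| is exactly that ratio, and near z =
    1 the angle is nearly that one, which is why the two bounds meet. Two obstacles shape the upper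
    bound. First, Psi is only continuous, so its subharmonicity is expressed by touching: wherever w
    z is nonzero, one harmonic branch agrees with Psi at the point and stays below it nearby, and
    second derivatives of that branch in two orthogonal directions are compared. Zeros of w z admit
    no branch; a small multiple of ln |w z| keeps maxima away from them. Second, P+ f is a chosen
    limit, known only through its Fourier coefficients, or the default 0. The estimate is therefore
    proved for every splitting F = G + H with the right vanishing coefficients. The Fejer means are
    used as L^1 approximations, hence the maximum is truncated before the limit is taken. For the
    lower bound, a first-order recursion for the Fourier coefficients of F gives both its
    analyticity and the convergence of its partial sums. *)

Section derivative_rules.
Context {R : realType}.
Implicit Types (f g : R -> R) (x a b : R).

(* Unlike [is_derive], [has_derive] is not a class: the tactic [derive] below is then the only
   one to choose the differentiation rules. *)
Definition has_derive f x a := is_derive x 1 f a.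

Lemma has_derive_eq f x a b : has_derive f x a -> a = b -> is_derive x 1 f b.
Proof. by move=> fa <-. Qed.

Lemma has_derive_add f g x a b : has_derive f x a -> has_derive g x b ->
  has_derive (fun t => f t + g t) x (a + b).
Proof. by move=> ? ?; exact: is_deriveD. Qed.

Lemma has_derive_sub f g x a b : has_derive f x a -> has_derive g x b ->
  has_derive (fun t => f t - g t) x (a - b).
Proof. by move=> ? ?; exact: is_deriveB. Qed.

Lemma has_derive_opp f x a : has_derive f x a -> has_derive (fun t => - f t) x (- a).
Proof. by move=> ?; exact: is_deriveN. Qed.

Lemma has_derive_const c x : has_derive (fun=> c : R) x 0.
Proof. exact: is_derive_cst. Qed.

Lemma has_derive_var x : has_derive (fun t : R => t) x 1.
Proof. exact: is_derive_id. Qed.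

Lemma has_derive_mul f g x a b : has_derive f x a -> has_derive g x b ->
  has_derive (fun t => f t * g t) x (a * g x + f x * b).
Proof.
move=> fa gb; apply: is_derive_eq (is_deriveM fa gb) _.
by rewrite /GRing.scale/= addrC [g x * _]mulrC.
Qed.

Lemma has_derive_sqr f x a : has_derive f x a ->
  has_derive (fun t => f t ^+ 2) x (2 * f x * a).
Proof.
move=> fa; rewrite (_ : (fun t => _) = (fun t => f t * f t)).
  have H := has_derive_mul fa fa; rewrite (_ : 2 * f x * a = a * f x + f x * a) //; ring.
by apply/funext => t; rewrite expr2.
Qed.

Lemma has_derive_chain f g x a b : has_derive f (g x) a -> has_derive g x b ->
  has_derive (fun t => f (g t)) x (a * b).
Proof. by move=> fa gb; exact: (is_derive1_comp fa gb). Qed.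

Lemma has_derive_sinf f x a : has_derive f x a ->
  has_derive (fun t => sin (f t)) x (cos (f x) * a).
Proof. by move=> fa; exact: (has_derive_chain (is_derive_sin _) fa). Qed.

Lemma has_derive_cosf f x a : has_derive f x a ->
  has_derive (fun t => cos (f t)) x (- sin (f x) * a).
Proof. by move=> fa; exact: (has_derive_chain (is_derive_cos _) fa). Qed.

Lemma has_derive_expf f x a : has_derive f x a ->
  has_derive (fun t => expR (f t)) x (expR (f x) * a).
Proof. by move=> fa; exact: (has_derive_chain (is_derive_expR _) fa). Qed.

Lemma has_derive_lnf f x a : 0 < f x -> has_derive f x a ->
  has_derive (fun t => ln (f t)) x ((f x)^-1 * a).
Proof. by move=> fx fa; exact: (has_derive_chain (is_derive1_ln fx) fa). Qed.

Lemma has_derive_powRf f x a p : 0 < f x -> has_derive f x a ->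
  has_derive (fun t => f t `^ p) x (p * f x `^ (p - 1) * a).
Proof.
by move=> fx fa; exact: (has_derive_chain (is_derive1_powR p fx) fa).
Qed.

Lemma has_derive_atanf f x a : has_derive f x a ->
  has_derive (fun t => atan (f t)) x ((1 + f x ^+ 2)^-1 * a).
Proof. by move=> fa; exact: (has_derive_chain (is_derive1_atan _) fa). Qed.

Lemma has_derive_invf f x a : f x != 0 -> has_derive f x a ->
  has_derive (fun t => (f t)^-1) x (- (f x) ^- 2 * a).
Proof. by move=> f0 fa; exact: is_deriveV. Qed.

End derivative_rules.

Ltac derive_step := lazymatch goal with
  | |- has_derive (fun t => t) _ _ => exact: has_derive_var
  | |- has_derive (fun t => @GRing.add _ (@?f t) (@GRing.opp _ (@?h t))) _ _ =>
      apply: (@has_derive_sub _ f h)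
  | |- has_derive (fun t => @GRing.add _ (@?f t) (@?h t)) _ _ => apply: (@has_derive_add _ f h)
  | |- has_derive (fun t => @GRing.opp _ (@?f t)) _ _ => apply: (@has_derive_opp _ f)
  | |- has_derive (fun t => @GRing.mul _ (@?f t) (@?h t)) _ _ => apply: (@has_derive_mul _ f h)
  | |- has_derive (fun t => @GRing.exp _ (@?f t) 2) _ _ => apply: (@has_derive_sqr _ f)
  | |- has_derive (fun t => sin (@?f t)) _ _ => apply: (@has_derive_sinf _ f)
  | |- has_derive (fun t => cos (@?f t)) _ _ => apply: (@has_derive_cosf _ f)
  | |- has_derive (fun t => expR (@?f t)) _ _ => apply: (@has_derive_expf _ f)
  | |- has_derive (fun t => atan (@?f t)) _ _ => apply: (@has_derive_atanf _ f)
  | |- has_derive (fun t => ln (@?f t)) _ _ => apply: (@has_derive_lnf _ f)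
  | |- has_derive (fun t => powR (@?f t) ?p) _ _ => apply: (@has_derive_powRf _ f)
  | |- has_derive (fun t => @GRing.inv _ (@?f t)) _ _ => apply: (@has_derive_invf _ f)
  | |- _ => exact: has_derive_const
  end.

Ltac derive := apply: has_derive_eq; [do ! derive_step|rewrite ?/GRing.scale /=].

(** * Derivative tests at extrema, and elementary bounds for powers, sine and cosine *)

Section one_variable.
Context {R : realType}.
Implicit Types (f df : R -> R) (a b c d : R).

Lemma is_derive_unique f c a b : is_derive c 1 f a -> is_derive c 1 f b -> a = b.
Proof. by move=> [_ <-] [_ <-]. Qed.

Lemma is_derive_continuous f c a : is_derive c 1 f a -> {for c, continuous f}.
Proof.
by case=> df _; exact/differentiable_continuous/derivable1_diffP.
Qed.

Lemma is_derive_slope f c d : is_derive c 1 f d ->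
  h^-1 * (f (c + h) - f c) @[h --> 0^'] --> d.
Proof.
move=> [fd <-]; rewrite (_ : (fun h => _) = (fun h => h^-1 *: ((f \o shift c) (h *: 1) - f c))).
  exact: fd.
by apply/funext => h /=; rewrite /GRing.scale/= mulr1 [c + h]addrC.
Qed.

Lemma is_derive_gt0_near f c d : is_derive c 1 f d -> 0 < d ->
  exists2 e, 0 < e & forall h, h != 0 -> `|h| < e -> 0 < h^-1 * (f (c + h) - f c).
Proof.
move=> /is_derive_slope fd d0.
have /(_ _)/nbhs_ballP[e /= e0 he] := cvgr_gt _ fd 0 d0.
exists e => // h h0 hle; apply: he => //.
by rewrite /ball/= sub0r normrN.
Qed.

Lemma derive_gt0_left f c d e : is_derive c 1 f d -> 0 < d -> 0 < e ->
  exists x, [/\ c - e < x, x < c & f x < f c].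
Proof.
move=> fd d0 e0; have [r r0 hr] := is_derive_gt0_near fd d0.
pose h := - (Num.min r e / 2).
have m0 : 0 < Num.min r e by rewrite lt_min r0.
have hlt : h < 0 by rewrite /h; lra.
have mr : Num.min r e <= r by rewrite ge_min lexx.
have me : Num.min r e <= e by rewrite ge_min lexx orbT.
exists (c + h); split; [rewrite /h; lra|lra|].
have hr' : `|h| < r by rewrite ltr0_norm// /h; lra.
have /hr/(_ hr') : h != 0 by rewrite lt_eqF.
by rewrite nmulr_rgt0 ?invr_lt0// subr_lt0.
Qed.

Lemma derive_gt0_lt f df a b : a < b ->
  (forall x, a <= x <= b -> is_derive x 1 f (df x)) ->
  (forall x, a < x < b -> 0 < df x) -> f a < f b.
Proof.
move=> ab fd d0.
have [||c] := @MVT R f df a b ab.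
- by move=> x; rewrite in_itv/= => /andP[ax xb]; apply: fd; rewrite !ltW.
- apply: continuous_in_subspaceT => x; rewrite inE/= in_itv/= => xab.
  exact: is_derive_continuous (fd _ xab).
by rewrite in_itv/= => cab fE; rewrite -subr_gt0 fE mulr_gt0 ?subr_gt0// d0.
Qed.

(** If [d] were negative, [df], which is 0 at the minimum, would be negative just to the right of
    [c], and the mean value theorem would push [f] below [f c]. *)
Lemma second_derivative_min f df c d e : 0 < e ->
  (forall x, `|x - c| < e -> is_derive x 1 f (df x)) -> is_derive c 1 df d ->
  (forall x, `|x - c| < e -> f c <= f x) -> 0 <= d.
Proof.
move=> e0 fd dfd fmin; rewrite leNgt; apply/negP => d0.
have cc : `|c - c| < e by rewrite subrr normr0.
have dfc : df c = 0.
  apply: (is_derive_unique (fd c cc)).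
  apply: (@derive1_at_min _ f (c - e) (c + e)).
  - by lra.
  - move=> t; rewrite in_itv/= -ltr_distl => te.
    by case: (fd t te).
  - by rewrite in_itv/= -ltr_distl.
  - by move=> t; rewrite in_itv/= -ltr_distl => te; exact: fmin.
have d0' : 0 < - d by lra.
have [r r0 hr] := is_derive_gt0_near (has_derive_opp dfd) d0'.
pose h := Num.min r e / 2.
have m0 : 0 < Num.min r e by rewrite lt_min r0.
have mr : Num.min r e <= r by rewrite ge_min lexx.
have me : Num.min r e <= e by rewrite ge_min lexx orbT.
have h0 : 0 < h by rewrite /h; lra.
have : - f c < - f (c + h).
  apply: (@derive_gt0_lt (fun x => - f x) (fun x => - df x)); first lra.
  - move=> x /andP[cx xh]; apply: has_derive_opp; apply: fd.
    by rewrite ger0_norm ?subr_ge0//; rewrite /h in xh; lra.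
  move=> x /andP[cx xh].
  have xc : 0 < x - c by lra.
  have xr : `|x - c| < r by rewrite gtr0_norm// /h in xh *; lra.
  have /hr/(_ xr) : x - c != 0 by rewrite gt_eqF.
  by rewrite dfc oppr0 subr0 pmulr_rgt0 ?invr_gt0// addrC subrK.
have ce : `|c + h - c| < e by rewrite addrAC subrr add0r gtr0_norm// /h; lra.
by have := fmin _ ce; lra.
Qed.

Lemma derive_local_min0 f c d e : is_derive c 1 f d -> 0 < e ->
  (forall x, `|x - c| < e -> f c <= f x) -> d = 0.
Proof.
move=> fd e0 fmin; have small (r : R) : 0 < r ->
    exists h, [/\ 0 < h, h < r & h < e].
  move=> r0; exists (Num.min r e / 2).
  have m0 : 0 < Num.min r e by rewrite lt_min r0.
  have mr : Num.min r e <= r by rewrite ge_min lexx.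
  have me : Num.min r e <= e by rewrite ge_min lexx orbT.
  by split; lra.
have [d0|d0|//] := ltgtP d 0.
  have d0' : 0 < - d by lra.
  have [r r0 hr] := is_derive_gt0_near (has_derive_opp fd) d0'.
  have [h [h0 hr' he]] := small _ r0.
  have hle : `|h| < r by rewrite gtr0_norm.
  have := hr h (lt0r_neq0 h0) hle; rewrite pmulr_rgt0 ?invr_gt0// => fh.
  have ce : `|c + h - c| < e by rewrite addrAC subrr add0r gtr0_norm.
  by have := fmin _ ce; lra.
have [x [xe xc fx]] := derive_gt0_left fd d0 e0.
have ce : `|x - c| < e by rewrite ltr0_norm; lra.
by have := fmin _ ce; lra.
Qed.

(** With the absolute value the power is continuous on the whole line, including 0, so it composes
    with any continuous function. *)
Lemma continuous_norm_powR (s : R) : 0 < s -> continuous (fun x : R => `|x| `^ s).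
Proof.
move=> s0 x; have [->|x0] := eqVneq x 0.
  apply/cvgrPdist_lt => e e0; rewrite normr0 powR0 ?gt_eqF//.
  near=> t; rewrite sub0r normrN ger0_norm ?powR_ge0//.
  have te : `|t| < e `^ (s^-1).
    near: t; apply/nbhs_ballP; exists (e `^ s^-1) => /=; first exact: powR_gt0.
    by move=> t; rewrite /ball/= sub0r normrN.
  have -> : e = (e `^ s^-1) `^ s by rewrite -powRrM mulVf ?gt_eqF// powRr1// ltW.
  by apply: gt0_ltr_powR; rewrite ?nnegrE ?powR_ge0.
apply: (@continuous_comp _ _ _ (fun t : R => `|t|) (fun t => t `^ s)).
  exact: norm_continuous.
apply: is_derive_continuous; apply: is_derive1_powR; by rewrite normr_gt0.
Unshelve. all: by end_near. Qed.

Lemma sin_le_id (x : R) : 0 <= x -> sin x <= x.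
Proof.
rewrite le_eqVlt => /predU1P[<-|x0]; first by rewrite sin0.
pose f t : R := t - sin t.
have fE (t : R) : is_derive t 1 f (1 - cos t) by rewrite /f; derive; ring.
have fc : {within `[0, x], continuous f}.
  by apply: continuous_subspaceT => t; exact: is_derive_continuous (fE t).
have [y _] := @MVT_segment R f _ 0 x (ltW x0) (fun t _ => fE t) fc.
rewrite /f sin0 !subr0 => h.
by rewrite -subr_ge0 h mulr_ge0 ?subr_ge0 ?cos_le1// ltW.
Qed.

(** The left side is the square of 2 sin (|x| / 2). *)
Lemma cos_ge_quadratic (x : R) : 2 - 2 * cos x <= x ^+ 2.
Proof.
have -> : 2 - 2 * cos x = (2 * sin (`|x| / 2)) ^+ 2.
  by rewrite -cos_norm [in LHS](_ : `|x| = `|x| / 2 *+ 2) ?cos_mulr2n ?cos2sin2; [ring|rewrite mulr2n; lra].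
have : `|sin (`|x| / 2)| <= `|x| / 2.
  have y0 : 0 <= `|x| / 2 by rewrite divr_ge0.
  have [yp|yp] := leP (`|x| / 2) pi.
    by rewrite ger0_norm ?sin_le_id// sin_ge0_pi// y0.
  by rewrite (le_trans (sin_max _))//; move: (pi_ge2 R); lra.
rewrite -ler_sqr ?nnegrE// ?divr_ge0// real_normK ?num_real//.
by rewrite !exprMn real_normK ?num_real// exprVn; lra.
Qed.

End one_variable.

(** * The pointwise inequality *)

(** The difference of the two sides vanishes at x = 0, and its derivative s b (cos (b x) - cos (s
    x)) is positive as long as s x stays below pi. *)
Lemma sinc_lt (R : realType) (b s x : R) : 0 < b < s -> 0 < x -> s * x <= pi ->
  b * sin (s * x) < s * sin (b * x).
Proof.
move=> /andP[b0 bs] x0 sx; rewrite -subr_gt0.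
pose f t : R := s * sin (b * t) - b * sin (s * t).
have f0 : f 0 = 0 by rewrite /f !mulr0 sin0 !mulr0 subrr.
rewrite -[ltLHS]f0 -/(f x).
apply: (@derive_gt0_lt _ f (fun t => s * b * (cos (b * t) - cos (s * t)))) => //.
  by move=> t _; rewrite /f; derive; ring.
move=> t /andP[t0 tx].
have st : s * t <= s * x by rewrite ler_pM2l ?ltW//; lra.
have bt : 0 < b * t by rewrite mulr_gt0.
have bst : b * t < s * t by rewrite ltr_pM2r.
rewrite mulr_gt0//; first by rewrite mulr_gt0//; lra.
by rewrite subr_gt0 ltr_cos// in_itv/=; apply/andP; split; lra.
Qed.

Section pointwise_inequality.
(* [sg = p / 2], [e] is the sign of [1 - sg] and [gm = pi / p]; the constants [a] and [b] make the
   inequality an equality at modulus [c] and angle [gm]. *)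
Context {R : realType} (sg e b' gm c s a b Phi : R).
Context (sg_half : 1 / 2 < sg) (e_sign : e = 1 \/ e = -1) (b'E : 1 - sg = e * b') (b'_gt0 : 0 < b').
Context (gmE : sg * gm = pi / 2) (cE : c = - e * cos gm) (sE : s = sin gm)
  (aE : a = (s `^ (2 * sg))^-1) (bE : b = 2 * c `^ (1 - sg) / s)
  (PhiE : Phi = if e == 1 then pi else pi / sg).

Let ee : e * e = 1. Proof. by case: e_sign => ->; lra. Qed.

Let e1_lt : e = 1 -> sg < 1. Proof. by move: b'E b'_gt0 => + + eE; rewrite eE; lra. Qed.
Let eN1_gt : e = -1 -> 1 < sg. Proof. by move: b'E b'_gt0 => + + eE; rewrite eE; lra. Qed.

Let sg0 : 0 < sg. Proof. by move: sg_half; lra. Qed.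
Let b'_lt : b' < sg. Proof. by move: sg_half b'E; case: e_sign => ->; lra. Qed.

Let pi0 : 0 < pi :> R := pi_gt0 R.

(** [Phi] is the last angle before the truncation in the minorant: for sg > 1 the value cos (sg x) =
    -1 is reached at pi / sg < pi, while for sg < 1 the whole half turn is allowed. *)
Let Phi_le : Phi <= pi.
Proof.
rewrite PhiE; case: e_sign => eE; first by rewrite eE eqxx.
by case: ifP => // _; rewrite ler_pdivrMr// ler_peMr ?ltW// eN1_gt.
Qed.

Let sg_Phi : sg * Phi <= pi.
Proof.
rewrite PhiE; case: ifP => [/eqP /e1_lt sg1|_]; last by rewrite mulrC divfK// gt_eqF.
by rewrite ler_piMl// ltW.
Qed.

Let gm_gt0 : 0 < gm. Proof. by rewrite -(pmulr_rgt0 _ sg0) gmE divr_gt0. Qed.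

Let gm_Phi : gm < Phi.
Proof.
have h := sg_half; have h' := sg0.
have : gm < pi / sg by rewrite ltr_pdivlMr// mulrC gmE; move: pi0; lra.
have : gm < pi by rewrite -(ltr_pM2l h') gmE mulrC ltr_pM2r//; lra.
by rewrite PhiE; case: ifP.
Qed.

Let s_gt0 : 0 < s.
Proof. by rewrite sE sin_gt0_pi// gm_gt0/=; apply: lt_le_trans Phi_le. Qed.

(** This is the form in which the critical equations produce [c], namely r = sin (b' x) / sin (sg x)
    at x = gm. The two forms agree because b' gm = e (gm - pi / 2). *)
Let c_sin : c = sin (b' * gm).
Proof.
have -> : b' * gm = e * (gm - pi / 2) 
  by rewrite (_ : gm - _ = e * b' * gm) ?mulrA ?ee ?mul1r// -gmE -b'E; ring.
have -> : sin (e * (gm - pi / 2)) = e * sin (gm - pi / 2).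
  by case: e_sign => ->; rewrite ?mul1r// !mulN1r sinN.
by rewrite sinBpihalf cE; ring.
Qed.

Let in_dom (x : R) : 0 < x < Phi -> [/\ 0 < sin x, 0 < sin (sg * x) & 0 < sin (b' * x)].
Proof.
move=> /andP[x0 xP].
have h1 : sg * x < pi by rewrite (lt_le_trans _ sg_Phi)// ltr_pM2l.
have h2 : b' * x < sg * x by rewrite ltr_pM2r.
have hP := lt_le_trans xP Phi_le; have h3 := mulr_gt0 b'_gt0 x0; have h4 := mulr_gt0 sg0 x0.
by split; apply: sin_gt0_pi; apply/andP; split; lra.
Qed.

Let c_gt0 : 0 < c.
Proof. by rewrite c_sin; have [] := @in_dom gm; rewrite ?gm_gt0. Qed.

Let a_gt0 : 0 < a. Proof. by rewrite aE invr_gt0 powR_gt0. Qed.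
Let b_gt0 : 0 < b. Proof. by rewrite bE divr_gt0// mulr_gt0// powR_gt0. Qed.

(** Eliminating r from the two critical equations of [E] and taking logarithms leaves an equation in
    the angle alone, whose left side is [g]. *)
Let g x := (2 * sg - 1) * ln (sin x) + (1 - sg) * ln (sin (b' * x)) - sg * ln (sin (sg * x)).

(** Expanding sin and cos of x = sg x + e (b' x) turns the derivative of [- (e * g)] into ((sg sin
    (b' x))^2 - (b' sin (sg x))^2) over a positive product; [sinc_lt] gives its sign. *)
Let g_mono (x y : R) : 0 < x -> x < y -> y < Phi -> e * g y < e * g x.
Proof.
move=> x0 xy yP; rewrite -ltrN2.
pose dg t := (2 * sg - 1) * ((sin t)^-1 * cos t) + (1 - sg) * ((sin (b' * t))^-1 * (cos (b' * t) * b'))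
  - sg * ((sin (sg * t))^-1 * (cos (sg * t) * sg)).
pose F t := - (e * g t); rewrite -/(F x) -/(F y).
apply: (@derive_gt0_lt _ F (fun t => - (e * dg t)) x y xy) => t /andP[xt ty].
  have [|s1 s2 s3] := @in_dom t; first by rewrite (lt_le_trans x0 xt) (le_lt_trans ty yP).
  by rewrite /F /g /dg; derive => //; ring.
have tD : 0 < t < Phi by rewrite (lt_trans x0 xt) (lt_trans ty yP).
have [s1 s2 s3] := in_dom tD.
have key : b' * sin (sg * t) < sg * sin (b' * t).
  apply: sinc_lt; [by rewrite b'_gt0 b'_lt|exact: lt_trans xt|].
  by rewrite (le_trans _ sg_Phi)// ler_pM2l// ltW// (lt_trans ty yP).
suff -> : - (e * dg t) = ((sg * sin (b' * t)) ^+ 2 - (b' * sin (sg * t)) ^+ 2)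
    / (sin t * sin (sg * t) * sin (b' * t)).
  by rewrite divr_gt0 ?mulr_gt0// subr_gt0 ltr_sqr// nnegrE ltW// mulr_gt0.
have tE : t = sg * t + e * (b' * t) by rewrite mulrA -b'E; ring.
have sE' : sin t = sin (sg * t) * cos (b' * t) + e * (cos (sg * t) * sin (b' * t)).
  by rewrite {1}tE sinD; case: e_sign => ->; rewrite ?mul1r ?mulN1r ?sinN ?cosN; ring.
have cE' : cos t = cos (sg * t) * cos (b' * t) - e * (sin (sg * t) * sin (b' * t)).
  by rewrite {1}tE cosD; case: e_sign => ->; rewrite ?mul1r ?mulN1r ?sinN ?cosN; ring.
have sge : sg = 1 - e * b' by rewrite -b'E; ring.
have S := sin2cos2 (sg * t); have B := sin2cos2 (b' * t).
rewrite /dg b'E; move: sE' cE' S B s1 s2 s3 sge.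
move: (sin t) (cos t) (sin (sg * t)) (sin (b' * t)) (cos (sg * t)) (cos (b' * t)).
move=> S C A B CA CB SE CE AA BB S0 A0 B0 sge.
have num : (2 * sg - 1) * C * A * B + e * b' ^+ 2 * CB * S * A - sg ^+ 2 * CA * S * B
    = - e * ((sg * B) ^+ 2 - (b' * A) ^+ 2).
  have h1 : A ^+ 2 + CA ^+ 2 = 1 by rewrite AA subrK.
  have h2 : B ^+ 2 + CB ^+ 2 = 1 by rewrite BB subrK.
  transitivity (- e * ((sg * B) ^+ 2 * (A ^+ 2 + CA ^+ 2) - (b' * A) ^+ 2 * (B ^+ 2 + CB ^+ 2))).
    by rewrite SE CE sge; case: e_sign => ->; ring.
  by rewrite h1 h2 !mulr1.
have -> : - (e * ((2 * sg - 1) * (S^-1 * C) + e * b' * (B^-1 * (CB * b')) - sg * (A^-1 * (CA * sg))))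
    = - e * ((2 * sg - 1) * C * A * B + e * b' ^+ 2 * CB * S * A - sg ^+ 2 * CA * S * B) / (S * A * B).
  by field; rewrite !gt_eqF.
by rewrite num mulrA mulrNN ee mul1r.
Qed.

Let slope_sin (k : R) : t^-1 * sin (k * t) @[t --> (0 : R)^'] --> k.
Proof.
have D : is_derive (0 : R) 1 (fun t => sin (k * t)) k.
  by derive; rewrite mulr0 cos0; ring.
have := is_derive_slope D; rewrite mulr0 sin0.
by have -> : (fun h => h^-1 * (sin (k * (0 + h)) - 0)) = (fun h => h^-1 * sin (k * h));
  first by apply/funext => t; rewrite add0r subr0.
Qed.

(** The coefficients of the three logarithms in [g] add up to 0, so the ln x singularities cancel
    and the right side is the limit of [e * g] at 0; a strictly decreasing function stays below it.
    This excludes minima on the axis x = 0. *)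
Let g_at0 : e * g gm < e * ((1 - sg) * ln b' - sg * ln sg).
Proof.
pose u k t : R := t^-1 * sin (k * t).
have lnu (k : R) : 0 < k -> ln (u k t) @[t --> (0 : R)^'] --> ln k.
  move=> k0; exact: (@continuous_cvg _ _ _ _ _ (u k) (@ln R) k (continuous_ln k0) (@slope_sin k)).
pose G t := e * ((2 * sg - 1) * ln (u 1 t) + (1 - sg) * ln (u b' t) - sg * ln (u sg t)).
have GE t : 0 < t < Phi -> G t = e * g t.
  move=> /[dup] tP /andP[t0 _]; have [s1 s2 s3] := in_dom tP.
  have lnE k : 0 < sin (k * t) -> ln (u k t) = ln (sin (k * t)) - ln t.
    by move=> sk; rewrite /u lnM ?posrE ?invr_gt0// lnV ?posrE// addrC.
  by rewrite /G !lnE ?mul1r// /g; ring.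
have Glim : G t @[t --> (0 : R)^'] --> e * ((1 - sg) * ln b' - sg * ln sg).
  have -> : e * ((1 - sg) * ln b' - sg * ln sg)
      = e * ((2 * sg - 1) * ln 1 + (1 - sg) * ln b' - sg * ln sg) by rewrite ln1; ring.
  have l1 := @lnu 1 ltr01; have l2 := @lnu b' b'_gt0; have l3 := @lnu sg sg0.
  by apply: cvgMr; apply: cvgB; [apply: cvgD|]; apply: cvgMr.
rewrite ltNge; apply/negP => le.
(* The intermediate point gm / 2 keeps the inequality strict in the limit. *)
have gm2 : e * g gm < e * g (gm / 2).
  by apply: g_mono => //; move: gm_gt0; lra.
have /(_ _)/nbhs_ballP[d /= d0 dG] := cvgr_lt _ Glim _ (le_lt_trans le gm2).
pose t := Num.min d (gm / 2) / 2.
have m0 : 0 < Num.min d (gm / 2) by rewrite lt_min d0 divr_gt0.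
have md : Num.min d (gm / 2) <= d by rewrite ge_min lexx.
have mg : Num.min d (gm / 2) <= gm / 2 by rewrite ge_min lexx orbT.
have t0 : 0 < t by rewrite /t; lra.
have tg : t < gm / 2 by rewrite /t; lra.
have tP : t < Phi by move: gm_Phi gm_gt0; lra.
have : G t < e * g (gm / 2).
  by apply: dG; [rewrite /ball/= sub0r normrN gtr0_norm// /t; lra|rewrite gt_eqF].
rewrite GE ?t0//.
have : e * g (gm / 2) < e * g t by apply: g_mono => //; move: gm_Phi gm_gt0; lra.
by lra.
Qed.

(** [Q r x] is |1 + e r exp (i x)|^2, [E] is the difference of the two sides of the inequality to
    prove, and [Er] and [Ex] are the partial derivatives of [E]. *)
Let Q r x := 1 + r ^+ 2 + 2 * e * r * cos x.
Let E r x := a * Q r x `^ sg - 1 - e * b * r `^ sg * cos (sg * x).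
Let Er r x := a * (sg * Q r x `^ (sg - 1) * (2 * r + 2 * e * cos x))
  - e * b * (sg * r `^ (sg - 1)) * cos (sg * x).
Let Ex r x := a * (sg * Q r x `^ (sg - 1) * (- (2 * e * r * sin x)))
  + e * b * r `^ sg * (sg * sin (sg * x)).

Let QE r x : Q r x = (r + e * cos x) ^+ 2 + sin x ^+ 2.
Proof. by rewrite sin2cos2 /Q; case: e_sign => ->; ring. Qed.

Let Er_derive r x : 0 < r -> 0 < Q r x -> is_derive r 1 (E ^~ x) (Er r x).
Proof. by move=> r0 Q0; rewrite /E /Er /Q; derive => //; ring. Qed.

Let Ex_derive r x : 0 < r -> 0 < Q r x -> is_derive x 1 (E r) (Ex r x).
Proof. by move=> r0 Q0; rewrite /E /Ex /Q; derive => //; ring. Qed.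

(** The critical equations act as a law of sines: r = sin (b' x) / sin (sg x) and Q = (sin x / sin
    (sg x))^2. Inserted into the equation for [Ex] they leave [g x = g gm], so x = gm by
    monotonicity; there cos (sg x) = 0 and a Q^sg = 1. *)
Let E_critical r x : 0 < r -> 0 < x < Phi -> Er r x = 0 -> Ex r x = 0 -> E r x = 0.
Proof.
move=> r0 /[dup] xP /andP[x0 xPhi]; have [S0 A0 B0] := in_dom xP.
have Q0 : 0 < Q r x by rewrite QE ltr_wpDl ?sqr_ge0// exprn_gt0.
pose X := 2 * a * Q r x `^ (sg - 1); pose Y := b * r `^ (sg - 1).
have X0 : 0 < X by rewrite !mulr_gt0// powR_gt0.
have Y0 : 0 < Y by rewrite !mulr_gt0// powR_gt0.
have rsg : r `^ sg = r * r `^ (sg - 1) by rewrite mulr_powRB1// ltW.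
rewrite (_ : Er r x = sg * (X * (r + e * cos x) - e * Y * cos (sg * x))); last first.
  by rewrite /Er /X /Y; ring.
rewrite (_ : Ex r x = - (e * sg * r) * (X * sin x - Y * sin (sg * x))); last first.
  by rewrite /Ex /X /Y rsg; ring.
move=> /eqP; rewrite mulf_eq0 gt_eqF//= subr_eq0 => /eqP h1.
move=> /eqP; rewrite mulf_eq0 oppr_eq0 !mulf_eq0 (gt_eqF sg0) (gt_eqF r0) !orbF.
have -> /= : (e == 0) = false by case: e_sign => ->; rewrite ?oppr_eq0 oner_eq0.
rewrite subr_eq0 => /eqP h2.
have h3 : r * sin (sg * x) = sin (b' * x).
  have -> : sin (b' * x) = e * sin (x - sg * x).
    have -> : x - sg * x = e * (b' * x) by rewrite mulrA -b'E; ring.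
    by case: e_sign => ->; rewrite ?mul1r// !mulN1r sinN opprK.
  apply: (mulfI (lt0r_neq0 X0)).
  have : X * (r + e * cos x) * sin (sg * x) = e * cos (sg * x) * (X * sin x) by rewrite h1 h2; ring.
  by rewrite sinB => h; lra.
have Q1 : Q r x * sin (sg * x) ^+ 2 = sin x ^+ 2.
  have h4 : (r + e * cos x) * sin (sg * x) = e * (cos (sg * x) * sin x).
    apply: (mulfI (lt0r_neq0 X0)).
    have := congr1 (fun t => t * sin (sg * x)) h1; have := congr1 (fun t => e * cos (sg * x) * t) h2.
    by rewrite /=; lra.
  rewrite QE mulrDl -exprMn h4 exprMn expr2 ee mul1r exprMn cos2sin2; ring.
have lnr : ln r = ln (sin (b' * x)) - ln (sin (sg * x)).
  by rewrite -h3 lnM ?posrE//; ring.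
have lnQ : ln (Q r x) = 2 * (ln (sin x) - ln (sin (sg * x))).
  have := congr1 (@ln R) Q1; rewrite lnM ?posrE ?exprn_gt0// !lnXn//.
  by rewrite !mulr2n; lra.
have gx : g x = g gm.
  have := congr1 (@ln R) h2; rewrite !lnM ?posrE// ?mulr_gt0 ?powR_gt0// !ln_powR lnr lnQ.
  rewrite aE bE lnV ?posrE ?powR_gt0// ln_powR lnM ?posrE ?mulr_gt0 ?powR_gt0 ?invr_gt0//.
  rewrite lnM ?posrE ?powR_gt0// ln_powR lnV ?posrE//.
  rewrite /g gmE sin_pihalf ln1 -sE -c_sin.
  lra.
have xgm : x = gm.
  have [xgm|xgm|//] := ltgtP x gm.
    by have := g_mono x0 xgm gm_Phi; rewrite gx ltxx.
  by have := g_mono gm_gt0 xgm xPhi; rewrite gx ltxx.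
move: h3 Q1; rewrite xgm gmE sin_pihalf mulr1 expr1n mulr1 -c_sin -sE => rc Qs.
rewrite /E Qs gmE cos_pihalf mulr0 subr0 -powR_mulrn ?ltW// -powRrM.
by rewrite aE mulVf ?subrr// gt_eqF// powR_gt0.
Qed.

(** At a minimum the second derivative in the angle is nonnegative; combined with [Er r 0 = 0] this
    gives b' <= sg r and e (ln sg + ln (1 + e r)) >= 0. In the logarithm of the equation
    [Er r 0 = 0] these force [e * g gm] up to the limit of [e * g] at 0, against [g_at0]. *)
Let E_axis r d : 0 < r -> 0 < Q r 0 -> 0 < d -> Er r 0 = 0 ->
  ~ (forall x : R, `|x| < d -> E r 0 <= E r x).
Proof.
move=> r0 Q0 d0 Er0 Emin.
pose X := 2 * a * Q r 0 `^ (sg - 1); pose Y := b * r `^ (sg - 1).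
have X0 : 0 < X by rewrite !mulr_gt0// powR_gt0.
have Y0 : 0 < Y by rewrite !mulr_gt0// powR_gt0.
have rsg : r `^ sg = r * r `^ (sg - 1) by rewrite mulr_powRB1// ltW.
have QD : is_derive (0 : R) 1 (Ex r) (sg * r * e * (sg * Y - X)).
  rewrite /Ex /Q; derive => //.
  by rewrite !(sin0, cos0, mulr0) -/(Q r 0) /X /Y rsg /Q cos0; ring.
have posQ (x : R) : `|x| < 1 -> 0 < Q r x.
  have [->//|x0 x1] := eqVneq x 0.
  rewrite QE ltr_wpDl ?sqr_ge0// exprn_even_gt0//=.
  have : 0 < `|sin x|; last by rewrite normr_gt0.
  have sx : `|sin x| = sin `|x|.
    have [h|h] := leP 0 x.
      by rewrite (ger0_norm h) ger0_norm// sin_ge0_pi// h/=; move: x1 (pi_ge2 R); rewrite (ger0_norm h); lra.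
    rewrite (ltr0_norm h) sinN ler0_norm// -oppr_ge0 -sinN sin_ge0_pi//.
    by move: x1 (pi_ge2 R); rewrite (ltr0_norm h); lra.
  by rewrite sx sin_gt0_pi// normr_gt0 x0/=; move: x1 (pi_ge2 R); lra.
have := @second_derivative_min R (E r) (Ex r) 0 _ (Num.min 1 d) _ _ QD.
rewrite lt_min d0 ltr01 => /(_ isT) H.
have {H} : 0 <= sg * r * e * (sg * Y - X).
  apply: H => x; rewrite subr0 lt_min => /andP[x1 xd].
    exact: Ex_derive (posQ _ x1).
  exact: Emin.
rewrite -mulrA pmulr_rge0; last exact: mulr_gt0.
have : e * Er r 0 = 0 by rewrite Er0 mulr0.
rewrite (_ : e * Er r 0 = sg * (X * (1 + e * r) - Y)); last first.
  by rewrite /Er /X /Y cos0 mulr0 cos0; case: e_sign => ->; ring.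
move=> /eqP; rewrite mulf_eq0 gt_eqF//= subr_eq0 => /eqP YE eY.
have n0 : 0 < 1 + e * r by rewrite -(pmulr_rgt0 _ X0) YE.
have Qn : Q r 0 = (1 + e * r) ^+ 2 by rewrite /Q cos0; case: e_sign => ->; ring.
have gg : (2 * sg - 1) * ln (1 + e * r) + (1 - sg) * ln r = g gm.
  have := congr1 (@ln R) YE; rewrite /X /Y Qn !lnM ?posrE// ?mulr_gt0 ?powR_gt0 ?exprn_gt0//.
  rewrite !ln_powR lnXn// aE bE lnV ?posrE ?powR_gt0// ln_powR lnM ?posrE ?mulr_gt0 ?powR_gt0 ?invr_gt0//.
  rewrite lnM ?posrE ?powR_gt0// ln_powR lnV ?posrE//.
  by rewrite /g gmE sin_pihalf ln1 -sE -c_sin mulr2n; lra.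
have enu : 0 <= e * (sg * (1 + e * r) - 1).
  by rewrite -(pmulr_rge0 _ X0); move: eY; rewrite -YE; lra.
have := g_at0; rewrite -gg ltNge => /negP; apply.
have lnr : ln b' - ln sg <= ln r.
  have : b' <= sg * r by move: enu b'E; case: e_sign => ->; lra.
  by rewrite -ler_ln ?posrE ?mulr_gt0// lnM ?posrE//; lra.
have lnn : 0 <= e * (ln sg + ln (1 + e * r)).
  rewrite -lnM ?posrE//; move: enu n0; case: e_sign => ->; rewrite ?mul1r ?mulN1r => h n0.
    by rewrite ln_ge0//; lra.
  by rewrite oppr_ge0 ln_le0//; lra.
move: lnr lnn sg_half b'E b'_gt0; set l1 := ln b'; set l2 := ln sg; set l3 := ln r.
case: e_sign => ->; set l4 := ln _; nra.
Qed.

Let PhiN : e = -1 -> Phi = pi / sg.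
Proof. by move=> eE; rewrite PhiE eE ifN// lt_eqF//; lra. Qed.

Let Phi_lt_pi : e = -1 -> Phi < pi.
Proof. by move=> eE; rewrite PhiN// ltr_pdivrMr// ltr_pMr// eN1_gt. Qed.

Let pow1 (k : R) : 1 `^ k = 1 :> R. Proof. by rewrite powR1. Qed.

Let c_le1 : c <= 1.
Proof. by rewrite cE; case: e_sign => ->; rewrite ?opprK ?mul1r ?cos_le1// mulN1r lerNl cos_geN1. Qed.

Let s_le1 : s <= 1. Proof. by rewrite sE sin_le1. Qed.

Let a_ge1 : 1 <= a.
Proof.
rewrite aE invf_ge1 ?powR_gt0//.
by rewrite -[leRHS](pow1 (2 * sg)) ge0_ler_powR ?nnegrE ?mulr_ge0// ltW.
Qed.

Let b_ge2 : e = -1 -> 2 <= b.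
Proof.
move=> eE; have sg1 := eN1_gt eE.
rewrite bE ler_pdivlMr//; apply: (@le_trans _ _ 2); first by move: s_le1; lra.
rewrite ler_peMr// -opprB powRN invf_ge1 ?powR_gt0// -[leRHS](pow1 (sg - 1)).
by rewrite ge0_ler_powR ?nnegrE//; [lra|exact: ltW].
Qed.

Let Q_gt0 r x : 0 < x < pi -> 0 < Q r x.
Proof. by move=> xpi; rewrite QE ltr_wpDl ?sqr_ge0// exprn_gt0// sin_gt0_pi. Qed.

(** [Ex] is strictly positive at the last angle, so [E] is smaller just before it. The point
    excluded for e = 1 is the one where [Q] vanishes and the derivative formula fails. *)
Let E_top r d : 0 < r -> 0 < d -> (e = 1 -> r != 1) -> ~ (forall x, Phi - d < x < Phi -> E r Phi <= E r x).
Proof.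
move=> r0 d0 r1 Emin.
have Q0 : 0 < Q r Phi.
  case: e_sign => eE.
    rewrite QE PhiE eE eqxx cospi sinpi expr0n/= addr0 exprn_even_gt0//= mul1r subr_eq0.
    exact: r1.
  by apply: Q_gt0; rewrite (lt_trans gm_gt0 gm_Phi)/= Phi_lt_pi.
have [|x [xd xP]] := derive_gt0_left (Ex_derive r0 Q0) _ d0; last first.
  by rewrite ltNge Emin// xd.
case: e_sign => eE.
  have PE : Phi = pi by rewrite PhiE eE eqxx.
  rewrite /Ex PE sinpi !mulr0 oppr0 !mulr0 add0r eE mul1r !mulr_gt0 ?powR_gt0//.
  by apply: sin_gt0_pi; rewrite mulr_gt0//= gtr_pMl// e1_lt.
have PE : sg * Phi = pi by rewrite PhiN// mulrC divfK// gt_eqF.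
rewrite /Ex PE sinpi !mulr0 addr0 eE.
have -> : - (2 * -1 * r * sin Phi) = 2 * r * sin Phi by ring.
by rewrite !mulr_gt0 ?powR_gt0// sin_gt0_pi// (lt_trans gm_gt0 gm_Phi)/= Phi_lt_pi.
Qed.

(** At the angle pi - h one has Q <= h^2, so Q^sg <= h^(2 sg) is o(h) because 2 sg > 1, while - b
    cos (sg x) drops by an amount linear in h. *)
Let E_corner d : e = 1 -> 0 < d -> ~ (forall x, pi - d < x < pi -> E 1 pi <= E 1 x).
Proof.
move=> eE d0 Emin; have sg1 := e1_lt eE.
pose k := b * (sg * sin (sg * pi)).
have k0 : 0 < k.
  by rewrite !mulr_gt0// sin_gt0_pi// mulr_gt0//= gtr_pMl.
(* [k] is the slope of - b cos (sg x) at pi. With half of it removed the function still increases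
   there, so the drop over a step h exceeds k h / 2. *)
pose m x := - (b * cos (sg * x)) - k / 2 * x.
have mD : is_derive (pi : R) 1 m (k / 2).
  by rewrite /m; derive => //; rewrite /k; lra.
have [r r0 hr] : exists2 r, 0 < r & forall h, h != 0 -> `|h| < r -> 0 < h^-1 * (m (pi + h) - m pi).
  by apply: (is_derive_gt0_near mD); rewrite divr_gt0.
have p0 : 0 < 2 * sg - 1 by move: sg_half; lra.
have ka : 0 < k / (2 * a) by apply: divr_gt0 => //; apply: mulr_gt0.
have := @continuous_norm_powR R (2 * sg - 1) p0 0 => /(cvgr_lt _) /(_ (k / (2 * a))).
rewrite normr0 powR0 ?gt_eqF// => /(_ ka)/nbhs_ballP[u /= u0 hu].
pose h := Num.min r (Num.min u d) / 2.
have mu0 : 0 < Num.min r (Num.min u d) by rewrite !lt_min r0 u0.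
have mr : Num.min r (Num.min u d) <= r by rewrite ge_min lexx.
have mu : Num.min r (Num.min u d) <= u by rewrite !ge_min lexx !orbT.
have md : Num.min r (Num.min u d) <= d by rewrite !ge_min lexx !orbT.
have h0 : 0 < h by rewrite /h; lra.
have hhr : `|- h| < r by rewrite normrN gtr0_norm//; rewrite /h; lra.
have := hr (- h) _ hhr; rewrite oppr_eq0 gt_eqF// => /(_ isT).
rewrite nmulr_rgt0 ?invr_lt0 ?oppr_lt0// => mh.
have ah : a * h `^ (2 * sg - 1) < k / 2.
  have hb : ball 0 u h by rewrite /ball/= sub0r normrN gtr0_norm// /h; lra.
  have := hu h hb; rewrite /= gtr0_norm// ltr_pdivlMr ?mulr_gt0//.
  by rewrite mulrCA => ?; lra.
have hpi : pi - d < pi - h < pi by apply/andP; split; rewrite /h in h0 *; lra.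
have := Emin _ hpi; apply/negP; rewrite -ltNge /E /Q eE.
rewrite cospi (_ : 1 + 1 ^+ 2 + 2 * 1 * 1 * -1 = 0); last by ring.
rewrite powR0 ?gt_eqF// pow1.
have cE' : cos (pi - h) = - cos h by rewrite cosB cospi sinpi; ring.
have Qh : (1 + 1 ^+ 2 + 2 * 1 * 1 * cos (pi - h)) `^ sg <= h * h `^ (2 * sg - 1).
  have -> : h * h `^ (2 * sg - 1) = (h ^+ 2) `^ sg.
    by rewrite mulr_powRB1 ?mulr_gt0 ?(ltW h0)// powRrM powR_mulrn// ltW.
  apply: ge0_ler_powR; rewrite ?nnegrE ?sqr_ge0 ?(ltW sg0)//.
  - by rewrite cE'; move: (cos_le1 h); lra.
  - by have := cos_ge_quadratic h; rewrite cE'; lra.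
move: mh; rewrite /m => mh.
have : a * (1 + 1 ^+ 2 + 2 * 1 * 1 * cos (pi - h)) `^ sg <= h * (a * h `^ (2 * sg - 1)).
  by rewrite mulrCA ler_pM2l.
have : h * (a * h `^ (2 * sg - 1)) < h * (k / 2) by rewrite ltr_pM2l.
by move: mh; lra.
Qed.

(** A version of [E] that is continuous on the whole plane, for the extreme value theorem; the
    absolute values change nothing when r >= 0. *)
Let F (z : R * R) := a * `|Q z.1 z.2| `^ sg - 1 - e * b * `|z.1| `^ sg * cos (sg * z.2).

Let Q_ge0 r x : 0 <= Q r x. Proof. by rewrite QE addr_ge0// sqr_ge0. Qed.

Let FE r x : 0 <= r -> F (r, x) = E r x.
Proof. by move=> r0; rewrite /F /E/= !ger0_norm. Qed.

Let F_continuous : continuous F.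
Proof.
move=> z; have c1 : w.1 @[w --> z] --> z.1 by exact: cvg_fst.
have c2 : w.2 @[w --> z] --> z.2 by exact: cvg_snd.
have csg := @continuous_norm_powR R sg sg0.
have comp (f : R * R -> R) (h : R -> R) l : f w @[w --> z] --> l -> {for l, continuous h} ->
    h (f w) @[w --> z] --> h l.
  by move=> fl hl; exact: (cvg_comp f h fl hl).
have ccos k : cos (k * w.2) @[w --> z] --> cos (k * z.2).
  by apply: comp; [exact: cvgMr|exact: continuous_cos].
rewrite /F; apply: cvgB; last first.
  apply: cvgM; last exact: ccos.
  apply: cvgMr.
  exact: (comp _ _ _ c1 (csg _)).
apply: cvgB; last exact: cvg_cst.
apply: cvgMr.
apply: (comp _ (fun t : R => `|t| `^ sg) _ _ (csg _)).
rewrite /Q; apply: cvgD.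
  by apply: cvgD; [exact: cvg_cst|exact: cvgM].
apply: cvgM; first exact: cvgMr.
by have := ccos 1; under eq_fun do rewrite mul1r; rewrite mul1r.
Qed.

(** For B >= 4 one has Q >= (B - 1)^2 >= B (B / 2) at every angle, so a Q^sg exceeds (1 + b) B^sg as
    soon as (B / 2)^sg >= 1 + b. *)
Let E_large : exists2 B, 1 < B & forall x, 0 <= E B x.
Proof.
have [B B4 BB] : exists2 B : R, 4 <= B & 1 + b <= (B / 2) `^ sg.
  pose t := (1 + b) `^ (sg^-1).
  have b1 : 0 < 1 + b by rewrite addr_gt0.
  exists (Num.max 4 (2 * t)); first by rewrite le_max lexx.
  have -> : 1 + b = t `^ sg by rewrite -powRrM mulVf ?gt_eqF// powRr1// ltW.
  have m4 : 4 <= Num.max 4 (2 * t) by rewrite le_max lexx.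
  have m2 : 2 * t <= Num.max 4 (2 * t) by rewrite le_max lexx orbT.
  by rewrite ge0_ler_powR ?nnegrE ?powR_ge0 ?(ltW sg0)//; lra.
exists B; first by lra.
move=> x; have B0 : 0 < B by lra.
have BQ : B * (B / 2) <= Q B x.
  have : -1 <= e * cos x <= 1.
    by case: e_sign => ->; have := cos_le1 x; have := cos_geN1 x; lra.
  by rewrite QE => /andP[h1 h2]; have := sqr_ge0 (sin x); nra.
have B1 : 1 <= B `^ sg by rewrite -[leLHS](pow1 sg) ge0_ler_powR ?nnegrE ?(ltW sg0)//; lra.
have h : (1 + b) * B `^ sg <= a * Q B x `^ sg.
  have : B `^ sg * (B / 2) `^ sg <= Q B x `^ sg.
    by rewrite -powRM ?ge0_ler_powR ?nnegrE ?(ltW sg0)//; nra.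
  have q0 : 0 <= Q B x `^ sg by exact: powR_ge0.
  by move: a_ge1 BB B1; nra.
rewrite /E; have : e * b * B `^ sg * cos (sg * x) <= b * B `^ sg.
  have bB : 0 <= b * B `^ sg by rewrite mulr_ge0 ?powR_ge0// ltW.
  have : e * cos (sg * x) <= 1.
    by case: e_sign => ->; have := cos_le1 (sg * x); have := cos_geN1 (sg * x); lra.
  by nra.
by lra.
Qed.

(** A minimum of [E] over a rectangle is located. On the edges r = 0 and r = B the sign is clear,
    the edges x = 0 and x = Phi are excluded or checked directly, and an interior minimum is
    critical, hence has value 0. *)
Lemma trigonometric_power_inequality r x : 0 <= r <= 1 -> 0 <= x <= Phi ->
  1 + e * b * r `^ sg * cos (sg * x) <= a * (1 + r ^+ 2 + 2 * e * r * cos x) `^ sg.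
Proof.
move=> /andP[r0 r1] xP; suff : 0 <= E r x by rewrite /E /Q; lra.
(* The rectangle extends to some B > 1, which makes r = 1 interior; on the edge r = 1 itself the
   sign of [E] would not be known. *)
have [B B1 EB] := E_large.
pose K := `[0, B]%classic `*` `[0, Phi]%classic.
have P0 := lt_trans gm_gt0 gm_Phi.
have [|||[r' x'] /= ] := @compact_EVT_min _ R F K.
- by exists (0, 0); split; rewrite /= in_itv/= lexx ltW//; lra.
- by apply: compact_setX; exact: segment_compact.
- exact: continuous_subspaceT F_continuous.
rewrite inE => -[/=]; rewrite !in_itv/= => /andP[r'0 r'B] /andP[x'0 x'P] Fmin.
have {Fmin} Emin t y : 0 <= t <= B -> 0 <= y <= Phi -> E r' x' <= E t y.
  move=> tB yP; rewrite -!FE//; last by case/andP: tB.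
  by apply: Fmin; rewrite inE; split; rewrite /= in_itv.
suff : 0 <= E r' x' by move=> h; apply: (le_trans h); apply: Emin => //; rewrite r0/=; lra.
move: r'0; rewrite le_eqVlt => /predU1P[r'E|r'0].
  by rewrite /E /Q -r'E expr0n/= !mulr0 !mul0r !addr0 pow1 powR0 ?gt_eqF//; move: a_ge1; lra.
move: r'B; rewrite le_eqVlt => /predU1P[->|r'B]; first exact: EB.
have Er0 : 0 < Q r' x' -> Er r' x' = 0.
  move=> Q0; apply: (derive_local_min0 (Er_derive r'0 Q0) (e := Num.min r' (B - r'))).
    by rewrite lt_min r'0; lra.
  move=> t; rewrite lt_min ltr_norml ltr_norml => /andP[/andP[h1 h2] /andP[h3 h4]].
  by apply: Emin; [apply/andP; split; lra|rewrite x'0].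
move: x'0; rewrite le_eqVlt => /predU1P[x'E|x'0].
  (* On the axis [Q] vanishes only for e = -1 and r = 1, where E = b - 1 and b >= 2. *)
  have [Q0|Qn] := eqVneq (Q r' 0) 0.
    case: e_sign => eE; first by move: Q0; rewrite /Q eE cos0; nra.
    have r'1 : r' = 1 by move: Q0; rewrite /Q eE cos0; nra.
    rewrite /E -x'E Q0 r'1 pow1 powR0 ?gt_eqF// !mulr0 cos0 eE.
    by have := b_ge2 eE; lra.
  have Q0 : 0 < Q r' 0 by rewrite lt_def Qn Q_ge0.
  rewrite -x'E in Er0 Emin.
  exfalso; apply: (E_axis r'0 Q0 P0 (Er0 Q0)) => y yP.
  (* [E] is even in the angle, so a minimum on the edge x = 0 is a two-sided local minimum. *)
  have -> : E r' y = E r' `|y|.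
    have cosn k : 0 < k -> cos (k * `|y|) = cos (k * y).
      by move=> k0; rewrite -[in RHS]cos_norm normrM (gtr0_norm k0).
    by rewrite /E /Q cos_norm cosn.
  by apply: Emin; [rewrite !ltW|rewrite normr_ge0 ltW].
move: x'P; rewrite le_eqVlt => /predU1P[x'E|x'P].
  rewrite x'E in Emin *.
  have [/andP[/eqP eE /eqP r'1]|h] := boolP ((e == 1) && (r' == 1)).
    have PE : Phi = pi by rewrite PhiE eE eqxx.
    exfalso; apply: (E_corner eE P0); rewrite -PE => y /andP[y0 yP].
    by rewrite -r'1; apply: Emin; rewrite ?ltW// ?r'0//=; lra.
  exfalso; apply: (E_top r'0 P0).
    by move=> eE; move: h; rewrite eE eqxx.
  by move=> y /andP[y0 yP]; apply: Emin; rewrite !ltW//; lra.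
have xp : 0 < x' < pi by rewrite x'0 (lt_le_trans x'P).
have Q0 := Q_gt0 r' xp.
rewrite E_critical ?x'0//; first exact: Er0.
apply: (derive_local_min0 (Ex_derive r'0 Q0) (e := Num.min x' (Phi - x'))).
  by rewrite lt_min x'0; lra.
move=> t; rewrite lt_min ltr_norml ltr_norml => /andP[/andP[h1 h2] /andP[h3 h4]].
by apply: Emin; [rewrite !ltW|apply/andP; split; lra].
Qed.

End pointwise_inequality.

(** * Modulus and argument *)

Local Open Scope complex_scope.

Section complex_modulus.
Context {R : realType}.
Implicit Types (z w : R[i]) (x y t : R).

Lemma ReM z w : complex.Re (z * w) = complex.Re z * complex.Re w - complex.Im z * complex.Im w.
Proof. by case: z w => [a b] [c d]. Qed.

Lemma ImM z w : complex.Im (z * w) = complex.Re z * complex.Im w + complex.Im z * complex.Re w.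
Proof. by case: z w => [a b] [c d]. Qed.

Lemma ReD z w : complex.Re (z + w) = complex.Re z + complex.Re w.
Proof. by case: z w => [a b] [c d]. Qed.

Lemma ImD z w : complex.Im (z + w) = complex.Im z + complex.Im w.
Proof. by case: z w => [a b] [c d]. Qed.

Lemma ReN z : complex.Re (- z) = - complex.Re z. Proof. by case: z. Qed.
Lemma ImN z : complex.Im (- z) = - complex.Im z. Proof. by case: z. Qed.
Lemma ReJ z : complex.Re z^* = complex.Re z. Proof. by case: z. Qed.
Lemma ImJ z : complex.Im z^* = - complex.Im z. Proof. by case: z. Qed.

Lemma ReB z w : complex.Re (z - w) = complex.Re z - complex.Re w.
Proof. by rewrite ReD ReN. Qed.

Lemma ImB z w : complex.Im (z - w) = complex.Im z - complex.Im w.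
Proof. by rewrite ImD ImN. Qed.

Lemma Re_realM x z : complex.Re (x%:C * z) = x * complex.Re z.
Proof. by case: z => a b /=; rewrite mul0r subr0. Qed.

Lemma Im_realM x z : complex.Im (x%:C * z) = x * complex.Im z.
Proof. by case: z => a b /=; rewrite mul0r addr0. Qed.

Lemma complex_eqP z w :
  complex.Re z = complex.Re w -> complex.Im z = complex.Im w -> z = w.
Proof. by case: z w => [a b] [c d] /= -> ->. Qed.

Lemma sqr_cabs z : cabs z ^+ 2 = complex.Re z ^+ 2 + complex.Im z ^+ 2.
Proof. by case: z => a b; rewrite /cabs /= sqr_sqrtr// addr_ge0// sqr_ge0. Qed.

Lemma cabs_ge0 z : 0 <= cabs z.
Proof. by case: z => a b; rewrite /cabs /= sqrtr_ge0. Qed.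

Lemma cabsM z w : cabs (z * w) = cabs z * cabs w.
Proof. exact: ComplexField.Normc.normcM. Qed.

Lemma cabs0 : cabs (0 : R[i]) = 0.
Proof. exact: ComplexField.Normc.normc0. Qed.

Lemma cabs1 : cabs (1 : R[i]) = 1.
Proof. exact: ComplexField.Normc.normc1. Qed.

Lemma cabs_eq0 z : (cabs z == 0) = (z == 0).
Proof.
by apply/eqP/eqP => [/ComplexField.Normc.eq0_normc//|->]; exact: cabs0.
Qed.

Lemma cabs_gt0 z : (0 < cabs z) = (z != 0).
Proof. by rewrite lt_def cabs_eq0 cabs_ge0 andbT. Qed.

Lemma cabsD_le z w : cabs (z + w) <= cabs z + cabs w.
Proof. exact: le_normcD. Qed.

Lemma cabsN z : cabs (- z) = cabs z.
Proof. exact: normcN. Qed.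

Lemma cabsB z w : cabs (z - w) = cabs (w - z).
Proof. by rewrite -cabsN opprB. Qed.

Lemma cabsJ z : cabs z^* = cabs z.
Proof. by case: z => a b; rewrite /cabs /= sqrrN. Qed.

Lemma cabs_real x : cabs x%:C = `|x|.
Proof. by rewrite /cabs /= expr0n/= addr0 sqrtr_sqr. Qed.

Lemma norm_Re_le z : `|complex.Re z| <= cabs z.
Proof.
rewrite -ler_sqr ?nnegrE ?cabs_ge0// real_normK ?num_real// sqr_cabs.
by rewrite lerDl sqr_ge0.
Qed.

Lemma norm_Im_le z : `|complex.Im z| <= cabs z.
Proof.
rewrite -ler_sqr ?nnegrE ?cabs_ge0// real_normK ?num_real// sqr_cabs.
by rewrite lerDr sqr_ge0.
Qed.

Lemma cabs_le_ReIm z : cabs z <= `|complex.Re z| + `|complex.Im z|.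
Proof.
rewrite -ler_sqr ?nnegrE ?cabs_ge0 ?addr_ge0// sqr_cabs sqrrD !real_normK ?num_real//.
by rewrite -addrA lerD2l lerDr mulrn_wge0// mulr_ge0.
Qed.

Lemma cabs_distB z w : `|cabs z - cabs w| <= cabs (z - w).
Proof.
have h1 := cabsD_le (z - w) w; have h2 := cabsD_le (w - z) z.
rewrite !subrK in h1 h2; rewrite [cabs (w - z)]cabsB in h2.
by rewrite ler_norml; apply/andP; split; lra.
Qed.

Lemma sqr_cabsD z w :
  cabs (z + w^*) ^+ 2 = cabs z ^+ 2 + cabs w ^+ 2 + 2 * complex.Re (z * w).
Proof. by rewrite !sqr_cabs ReM ReD ImD ReJ ImJ; ring. Qed.

Lemma cabs_cisE t : cabs (cis t) = 1. Proof. exact/eqP/cabs_cis. Qed.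

Lemma cisD x y : cis (x + y) = cis x * cis y.
Proof. by apply: complex_eqP; rewrite ?ReM ?ImM /= ?cosD ?sinD 1?addrC. Qed.

Lemma cisN x : cis (- x) = (cis x)^*.
Proof. by rewrite /cis cosN sinN. Qed.

Lemma cis0 : cis (0 : R) = 1. Proof. by rewrite /cis cos0 sin0. Qed.

Lemma cisX x n : cis x ^+ n = cis (n%:R * x).
Proof.
elim: n => [|n ih]; first by rewrite mul0r cis0.
by rewrite exprS ih -cisD -natr1 mulrDl mul1r addrC.
Qed.

Lemma cos_acos_id x : 0 <= x <= pi -> acos (cos x) = x.
Proof. by move=> xP; rewrite cosK// in_itv. Qed.

Lemma acos_cos_le x : acos (cos x) <= `|x|.
Proof.
rewrite -cos_norm; have [h|h] := leP `|x| pi; first by rewrite cos_acos_id// normr_ge0.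
by rewrite (le_trans _ (ltW h))// acos_lepi// cos_geN1 cos_le1.
Qed.

Lemma acos_cos_reflect x : pi <= `|x| <= 2 * pi -> acos (cos x) = 2 * pi - `|x|.
Proof.
move=> /andP[h1 h2]; rewrite -cos_norm -[LHS](_ : acos (cos (2 * pi - `|x|)) = _).
  by rewrite cos_acos_id//; apply/andP; split; lra.
by congr acos; rewrite cosB mulr_natl cos2pi sin2pi mul1r mul0r addr0.
Qed.

(** For u = acos x >= v = acos y, cos v - cos u exceeds 1 - cos (u - v) by 4 sin (v / 2) sin ((u -
    v) / 2) cos (u / 2) >= 0. This is a modulus of continuity valid up to the end points, where the
    derivative of acos blows up. *)
Lemma acos_modulus x y : -1 <= x <= 1 -> -1 <= y <= 1 -> 1 - cos (acos x - acos y) <= `|x - y|.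
Proof.
wlog le : x y / acos y <= acos x => [h|] xI yI.
  have [|/ltW] := leP (acos y) (acos x); first by move=> /h; apply.
  by move=> /h/(_ yI xI); rewrite distrC -[acos x - acos y]opprB cosN.
have := acos_ge0 yI; have := acos_lepi xI.
have := acosK (_ : x \in `[-1, 1]); rewrite in_itv/= xI => /(_ isT).
have := acosK (_ : y \in `[-1, 1]); rewrite in_itv/= yI => /(_ isT).
move: (acos x) (acos y) le => u v vu <- <- up v0.
rewrite distrC; apply: le_trans (ler_norm _).
pose p := v / 2; pose q := (u - v) / 2.
have -> : u = p *+ 2 + q *+ 2 by rewrite /p /q; field.
have -> : v = p *+ 2 by rewrite /p; field.
have -> : p *+ 2 + q *+ 2 - p *+ 2 = q *+ 2 by ring.
rewrite -mulrnDl !cos_mulr2n cosD.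
have sp : 0 <= sin p by apply: sin_ge0_pi; rewrite /p; apply/andP; split; lra.
have sq : 0 <= sin q by apply: sin_ge0_pi; rewrite /q; apply/andP; split; lra.
have cpq : 0 <= cos (p + q).
  by apply: cos_ge0_pihalf; rewrite /p /q; apply/andP; split; lra.
have := mulr_ge0 (mulr_ge0 sp sq) cpq; rewrite cosD.
have := cos2Dsin2 p; have := cos2Dsin2 q.
move: (cos p) (sin p) (cos q) (sin q) => A B C D h1 h2 h3.
have -> : A ^+ 2 *+ 2 - 1 - ((A * C - B * D) ^+ 2 *+ 2 - 1) =
    1 - (C ^+ 2 *+ 2 - 1) + 4 * (B * D * (A * C - B * D)).
  have E1 : A ^+ 2 = 1 - B ^+ 2 by lra.
  have E2 : C ^+ 2 = 1 - D ^+ 2 by lra.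
  transitivity (A ^+ 2 *+ 2 - (A ^+ 2 * C ^+ 2 - B ^+ 2 * D ^+ 2) *+ 2 + 4 * (B * D * (A * C - B * D))); first by ring.
  by rewrite E1 E2; ring.
by rewrite lerDl mulr_ge0.
Qed.

Lemma continuous_acos_clamp : continuous (fun x => acos (Num.max (-1) (Num.min 1 x)) : R).
Proof.
have clampP x : -1 <= Num.max (-1) (Num.min 1 x) <= 1.
  by rewrite le_max lexx/= ge_max ge_min lexx/= andbT; lra.
have clamp_lip x y : `|Num.max (-1) (Num.min 1 x) - Num.max (-1) (Num.min 1 y)| <= `|x - y|.
  have m (a b : R) : Num.max (-1) (Num.min 1 a) = if a < -1 then -1 else if 1 < a then 1 else a.
    case: (ltP a (-1)) => ha; first by rewrite min_r ?max_l//; lra.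
    by case: (ltP 1 a) => hb; rewrite ?max_r//; lra.
  rewrite !(m _ 0); have := ler_norm (x - y); have := ler_norm (y - x); rewrite [`|y - x|]distrC.
  by case: (ltP x (-1)); case: (ltP y (-1)); try case: (ltP 1 x); try case: (ltP 1 y); move=> *;
    rewrite ler_norml; apply/andP; split; lra.
move=> x; apply/cvgrPdist_lt => e e0.
have pi0 := pi_gt0 R.
pose d := Num.min e pi.
have d0 : 0 < d by rewrite lt_min e0.
have dpi : d <= pi by rewrite ge_min lexx orbT.
have c0 : 0 < 1 - cos d.
  by rewrite subr_gt0 -[ltRHS](@cos0 R) ltr_cos// in_itv/= ?lexx ?(ltW d0)// ltW.
near=> y.
have yd : `|x - y| < 1 - cos d by near: y; exact: (@cvgr_dist_lt _ _ _ _ _ id x).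
set u := acos _; set v := acos _.
have := acos_modulus (clampP x) (clampP y); rewrite -/u -/v => h.
have {}h : 1 - cos (u - v) < 1 - cos d.
  by apply: le_lt_trans h _; apply: le_lt_trans (clamp_lip x y) yd.
apply: (@lt_le_trans _ _ d); last by rewrite ge_min lexx.
rewrite ltNge; apply/negP => duv.
move: h; apply/negP; rewrite -leNgt lerD2l lerN2 -[in leLHS]cos_norm.
have uv : `|u - v| <= pi.
  have := acos_ge0 (clampP x); have := acos_lepi (clampP x); have := acos_ge0 (clampP y); have := acos_lepi (clampP y).
  rewrite -/u -/v => h1 h2 h3 h4; rewrite ler_norml; apply/andP; split; lra.
have [->//|ne] := eqVneq d `|u - v|.
by apply: ltW; rewrite ltr_cos ?in_itv/= ?(ltW d0)// ?normr_ge0// lt_neqAle ne.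
Unshelve. all: by end_near. Qed.

Lemma polar z : z != 0 -> exists2 t, `|t| <= pi & z = (cabs z)%:C * cis t.
Proof.
move=> z0; have c0 : 0 < cabs z by rewrite cabs_gt0.
set r := cabs z in c0 *; have r2 : r ^+ 2 = _ := sqr_cabs z.
have xI : -1 <= complex.Re z / r <= 1.
  by rewrite -ler_norml normrM normfV (gtr0_norm c0) ler_pdivrMr// mul1r norm_Re_le.
pose t := acos (complex.Re z / r).
have ct : cos t = complex.Re z / r by rewrite acosK// in_itv.
have st : (r * sin t) ^+ 2 = complex.Im z ^+ 2.
  by rewrite exprMn sin2cos2 ct exprMn exprVn mulrBr mulr1 mulrC divfK ?r2; [ring|rewrite -r2 sqrf_eq0 gt_eqF].
move: (eqf_sqr (r * sin t) (complex.Im z)); rewrite st eqxx => /esym/orP[] /eqP E.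
  exists t; first by rewrite ger0_norm ?acos_ge0 ?acos_lepi.
  apply: complex_eqP; rewrite ?Re_realM ?Im_realM/=; last by rewrite E.
  by rewrite ct mulrC divfK ?gt_eqF.
exists (- t); first by rewrite normrN ger0_norm ?acos_ge0 ?acos_lepi.
rewrite cisN; apply: complex_eqP; rewrite ?Re_realM ?Im_realM/= ?mulrN ?E ?opprK//.
by rewrite ct mulrC divfK ?gt_eqF.
Qed.

End complex_modulus.

(** * The subharmonic minorant *)

Section minorant.
Context {R : realType}.
Implicit Types (z w : R[i]) (p t x y : R).

Definition exponent_sign p : R := if p <= 2 then 1 else -1.

(* The angle is measured from the positive axis if [p <= 2] and from the negative axis
   otherwise.  At [z = 0] the quotient is [0], which is harmless since [0 `^ (p / 2) = 0]. *)
Definition minorant p z : R := exponent_sign p * cabs z `^ (p / 2)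
  * cos (Num.min (p / 2 * acos (exponent_sign p * complex.Re z / cabs z)) pi).

Lemma exponent_signP p : exponent_sign p = 1 /\ p <= 2 \/ exponent_sign p = -1 /\ 2 < p.
Proof. by rewrite /exponent_sign; case: leP => h; [left|right]. Qed.

Lemma exponent_sign_sqr p : exponent_sign p * exponent_sign p = 1.
Proof. by case: (exponent_signP p) => -[-> _]; ring. Qed.

Lemma cos_quotient_bound p z : -1 <= exponent_sign p * complex.Re z / cabs z <= 1.
Proof.
rewrite -ler_norml; have [->|z0] := eqVneq z 0.
  by rewrite cabs0 invr0 mulr0 normr0.
have c0 : 0 < cabs z by rewrite cabs_gt0.
rewrite !normrM normfV (gtr0_norm c0) ler_pdivrMr// mul1r.
by case: (exponent_signP p) => -[-> _]; rewrite ?normrN normr1 mul1r norm_Re_le.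
Qed.

Lemma minorant0 p : 0 < p -> minorant p 0 = 0.
Proof. by move=> p0; rewrite /minorant cabs0 powR0 ?mulr0 ?mul0r// gt_eqF// divr_gt0. Qed.

Lemma norm_minorant_le p z : `|minorant p z| <= cabs z `^ (p / 2).
Proof.
rewrite /minorant !normrM (ger0_norm (powR_ge0 _ _)).
have -> : `|exponent_sign p| = 1 by case: (exponent_signP p) => -[-> _]; rewrite ?normrN normr1.
by rewrite mul1r ler_piMr ?powR_ge0// cos_max.
Qed.

Lemma minorant_polar p r t : 0 < r ->
  minorant p (r%:C * (exponent_sign p)%:C * cis t) =
  exponent_sign p * r `^ (p / 2) * cos (Num.min (p / 2 * acos (cos t)) pi).
Proof.
move=> r0; rewrite /minorant !cabsM !cabs_real cabs_cisE mulr1 (gtr0_norm r0).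
have -> : `|exponent_sign p| = 1 by case: (exponent_signP p) => -[-> _]; rewrite ?normrN normr1.
have -> : complex.Re (r%:C * (exponent_sign p)%:C * cis t) = r * (exponent_sign p * cos t).
  by rewrite -mulrA !Re_realM.
rewrite mulr1; congr (_ * cos (Num.min (_ * acos _) pi)).
by rewrite mulrCA [exponent_sign p * (_ * _)]mulrA exponent_sign_sqr mul1r mulrC mulKf// gt_eqF.
Qed.

(** Subharmonicity in the form used below: a harmonic branch of the (p / 2)-th power agrees with the
    minorant at z and lies below it for small rotations. For p <= 2 this survives the cut since
    folding an angle back into [0, pi] only raises the cosine; for p > 2 it survives the truncation
    since the truncated value is the largest possible one. *)
Lemma minorant_touch p z : 1 < p -> z != 0 -> exists2 k, 0 < k &
  exists2 b, minorant p z = cabs z `^ (p / 2) * cos b &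
  forall r y, 0 < r -> `|y| < k ->
    (cabs z * r) `^ (p / 2) * cos (b + p / 2 * y) <= minorant p (z * (r%:C * cis y)).
Proof.
move=> p1 z0; have pi0 := pi_gt0 R.
pose e := exponent_sign p; have [sg sgp] : exists sg, sg = p / 2 by exists (p / 2).
have sg0 : 0 < sg by rewrite sgp; lra.
have ee : (e%:C * e%:C : R[i]) = 1 by rewrite -[1]/(1%:C) -(exponent_sign_sqr p) -rmorphM.
have ez0 : e%:C * z != 0.
  by apply/eqP => h; move/eqP: z0; apply; rewrite -[z]mul1r -ee -mulrA h mulr0.
have [t tpi ezE] := polar ez0; rewrite -sgp.
have r1 : 0 < cabs z by rewrite cabs_gt0.
have zE : z = (cabs z)%:C * e%:C * cis t.
  have cE : cabs (e%:C * z) = cabs z.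
    by rewrite cabsM cabs_real; case: (exponent_signP p); rewrite -/e => -[-> _]; rewrite ?normrN normr1 mul1r.
  by rewrite -[LHS]mul1r -ee -mulrA ezE cE; ring.
have zyE r y : z * (r%:C * cis y) = (cabs z * r)%:C * e%:C * cis (t + y).
  by rewrite {1}zE cisD rmorphM/=; ring.
have touch (k b : R) : 0 < k -> e * cos (Num.min (sg * acos (cos t)) pi) = cos b ->
    (forall y, `|y| < k -> cos (b + sg * y) <= e * cos (Num.min (sg * acos (cos (t + y))) pi)) ->
  exists2 k, 0 < k & exists2 b, minorant p z = cabs z `^ sg * cos b &
    forall r y, 0 < r -> `|y| < k ->
    (cabs z * r) `^ sg * cos (b + sg * y) <= minorant p (z * (r%:C * cis y)).
  move=> k0 h0 hy; exists k => //; exists b.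
    by rewrite {1}zE minorant_polar// -/e -sgp mulrAC h0 mulrC.
  move=> r y r0 yk; rewrite zyE minorant_polar ?mulr_gt0// -/e -sgp.
  by rewrite (mulrC e) -[_ * e * _]mulrA ler_wpM2l ?powR_ge0// hy.
have acos_t : acos (cos t) = `|t| by rewrite -cos_norm cos_acos_id// normr_ge0.
have cosn (k u : R) : 0 < k -> cos (k * `|u|) = cos (k * u).
  by move=> k0; rewrite -[in RHS]cos_norm normrM (gtr0_norm k0).
have acosP (u : R) : 0 <= acos (cos u) <= pi by rewrite acos_ge0 ?acos_lepi// cos_geN1 cos_le1.
have [[eE p2]|[eE p2]] := exponent_signP p; rewrite -/e in eE.
  have sg1 : sg <= 1 by rewrite sgp; lra.
  have smin u : Num.min (sg * acos (cos u)) pi = sg * acos (cos u).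
    have /andP[h1 h2] := acosP u.
    by rewrite min_l// (le_trans _ h2)// ler_piMl.
  have [sgE|sgN] := eqVneq sg 1.
    apply: (touch 1 t) => //; first by rewrite smin eE acos_t cosn// sgE !mul1r.
    move=> y _; rewrite smin eE sgE !mul1r acosK// in_itv/=.
    by rewrite cos_geN1 cos_le1.
  have sgl : sg < 1 by rewrite lt_neqAle sgN.
  (* This radius keeps sg |t + y| at most pi, where the cosine is decreasing. *)
  apply: (touch (pi / sg - pi) (sg * t)).
  - by rewrite subr_gt0 ltr_pdivlMr// gtr_pMr.
  - by rewrite smin eE acos_t cosn// mul1r.
  move=> y yk; rewrite smin eE mul1r -mulrDr -cosn//.
  have tyP : sg * `|t + y| <= pi.
    rewrite mulrC -ler_pdivlMr//; have := ler_normD t y; lra.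
  have h := acos_cos_le (t + y); have /andP[h1 h2] := acosP (t + y).
  have [->//|ne] := eqVneq (sg * `|t + y|) (sg * acos (cos (t + y))).
  have hl : sg * acos (cos (t + y)) <= sg * `|t + y| by rewrite ler_pM2l.
  apply: ltW; rewrite ltr_cos ?in_itv/= ?mulr_ge0 ?(ltW sg0)//; first by rewrite lt_neqAle eq_sym ne.
  exact: le_trans tyP.
have sg1 : 1 < sg by rewrite sgp; lra.
have psg : pi / sg < pi by rewrite ltr_pdivrMr// ltr_pMr.
have [h|h] := leP (sg * `|t|) pi.
  (* This radius keeps |t + y| at most pi, so that no folding occurs; the shift by pi absorbs the
     sign e = -1. *)
  apply: (touch (pi - pi / sg) (sg * t + pi)).
  - by rewrite subr_gt0.
  - by rewrite acos_t min_l// cosn// eE cosDpi mulN1r.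
  move=> y yk; rewrite eE mulN1r addrAC cosDpi lerN2 -mulrDr.
  have tl : `|t| <= pi / sg by rewrite ler_pdivlMr// mulrC.
  have ty : `|t + y| <= pi by have := ler_normD t y; lra.
  rewrite -(cosn sg)// -[cos (t + y)]cos_norm cos_acos_id ?normr_ge0//.
  have [h'|h'] := leP (sg * `|t + y|) pi; first by [].
  by rewrite cospi cos_geN1.
(* In the truncated sector the minorant is |v|^(p / 2), which dominates the branch with b = 0; the
   radius is the angular distance to the edge of the sector. *)
apply: (touch (`|t| - pi / sg) 0).
- by rewrite subr_gt0 ltr_pdivrMr// mulrC.
- by rewrite acos_t min_r ?(ltW h)// eE cospi cos0; ring.
move=> y yk; rewrite add0r.
have h3 : pi / sg <= acos (cos (t + y)).
  have h1 := ler_normD t y; have h2 := lerB_normD t y.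
  have [h4|h4] := leP `|t + y| pi.
    by rewrite -cos_norm cos_acos_id ?normr_ge0//; lra.
  have ps0 : 0 < pi / sg by rewrite divr_gt0.
  have h5 : pi <= `|t + y| <= 2 * pi by apply/andP; split; lra.
  by rewrite acos_cos_reflect//; lra.
rewrite min_r; last by rewrite mulrC -ler_pdivrMr.
by rewrite eE cospi mulN1r opprK cos_le1.
Qed.

Lemma minorant_continuous p : 0 < p ->
  continuous (fun v : R * R => minorant p (v.1 +i* v.2)).
Proof.
move=> p0; have sg0 : 0 < p / 2 by rewrite divr_gt0.
have cabs_cont : continuous (fun v : R * R => cabs (v.1 +i* v.2)).
  move=> v; rewrite /cabs/=.
  have c1 : w.1 @[w --> v] --> v.1 by exact: cvg_fst.
  have c2 : w.2 @[w --> v] --> v.2 by exact: cvg_snd.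
  apply: (@cvg_comp _ _ _ (fun w : R * R => w.1 ^+ 2 + w.2 ^+ 2) Num.sqrt).
    by apply: cvgD; [exact: (cvgM c1 c1)|exact: (cvgM c2 c2)].
  exact: sqrt_continuous.
have pow_cont : continuous (fun v : R * R => cabs (v.1 +i* v.2) `^ (p / 2)).
  move=> v; have -> : (fun v : R * R => cabs (v.1 +i* v.2) `^ (p / 2)) =
      (fun v => `|cabs (v.1 +i* v.2)| `^ (p / 2)).
    by apply/funext => w; rewrite ger0_norm ?cabs_ge0.
  by apply: (cvg_comp (fun w : R * R => cabs (w.1 +i* w.2)) (fun t : R => `|t| `^ (p / 2)) (cabs_cont v));
    exact: continuous_norm_powR.
move=> v; have [v0|v0] := eqVneq (v.1 +i* v.2) 0.
  rewrite /continuous_at v0 minorant0//.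
  have := pow_cont v; rewrite /continuous_at v0 cabs0 powR0 ?gt_eqF// => h.
  apply/norm_cvg0P; apply: (squeeze_cvgr _ (cvg_cst 0) h).
  by near=> w; rewrite normr_ge0 norm_minorant_le.
pose H x : R := cos (Num.min (p / 2 * acos (Num.max (-1) (Num.min 1 x))) pi).
have H_cont : continuous H.
  move=> x; apply: (cvg_comp (fun x => Num.min (p / 2 * acos (Num.max (-1) (Num.min 1 x))) pi) cos);
    last exact: continuous_cos.
  apply: (@continuous_min R R (fun x => p / 2 * acos (Num.max (-1) (Num.min 1 x))) (cst pi) x).
    by apply: cvgMr; exact: continuous_acos_clamp.
  exact: cst_continuous.
pose q (w : R * R) := exponent_sign p * w.1 / cabs (w.1 +i* w.2).
have mE : (fun w : R * R => minorant p (w.1 +i* w.2)) =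
    (fun w : R * R => exponent_sign p * cabs (w.1 +i* w.2) `^ (p / 2) * H (q w)).
  apply/funext => w; rewrite /minorant/= /H /q; congr (_ * _).
  have /andP[h1 h2] := cos_quotient_bound p (w.1 +i* w.2); rewrite /= in h1 h2.
  by rewrite (min_r h2) (max_r h1).
have q_cont : q w @[w --> v] --> q v.
  apply: cvgM; first by apply: cvgMr; exact: cvg_fst.
  by apply: cvgV; [rewrite cabs_eq0|exact: cabs_cont].
have mv := congr1 (fun f => f v) mE; rewrite /= in mv.
rewrite /continuous_at mv mE; apply: cvgM.
  by apply: cvgMr; exact: pow_cont.
have Hq : H (q w) @[w --> v] --> H (q v) by apply: cvg_comp q_cont _; exact: H_cont.
exact: Hq.
Unshelve. all: by end_near. Qed.

End minorant.

(** * The pointwise inequality for complex numbers *)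

Section pointwise_complex.
Context {R : realType}.
Implicit Types (z w : R[i]) (p : R).

Lemma minorant_cos p z : 0 < p -> exists2 x, 0 <= x <= pi &
  [/\ complex.Re z = exponent_sign p * cos x * cabs z &
      minorant p z = exponent_sign p * cabs z `^ (p / 2) * cos (Num.min (p / 2 * x) pi)].
Proof.
move=> p0; have I := cos_quotient_bound p z.
exists (acos (exponent_sign p * complex.Re z / cabs z)); first by rewrite acos_ge0 ?acos_lepi.
split=> //; rewrite acosK ?in_itv//=.
have [->|z0] := eqVneq z 0; first by rewrite cabs0 mulr0.
rewrite -mulrA divfK ?cabs_eq0// mulrA.
by rewrite exponent_sign_sqr mul1r.
Qed.

Lemma sqr_powR_half (x p : R) : 0 <= x -> (x ^+ 2) `^ (p / 2) = x `^ p.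
Proof. by move=> x0; rewrite -powR_mulrn// -powRrM mulrC divfK. Qed.

(** Since |w + conj z|^2 = |w|^2 + |z|^2 + 2 Re (w z), division by |w|^p leaves the trigonometric
    inequality with r = |z| / |w| and x the angle of w z, measured from the axis that the sign
    selects. *)
Let ordered_inequality p (b : R) : 1 < p -> p != 2 ->
  b = 2 * (- exponent_sign p * cos (pi / p)) `^ (1 - p / 2) / sin (pi / p) ->
  forall w z, cabs z <= cabs w ->
  cabs w `^ p <= (1 / sin (pi / p)) `^ p * cabs (w + z^*) `^ p - b * minorant p (w * z).
Proof.
move=> p1 p2 bE w z zw; have p0 : 0 < p by lra.
have pi0 := pi_gt0 R.
have [x /andP[x0 xpi] [xE ->]] := minorant_cos (w * z) p0.
move: bE xE; set e := exponent_sign p => bE xE.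
have e_sign : e = 1 \/ e = -1 by case: (exponent_signP p) => -[eE _]; [left|right].
have ee : e * e = 1 := exponent_sign_sqr p.
have [w0|w0] := eqVneq w 0.
  have z0 : z = 0 by apply/eqP; rewrite -cabs_eq0 eq_le cabs_ge0 andbT -(@cabs0 R) -w0.
  rewrite w0 z0 raddf0 addr0 mulr0 cabs0 !powR0 ?gt_eqF// ?divr_gt0//.
  by rewrite !mulr0 mul0r mulr0 subrr.
have cw : 0 < cabs w by rewrite cabs_gt0.
pose sg := p / 2; pose b' := e * (1 - sg).
have b'0 : 0 < b'.
  rewrite /b' /sg; case: (exponent_signP p) => -[eE h]; rewrite /e eE; last by lra.
  by move: p2 h; rewrite neq_lt => /orP[]; lra.
have b'E : 1 - sg = e * b' by rewrite /b' mulrA ee mul1r.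
have sgh : 1 / 2 < sg by rewrite /sg; lra.
have gmE : sg * (pi / p) = pi / 2 by rewrite /sg; field; rewrite gt_eqF.
set s := sin (pi / p) in bE *.
have s0 : 0 < s.
  by apply: sin_gt0_pi; rewrite divr_gt0//= ltr_pdivrMr// ltr_pMr.
pose Phi : R := if e == 1 then pi else pi / sg.
have Phi0 : 0 < Phi by rewrite /Phi; case: ifP => _ //; rewrite divr_gt0// /sg; lra.
pose a := (s `^ (2 * sg))^-1.
have sg2 : 2 * sg = p by rewrite /sg; field.
have aE : (1 / s) `^ p = a.
  by rewrite /a sg2 div1r -[in LHS]powR_inv1 ?(ltW s0)// -powRrM mulN1r powRN.
have a0 : 0 < a by rewrite /a invr_gt0 powR_gt0.
pose r := cabs z / cabs w.
have r01 : 0 <= r <= 1 by rewrite divr_ge0 ?cabs_ge0//= ler_pdivrMr// mul1r.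
have main y : 0 <= y <= Phi ->
    1 + e * b * r `^ sg * cos (sg * y) <= a * (1 + r ^+ 2 + 2 * e * r * cos y) `^ sg.
  by move=> yP; apply: (trigonometric_power_inequality sgh e_sign b'E b'0 gmE) yP.
have sg0 : 0 < sg by lra.
have eN : e = -1 -> (e == 1) = false by move=> ->; rewrite lt_eqF//; lra.
have Phi_top : e = -1 -> cos (sg * Phi) = -1.
  move=> eE; rewrite /Phi (eN eE).
  by rewrite mulrC divfK ?cospi// gt_eqF//; lra.
have {main} main : 1 + e * b * r `^ sg * cos (Num.min (sg * x) pi) <=
    a * (1 + r ^+ 2 + 2 * e * r * cos x) `^ sg.
  have [xP|xP] := leP x Phi.
    rewrite min_l; first by apply: main; rewrite x0.
    move: xP; rewrite /Phi; case: e_sign => eE.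
      rewrite eE eqxx => _; move: b'0; rewrite /b' eE => h.
      by apply: le_trans xpi; rewrite ler_piMl//; lra.
    by rewrite (eN eE) ler_pdivlMr ?sg0// mulrC.
  case: e_sign => eE; first by move: xP; rewrite /Phi eE eqxx ltNge xpi.
  (* Beyond [Phi] the left side keeps its value at [Phi], while for e = -1 the right side increases
     with the angle. *)
  rewrite min_r; last first.
    by move: xP; rewrite /Phi (eN eE) ltr_pdivrMr// [sg * _]mulrC => /ltW.
  rewrite cospi -(Phi_top eE); apply: (le_trans (main Phi _)); first by rewrite lexx ltW.
  rewrite ler_pM2l//; apply: ge0_ler_powR; rewrite ?nnegrE ?(ltW sg0)//.
  - have := cos_le1 Phi; have := cos_geN1 Phi; case/andP: r01; rewrite eE; nra.
  - have := cos_le1 x; have := cos_geN1 x; case/andP: r01; rewrite eE; nra.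
  have : cos x <= cos Phi by rewrite ltW// ltr_cos ?in_itv/= ?x0 ?xpi ?(ltW Phi0)// (ltW (lt_le_trans xP xpi)).
  by case/andP: r01; rewrite eE; nra.
have zr : cabs z = r * cabs w by rewrite /r divfK ?gt_eqF.
have nE : cabs (w + z^*) ^+ 2 = cabs w ^+ 2 * (1 + r ^+ 2 + 2 * e * r * cos x).
  by rewrite sqr_cabsD xE cabsM zr; ring.
rewrite aE -(@sqr_powR_half (cabs (w + z^*))) ?cabs_ge0// nE -/sg.
have q0 : 0 <= 1 + r ^+ 2 + 2 * e * r * cos x.
  by rewrite -(pmulr_rge0 _ (exprn_gt0 2 cw)) -nE sqr_ge0.
rewrite powRM ?sqr_ge0// cabsM zr.
have wE : (cabs w * (r * cabs w)) `^ sg = (cabs w ^+ 2) `^ sg * r `^ sg.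
  by rewrite mulrCA -expr2 powRM ?sqr_ge0// 1?mulrC//; case/andP: r01.
rewrite wE -(@sqr_powR_half (cabs w)) ?cabs_ge0// -/sg.
set W := (_ ^+ 2) `^ sg; have W0 : 0 <= W by exact: powR_ge0.
have := ler_wpM2l W0 main; rewrite mulrDr mulr1.
by lra.
Qed.

Lemma minorant_inequality p : 1 < p -> exists2 b, 0 <= b & forall w z,
  Num.max (cabs w) (cabs z) `^ p <=
  (1 / sin (pi / p)) `^ p * cabs (w + z^*) `^ p - b * minorant p (w * z).
Proof.
move=> p1; have p0 : 0 < p by lra.
have ordered b : (forall w z, cabs z <= cabs w ->
    cabs w `^ p <= (1 / sin (pi / p)) `^ p * cabs (w + z^*) `^ p - b * minorant p (w * z)) ->
    forall w z, Num.max (cabs w) (cabs z) `^ p <=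
      (1 / sin (pi / p)) `^ p * cabs (w + z^*) `^ p - b * minorant p (w * z).
  move=> H w z; have [zw|wz] := leP (cabs z) (cabs w); first exact: H.
  have := H z w (ltW wz); rewrite [z * w]mulrC.
  by rewrite -(cabsJ (z + w^*)) rmorphD/= conjcK [z^* + w]addrC.
(* At p = 2 the quantity b' = |1 - p / 2| degenerates to 0. The minorant is then Re, and expanding
   |w + conj z|^2 suffices. *)
have [p2|p2] := eqVneq p 2.
  exists 2 => //; apply: ordered => w z zw; rewrite p2.
  have -> : minorant 2 (w * z) = complex.Re (w * z).
    have two0 : 0 < 2 :> R by lra.
    have [x xP [-> ->]] := minorant_cos (w * z) two0.
    have [[-> _]|[_]] := exponent_signP (2 : R); last by rewrite ltxx.
    rewrite divff// powRr1 ?cabs_ge0// !mul1r min_l 1?mulrC//.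
    by case/andP: xP.
  rewrite sin_pihalf divr1 powR1 mul1r !powR_mulrn ?cabs_ge0// sqr_cabsD.
  by have := sqr_ge0 (cabs z); lra.
exists (2 * (- exponent_sign p * cos (pi / p)) `^ (1 - p / 2) / sin (pi / p)).
  rewrite divr_ge0// ?mulr_ge0 ?powR_ge0//.
  rewrite sin_ge0_pi// divr_ge0 ?(ltW p0) ?pi_ge0//=.
  by rewrite ler_pdivrMr// ler_peMr ?pi_ge0// ltW.
exact: ordered (ordered_inequality p1 p2 _).
Qed.

End pointwise_complex.

(** * The maximum principle *)

Section harmonic_local.
Context {R : realType}.

Lemma has_derive_cast (f : R -> R) (x a b : R) : has_derive f x a -> a = b -> has_derive f x b.
Proof. by move=> fa <-. Qed.

Lemma has_derive_poly_line (S : {poly R[i]}) (z d : R[i]) (t : R) :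
  is_derive t 1 (fun t : R => complex.Re S.[z + t%:C * d]) (complex.Re (d * S^`().[z + t%:C * d])) /\
  is_derive t 1 (fun t : R => complex.Im S.[z + t%:C * d]) (complex.Im (d * S^`().[z + t%:C * d])).
Proof.
elim/poly_ind: S => [|S c [ihr ihi]].
  by split; rewrite deriv0 horner0 mulr0;
    [rewrite (_ : (fun t => _) = fun=> 0)|rewrite (_ : (fun t => _) = fun=> 0)];
    do ?[exact: has_derive_const|by apply/funext => u; rewrite horner0].
have vr u : complex.Re (z + u%:C * d) = complex.Re z + u * complex.Re d.
  by rewrite ReD Re_realM.
have vi u : complex.Im (z + u%:C * d) = complex.Im z + u * complex.Im d.
  by rewrite ImD Im_realM.
have hvr : has_derive (fun u : R => complex.Re z + u * complex.Re d) t (complex.Re d).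
  by derive; ring.
have hvi : has_derive (fun u : R => complex.Im z + u * complex.Im d) t (complex.Im d).
  by derive; ring.
rewrite derivD derivC addr0 derivM derivX mulr1 hornerD hornerM hornerX.
have hE u : (S * 'X + c%:P).[z + u%:C * d] = S.[z + u%:C * d] * (z + u%:C * d) + c.
  by rewrite !hornerE.
split.
  rewrite (_ : (fun u => _) = (fun u => complex.Re S.[z + u%:C * d] * (complex.Re z + u * complex.Re d)
    - complex.Im S.[z + u%:C * d] * (complex.Im z + u * complex.Im d) + complex.Re c)); last first.
    by apply/funext => u; rewrite hE ReD ReM vr vi.
  have D := has_derive_add (has_derive_sub (has_derive_mul ihr hvr) (has_derive_mul ihi hvi))
    (has_derive_const (complex.Re c) t).
  apply: has_derive_eq D _.
  by rewrite !(Re_realM, Im_realM, ReD, ImD, ReM, ImM); ring.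
rewrite (_ : (fun u => _) = (fun u => complex.Re S.[z + u%:C * d] * (complex.Im z + u * complex.Im d)
  + complex.Im S.[z + u%:C * d] * (complex.Re z + u * complex.Re d) + complex.Im c)); last first.
  by apply/funext => u; rewrite hE ImD ImM vr vi.
have D := has_derive_add (has_derive_add (has_derive_mul ihr hvi) (has_derive_mul ihi hvr))
  (has_derive_const (complex.Im c) t).
apply: has_derive_eq D _.
by rewrite !(Re_realM, Im_realM, ReD, ImD, ReM, ImM); ring.
Qed.

(* Second derivative at [0] of [W * Re (exp (i b) * v ^ sg) + dl * ln |v| + E] where
   [v = A + i B] and [v 0 = 1]. *)
Lemma second_derivative_local_max (A A1 B B1 E E1 : R -> R) (A2 B2 E2 W sg b dl e : R) :
  (forall t : R, is_derive t 1 A (A1 t)) -> (forall t : R, is_derive t 1 B (B1 t)) ->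
  (forall t : R, is_derive t 1 E (E1 t)) ->
  is_derive (0 : R) 1 A1 A2 -> is_derive (0 : R) 1 B1 B2 -> is_derive (0 : R) 1 E1 E2 ->
  A 0 = 1 -> B 0 = 0 -> 0 < e ->
  (forall t : R, `|t| < e -> 0 < A t /\
    W * (A t ^+ 2 + B t ^+ 2) `^ (sg / 2) * cos (b + sg * atan (B t / A t))
      + dl / 2 * ln (A t ^+ 2 + B t ^+ 2) + E t <= W * cos b + E 0) ->
  W * sg * cos b * (sg * (A1 0 ^+ 2 - B1 0 ^+ 2) + (A2 + B1 0 ^+ 2 - A1 0 ^+ 2))
  - W * sg * sin b * (sg * (2 * A1 0 * B1 0) + (B2 - 2 * A1 0 * B1 0))
  + dl * (A2 + B1 0 ^+ 2 - A1 0 ^+ 2) + E2 <= 0.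
Proof.
move=> AD BD ED A2D B2D E2D A0 B0 e0 max.
pose g t := - (W * (A t ^+ 2 + B t ^+ 2) `^ (sg / 2) * cos (b + sg * atan (B t / A t))
      + dl / 2 * ln (A t ^+ 2 + B t ^+ 2) + E t).
pose n t := (A t ^+ 2 + B t ^+ 2).
(* [l] and [y] are the real and imaginary parts of v' / v, through which the derivatives of v^sg and
   of ln |v| are written. *)
pose l t := (A t * A1 t + B t * B1 t) * (n t)^-1.
pose y t := (A t * B1 t - A1 t * B t) * (n t)^-1.
pose g1 t := - (W * ((n t) `^ (sg / 2) * (sg * l t * cos (b + sg * atan (B t / A t))
   - sg * y t * sin (b + sg * atan (B t / A t)))) + dl * l t + E1 t).
have n0 (t : R) : `|t| < e -> 0 < n t.
  by move=> /max[At _]; rewrite /n ltr_pwDl ?sqr_ge0// exprn_gt0.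
have gD (t : R) : `|t| < e -> is_derive t 1 g (g1 t).
  move=> te; have [At _] := max t te; have nt := n0 t te.
  have hA : has_derive A t (A1 t) := AD t.
  have hB : has_derive B t (B1 t) := BD t.
  have hE : has_derive E t (E1 t) := ED t.
  have hn : has_derive n t (2 * A t * A1 t + 2 * B t * B1 t).
    exact: has_derive_add (has_derive_sqr hA) (has_derive_sqr hB).
  have hat : has_derive (fun t => atan (B t / A t)) t (y t).
    have hq := has_derive_mul hB (has_derive_invf (lt0r_neq0 At) hA).
    have := has_derive_atanf hq.
    move=> H; apply: (has_derive_cast H); rewrite /y /n.
    have -> : 1 + (B t / A t) ^+ 2 = (A t ^+ 2 + B t ^+ 2) / A t ^+ 2.
      by field; rewrite gt_eqF.
    by field; rewrite -/(n t) !gt_eqF.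
  have hp := @has_derive_powRf R n _ _ (sg / 2) nt hn.
  have hc := has_derive_cosf (has_derive_add (has_derive_const b t) (has_derive_mul (has_derive_const sg t) hat)).
  have hl := has_derive_lnf nt hn.
  have H := has_derive_opp (has_derive_add (has_derive_add
    (has_derive_mul (has_derive_mul (has_derive_const W t) hp) hc)
    (has_derive_mul (has_derive_const (dl / 2) t) hl)) hE).
  apply: has_derive_eq H _; rewrite /g1.
  have -> : n t `^ (sg / 2 - 1) = n t `^ (sg / 2) / n t.
    rewrite powRB; last by apply/implyP => _; rewrite gt_eqF.
    by rewrite powRr1// ltW.
  by rewrite /l /y; field; rewrite gt_eqF.
have dist0 (t : R) : `|t - 0| < e -> `|t| < e by rewrite subr0.
have nn0 : n 0 = 1 by rewrite /n A0 B0; ring.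
have e0' : `|0 : R| < e by rewrite normr0.
have g1D : is_derive (0 : R) 1 g1 (- (W * sg * cos b * (sg * (A1 0 ^+ 2 - B1 0 ^+ 2) + (A2 + B1 0 ^+ 2 - A1 0 ^+ 2))
  - W * sg * sin b * (sg * (2 * A1 0 * B1 0) + (B2 - 2 * A1 0 * B1 0))
  + dl * (A2 + B1 0 ^+ 2 - A1 0 ^+ 2) + E2)).
  have hA : has_derive A 0 (A1 0) := AD 0.
  have hB : has_derive B 0 (B1 0) := BD 0.
  have hA1 : has_derive A1 0 A2 := A2D.
  have hB1 : has_derive B1 0 B2 := B2D.
  have hE : has_derive E1 0 E2 := E2D.
  have hn : has_derive n 0 (2 * A1 0).
    apply: has_derive_cast (has_derive_add (has_derive_sqr hA) (has_derive_sqr hB)) _.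
    by rewrite A0 B0; ring.
  have nz : n 0 != 0 by rewrite nn0 oner_neq0.
  have hni := has_derive_invf nz hn.
  have hl : has_derive l 0 (A2 + B1 0 ^+ 2 - A1 0 ^+ 2).
    apply: has_derive_cast (has_derive_mul (has_derive_add (has_derive_mul hA hA1) (has_derive_mul hB hB1)) hni) _.
    by rewrite A0 B0 nn0; field.
  have hy : has_derive y 0 (B2 - 2 * A1 0 * B1 0).
    apply: has_derive_cast (has_derive_mul (has_derive_sub (has_derive_mul hA hB1) (has_derive_mul hA1 hB)) hni) _.
    by rewrite A0 B0 nn0; field.
  have hat : has_derive (fun t => atan (B t / A t)) 0 (B1 0).
    have Az : A 0 != 0 by rewrite A0 oner_neq0.
    apply: has_derive_cast (has_derive_atanf (has_derive_mul hB (has_derive_invf Az hA))) _.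
    by rewrite A0 B0; field.
  have nt : 0 < n 0 by rewrite nn0.
  have hp := @has_derive_powRf R n _ _ (sg / 2) nt hn.
  have harg := has_derive_add (has_derive_const b 0) (has_derive_mul (has_derive_const sg 0) hat).
  have hc := has_derive_cosf harg; have hs := has_derive_sinf harg.
  have H := has_derive_opp (has_derive_add (has_derive_add
    (has_derive_mul (has_derive_const W 0) (has_derive_mul hp
      (has_derive_sub (has_derive_mul (has_derive_mul (has_derive_const sg 0) hl) hc)
                      (has_derive_mul (has_derive_mul (has_derive_const sg 0) hy) hs))))
    (has_derive_mul (has_derive_const dl 0) hl)) hE).
  apply: has_derive_eq H _.
  rewrite /l /y /= nn0 !powR1 A0 B0 (mul0r 1^-1) atan0 (mulr0 sg) (addr0 b) invr1.
  by field.
have := second_derivative_min e0 (fun t te => gD t (dist0 t te)) g1D.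
suff h (t : R) : `|t - 0| < e -> g 0 <= g t by move=> /(_ h); lra.
  move=> /dist0 te; have [_] := max t te; rewrite /g.
  by rewrite A0 B0 (mul0r 1^-1) atan0 (mulr0 sg) (addr0 b) expr1n expr0n/= addr0 powR1 ln1; lra.
Qed.

End harmonic_local.

(** * The maximum principle for the minorant of a polynomial *)

Section maximum_principle.
Context {R : realType}.
Implicit Types (q P S : {poly R[i]}) (z h : R[i]).

Lemma polar_atan (A B : R) : 0 < A ->
  A +i* B = (Num.sqrt (A ^+ 2 + B ^+ 2))%:C * cis (atan (B / A)).
Proof.
move=> A0; have n0 : 0 < A ^+ 2 + B ^+ 2 by rewrite ltr_pwDl ?sqr_ge0// exprn_gt0.
have c : cos (atan (B / A)) = A / Num.sqrt (A ^+ 2 + B ^+ 2).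
  rewrite cos_atan.
  have -> : 1 + (B / A) ^+ 2 = (A ^+ 2 + B ^+ 2) / A ^+ 2 by field; rewrite gt_eqF.
  by rewrite sqrtrM ?(ltW n0)// sqrtrV ?sqr_ge0// sqrtr_sqr (gtr0_norm A0) invf_div.
have s : sin (atan (B / A)) = B / Num.sqrt (A ^+ 2 + B ^+ 2).
  have := atanK (B / A); rewrite /tan c => /(congr1 (fun t => t * (A / Num.sqrt (A ^+ 2 + B ^+ 2)))).
  rewrite divfK; last by rewrite mulf_neq0 ?invr_neq0 ?gt_eqF// sqrtr_gt0.
  by move=> ->; field; rewrite !gt_eqF// sqrtr_gt0.
by apply: complex_eqP; rewrite ?Re_realM ?Im_realM /= ?c ?s mulrC divfK// gt_eqF// sqrtr_gt0.
Qed.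

(** For dl > 0 the logarithm pushes maxima away from the zeros of q, where no branch of q^(p / 2) is
    available; it is harmonic elsewhere. For ep > 0 the last term makes the subharmonicity
    strict. *)
Let V p q P dl ep z := minorant p q.[z] + dl * ln (cabs q.[z]) - complex.Re P.[z] + ep * cabs z ^+ 2.

(** On the line z + t d the normalised polynomial [S] starts at 1, so for small t its argument is an
    atan. Replacing the minorant by the touching branch keeps t = 0 a local maximum and makes the
    function twice differentiable there. *)
Let directional p q P dl ep z d rho k b : 1 < p -> q.[z] != 0 -> 0 < rho -> cabs d = 1 -> 0 < k ->
  minorant p q.[z] = cabs q.[z] `^ (p / 2) * cos b ->
  (forall r y, 0 < r -> `|y| < k ->
    (cabs q.[z] * r) `^ (p / 2) * cos (b + p / 2 * y) <= minorant p (q.[z] * (r%:C * cis y))) ->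
  (forall h, cabs h < rho -> V p q P dl ep (z + h) <= V p q P dl ep z) ->
  let S := (q.[z])^-1 *: q in let W := cabs q.[z] `^ (p / 2) in
  let S1 := d * S^`().[z] in let S2 := d * d * S^`()^`().[z] in
  W * (p / 2) * cos b * (p / 2 * (complex.Re S1 ^+ 2 - complex.Im S1 ^+ 2)
    + (complex.Re S2 + complex.Im S1 ^+ 2 - complex.Re S1 ^+ 2))
  - W * (p / 2) * sin b * (p / 2 * (2 * complex.Re S1 * complex.Im S1)
    + (complex.Im S2 - 2 * complex.Re S1 * complex.Im S1))
  + dl * (complex.Re S2 + complex.Im S1 ^+ 2 - complex.Re S1 ^+ 2)
  + (- complex.Re (d * d * P^`()^`().[z]) + 2 * ep) <= 0.
Proof.
move=> p1 qz rho0 d1 k0 Mb touch Vmax /=; set S := (q.[z])^-1 *: q; set W := cabs q.[z] `^ (p / 2).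
set S1 := d * S^`().[z]; set S2 := d * d * S^`()^`().[z].
pose A (t : R) := complex.Re S.[z + t%:C * d]; pose B (t : R) := complex.Im S.[z + t%:C * d].
pose A1 (t : R) := complex.Re (d * S^`().[z + t%:C * d]).
pose B1 (t : R) := complex.Im (d * S^`().[z + t%:C * d]).
pose E (t : R) := - complex.Re P.[z + t%:C * d] + ep * cabs (z + t%:C * d) ^+ 2.
pose E1 (t : R) := - complex.Re (d * P^`().[z + t%:C * d])
  + ep * (2 * (complex.Re z * complex.Re d + complex.Im z * complex.Im d) + 2 * t).
have z0E : z + (0 : R)%:C * d = z by rewrite mul0r addr0.
have AD (t : R) : is_derive t 1 A (A1 t) by case: (has_derive_poly_line S z d t).
have BD (t : R) : is_derive t 1 B (B1 t) by case: (has_derive_poly_line S z d t).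
have Sz : S.[z] = 1 by rewrite hornerZ mulVf.
have A0 : A 0 = 1 by rewrite /A z0E Sz.
have B0 : B 0 = 0 by rewrite /B z0E Sz.
have dd : complex.Re d ^+ 2 + complex.Im d ^+ 2 = 1 by rewrite -sqr_cabs d1 expr1n.
have nE : (fun t : R => cabs (z + t%:C * d) ^+ 2) = (fun t => cabs z ^+ 2
    + (2 * (complex.Re z * complex.Re d + complex.Im z * complex.Im d) * t + t ^+ 2)).
  apply/funext => t; rewrite !sqr_cabs ReD ImD Re_realM Im_realM.
  have t2 : t ^+ 2 = t ^+ 2 * (complex.Re d ^+ 2 + complex.Im d ^+ 2) by rewrite dd mulr1.
  by rewrite [in RHS]t2; ring.
have Re_lin c (T : {poly R[i]}) (t : R) :
    is_derive t 1 (fun t : R => complex.Re (c * T.[z + t%:C * d])) (complex.Re (d * (c * T^`().[z + t%:C * d]))) /\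
    is_derive t 1 (fun t : R => complex.Im (c * T.[z + t%:C * d])) (complex.Im (d * (c * T^`().[z + t%:C * d]))).
  have := has_derive_poly_line (c *: T) z d t.
  rewrite derivZ hornerZ.
  by under eq_fun do rewrite hornerZ; under [X in _ /\ is_derive _ _ X _]eq_fun do rewrite hornerZ.
have ED (t : R) : is_derive t 1 E (E1 t).
  rewrite /E /E1; have [D1 _] := has_derive_poly_line P z d t.
  have D2 : has_derive (fun t : R => cabs (z + t%:C * d) ^+ 2) t
      (2 * (complex.Re z * complex.Re d + complex.Im z * complex.Im d) + 2 * t).
    by rewrite nE; derive; ring.
  have D := has_derive_add (has_derive_opp D1) (has_derive_mul (has_derive_const ep t) D2).
  by apply: has_derive_eq D _; ring.
have A2D : is_derive (0 : R) 1 A1 (complex.Re S2).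
  by have [D _] := Re_lin d S^`() 0; apply: has_derive_eq D _; rewrite z0E mulrA.
have B2D : is_derive (0 : R) 1 B1 (complex.Im S2).
  by have [_ D] := Re_lin d S^`() 0; apply: has_derive_eq D _; rewrite z0E mulrA.
have E2D : is_derive (0 : R) 1 E1 (- complex.Re (d * d * P^`()^`().[z]) + 2 * ep).
  have [D1 _] := Re_lin d P^`() 0.
  have D2 : has_derive (fun t : R => 2 * (complex.Re z * complex.Re d + complex.Im z * complex.Im d) + 2 * t) 0 2.
    by derive; ring.
  have D := has_derive_add (has_derive_opp D1) (has_derive_mul (has_derive_const ep 0) D2).
  by apply: has_derive_eq D _; rewrite z0E mulrA; ring.
have cA := is_derive_continuous (AD 0); have cB := is_derive_continuous (BD 0).
have [e e0 [erho eA]] : exists2 e, 0 < e & e <= rho /\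
    forall t : R, `|t| < e -> 0 < A t /\ `|atan (B t / A t)| < k.
  have catan : atan (B t / A t) @[t --> (0 : R)] --> (0 : R).
    have q0 : B t / A t @[t --> (0 : R)] --> B 0 / A 0.
      by apply: cvgM => //; apply: cvgV => //; rewrite A0 oner_neq0.
    have : atan (B t / A t) @[t --> (0 : R)] --> atan (B 0 / A 0).
      by apply: cvg_comp q0 _; exact: continuous_atan.
    by rewrite B0 mul0r atan0.
  have A0' : 0 < A 0 by rewrite A0.
  have /(_ _)/nbhs_ballP[e1 /= e10 h1] := cvgr_gt _ cA 0 A0'.
  have k0' : `|0 : R| < k by rewrite normr0.
  have /(_ _)/nbhs_ballP[e2 /= e20 h2] := cvgr_norm_lt _ catan k k0'.
  exists (Num.min rho (Num.min e1 e2)); first by rewrite !lt_min rho0 e10 e20.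
  split; first by rewrite ge_min lexx.
  move=> t; rewrite !lt_min => /and3P[_ t1 t2].
  by split; [apply: h1|apply: h2]; rewrite /ball/= sub0r normrN.
have := @second_derivative_local_max R A A1 B B1 E E1 _ _ _ W (p / 2) b dl e AD BD ED A2D B2D E2D A0 B0 e0.
rewrite /A1 /B1 z0E -/S1; apply => t te; have [At yk] := eA t te; split => //.
have n0 : 0 < A t ^+ 2 + B t ^+ 2 by rewrite ltr_pwDl ?sqr_ge0// exprn_gt0.
pose r := Num.sqrt (A t ^+ 2 + B t ^+ 2).
have r0 : 0 < r by rewrite sqrtr_gt0.
have r2 : A t ^+ 2 + B t ^+ 2 = r ^+ 2 by rewrite sqr_sqrtr// ltW.
have qE : q.[z + t%:C * d] = q.[z] * (r%:C * cis (atan (B t / A t))).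
  rewrite -polar_atan// /A /B.
  have -> : complex.Re S.[z + t%:C * d] +i* complex.Im S.[z + t%:C * d] = S.[z + t%:C * d].
    by case: (S.[_]).
  by rewrite /S hornerZ mulrA divff// mul1r.
have hr : cabs (t%:C * d) < rho.
  by rewrite cabsM d1 mulr1 cabs_real (lt_le_trans te).
have := Vmax _ hr; have := touch r _ r0 yk.
rewrite /V -qE Mb -/W (powRM _ (cabs_ge0 _) (ltW r0)) -/W.
have -> : cabs q.[z + t%:C * d] = cabs q.[z] * r.
  by rewrite qE !cabsM cabs_cisE mulr1 cabs_real (gtr0_norm r0).
have lnr2 : ln (r ^+ 2) = 2 * ln r by rewrite lnXn// mulr_natl.
rewrite lnM ?posrE ?cabs_gt0// r2 sqr_powR_half ?(ltW r0)// lnr2 /E z0E.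
by lra.
Qed.

(* Near a point where [q] does not vanish, a branch of [Re (C * q ^ (p / 2))] touches the minorant
   from below; being harmonic, it leaves only the strictly positive Laplacian of [ep * |z| ^ 2]. *)
Let no_interior_max p q P dl ep z rho : 1 < p -> q.[z] != 0 -> 0 < rho -> 0 < ep ->
  ~ (forall h, cabs h < rho -> V p q P dl ep (z + h) <= V p q P dl ep z).
Proof.
move=> p1 qz rho0 ep0 Vmax; have [k k0 [b Mb touch]] := minorant_touch p1 qz.
have c1 : cabs (1 : R[i]) = 1 := cabs1.
have ci : cabs ('i : R[i]) = 1 by rewrite /cabs /= expr0n expr1n add0r sqrtr1.
(* Apart from 2 ep, every term is the real part of a constant times d^2, so it changes sign between
   d = 1 and d = i. The sum of the two inequalities reads 4 ep <= 0. *)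
have := directional p1 qz rho0 c1 k0 Mb touch Vmax.
have := directional p1 qz rho0 ci k0 Mb touch Vmax.
have iRe w : complex.Re ('i * w) = - complex.Im w by case: w => u v /=; ring.
have iIm w : complex.Im ('i * w) = complex.Re w by case: w => u v /=; ring.
have ii : ('i : R[i]) * 'i = -1 by rewrite -expr2 sqr_i.
rewrite /= ii !iRe !iIm !mulN1r !ReN !ImN !mul1r.
move: (complex.Re _) (complex.Im _) (complex.Re _) (complex.Im _) (complex.Re _).
move: (_ `^ _) (cos _) (sin _) => W cb sb u v m n w.
lra.
Qed.

Lemma polynomial_continuous q :
  continuous (fun v : R * R => complex.Re q.[v.1 +i* v.2]) /\
  continuous (fun v : R * R => complex.Im q.[v.1 +i* v.2]).
Proof.
elim/poly_ind: q => [|q c [ihr ihi]].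
  split; [rewrite (_ : (fun v => _) = fun=> 0)|rewrite (_ : (fun v => _) = fun=> 0)];
    do ?[exact: cst_continuous|by apply/funext => v; rewrite horner0].
have hE (v : R * R) : (q * 'X + c%:P).[v.1 +i* v.2] = q.[v.1 +i* v.2] * (v.1 +i* v.2) + c.
  by rewrite !hornerE.
split=> v.
  rewrite (_ : (fun v => _) = (fun v : R * R => complex.Re q.[v.1 +i* v.2] * v.1
     - complex.Im q.[v.1 +i* v.2] * v.2 + complex.Re c)); last first.
    by apply/funext => w; rewrite hE ReD ReM.
  apply: cvgD; last exact: cvg_cst.
  by apply: cvgB; [apply: cvgM; [exact: ihr|exact: cvg_fst]|apply: cvgM; [exact: ihi|exact: cvg_snd]].
rewrite (_ : (fun v => _) = (fun v : R * R => complex.Re q.[v.1 +i* v.2] * v.2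
   + complex.Im q.[v.1 +i* v.2] * v.1 + complex.Im c)); last first.
  by apply/funext => w; rewrite hE ImD ImM.
apply: cvgD; last exact: cvg_cst.
by apply: cvgD; [apply: cvgM; [exact: ihr|exact: cvg_snd]|apply: cvgM; [exact: ihi|exact: cvg_fst]].
Qed.

Lemma cabs_continuous (T : topologicalType) (f : T -> R[i]) :
  continuous (fun v => complex.Re (f v)) -> continuous (fun v => complex.Im (f v)) ->
  continuous (fun v => cabs (f v)).
Proof.
move=> fr fi v.
have E : (fun v => cabs (f v)) = (fun v => Num.sqrt (complex.Re (f v) ^+ 2 + complex.Im (f v) ^+ 2)).
  by apply/funext => w; rewrite -sqr_cabs sqrtr_sqr ger0_norm// cabs_ge0.
have h : (complex.Re (f w) ^+ 2 + complex.Im (f w) ^+ 2) @[w --> v] -->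
    complex.Re (f v) ^+ 2 + complex.Im (f v) ^+ 2.
  by apply: cvgD; [exact: (cvgM (fr v) (fr v))|exact: (cvgM (fi v) (fi v))].
rewrite E; exact: (cvg_comp _ Num.sqrt h (@sqrt_continuous R _)).
Qed.

Lemma minorant_comp_continuous (T : topologicalType) (f : T -> R[i]) p : 0 < p ->
  continuous (fun v => complex.Re (f v)) -> continuous (fun v => complex.Im (f v)) ->
  continuous (fun v => minorant p (f v)).
Proof.
move=> p0 fr fi v.
have E w : minorant p (f w) = minorant p (complex.Re (f w) +i* complex.Im (f w)) by case: (f w).
have h : (complex.Re (f w), complex.Im (f w)) @[w --> v] --> (complex.Re (f v), complex.Im (f v)).
  exact: (cvg_pair (fr v) (fi v)).
have h2 := cvg_comp _ (fun w : R * R => minorant p (w.1 +i* w.2)) h (@minorant_continuous R p p0 _).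
rewrite /continuous_at E; apply: cvg_trans h2.
by apply: near_eq_cvg; near=> w; rewrite /= E.
Unshelve. all: by end_near. Qed.

Lemma closed_unit_disc : closed [set v : R * R | v.1 ^+ 2 + v.2 ^+ 2 <= 1].
Proof.
have c : continuous (fun v : R * R => v.1 ^+ 2 + v.2 ^+ 2).
  move=> v; apply: cvgD.
    by apply: (@cvgM _ _ _ _ (fun v : R * R => v.1) (fun v : R * R => v.1)); exact: cvg_fst.
  by apply: (@cvgM _ _ _ _ (fun v : R * R => v.2) (fun v : R * R => v.2)); exact: cvg_snd.
exact: (closed_comp (fun v _ => c v) (@closed_le R 1)).
Qed.

Lemma closed_unit_disc_compact : compact [set v : R * R | v.1 ^+ 2 + v.2 ^+ 2 <= 1].
Proof.
pose K := `[-1, 1]%classic `*` `[-1, 1]%classic : set (R * R).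
apply: (@subclosed_compact _ _ K); first exact: closed_unit_disc.
- by apply: compact_setX; exact: segment_compact.
move=> [x y] /= h; have := sqr_ge0 x; have := sqr_ge0 y => h1 h2.
split; rewrite /= in_itv/= -ler_norml -ler_sqr ?nnegrE// expr1n real_normK ?num_real//; lra.
Qed.

(** If the bound failed at z0 by [eta], then V z0 >= 3/4 eta for small [dl] and [ep], while V is
    smaller on the unit circle and on the level set |q| = kap. The maximum of V over the part of the
    disc with |q| >= kap would thus be interior, against [no_interior_max]. *)
Let subharmonic_le p q P z0 : 1 < p ->
  (forall t, minorant p q.[cis t] <= complex.Re P.[cis t]) ->
  q.[z0] != 0 -> cabs z0 <= 1 -> minorant p q.[z0] <= complex.Re P.[z0].
Proof.
move=> p1 bd qz0 z01; rewrite leNgt; apply/negP => lt0.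
have p0 : 0 < p by lra.
pose eta := minorant p q.[z0] - complex.Re P.[z0].
have eta0 : 0 < eta by rewrite subr_gt0.
pose D : set (R * R) := [set v | v.1 ^+ 2 + v.2 ^+ 2 <= 1].
have [qr qi] := polynomial_continuous q; have [Pr Pi] := polynomial_continuous P.
have qc := cabs_continuous qr qi.
have mc := minorant_comp_continuous p0 qr qi.
have Dne : D !=set0 by exists (0, 0); rewrite /D/= expr0n/= addr0.
have sq_cabs (v : R * R) : cabs (v.1 +i* v.2) ^+ 2 = v.1 ^+ 2 + v.2 ^+ 2 by rewrite sqr_cabs.
have disc z : cabs z <= 1 -> D (complex.Re z, complex.Im z).
  by move=> h; rewrite /D/= -sqr_cabs -[leRHS](expr1n _ 2) ler_sqr ?nnegrE ?cabs_ge0.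
have [B hB] : exists B, forall z, cabs z <= 1 -> minorant p q.[z] - complex.Re P.[z] <= B.
  have fc : continuous (fun v : R * R => minorant p q.[v.1 +i* v.2] - complex.Re P.[v.1 +i* v.2]).
    by move=> v; apply: cvgB; [exact: mc|exact: Pr].
  have [v _ vmax] := compact_EVT_max Dne closed_unit_disc_compact (continuous_subspaceT fc).
  exists (minorant p q.[v.1 +i* v.2] - complex.Re P.[v.1 +i* v.2]) => z /disc zD.
  by have := vmax (complex.Re z, complex.Im z); rewrite inE => /(_ zD) /=; case: z zD.
have [L L1 hL] : exists2 L, 1 <= L & forall z, cabs z <= 1 -> cabs q.[z] <= L.
  have [v _ vmax] := compact_EVT_max Dne closed_unit_disc_compact (continuous_subspaceT qc).
  exists (Num.max 1 (cabs q.[v.1 +i* v.2])); first by rewrite le_max lexx.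
  move=> z /disc zD; rewrite le_max; apply/orP; right.
  by have := vmax (complex.Re z, complex.Im z); rewrite inE => /(_ zD) /=; case: z zD.
have lnL : 0 <= ln L by rewrite ln_ge0.
have cq0 : 0 < cabs q.[z0] by rewrite cabs_gt0.
pose l0 := ln (cabs q.[z0]).
(* Taking dl = eta / (4 T) bounds both dl ln L, which matters on the circle, and dl |l0|, which
   matters at z0, by eta / 4. *)
pose T := 1 + ln L + `|l0|.
have T0 : 0 < T by rewrite /T; have := normr_ge0 l0; lra.
have [dl dl0 dlT] : exists2 dl, 0 < dl & dl * T = eta / 4.
  by exists (eta / 4 / T); [rewrite !divr_gt0|rewrite divfK ?gt_eqF].
have dll : - (eta / 4) <= dl * l0.
  by have := normr_ge0 l0; have := ler_norm (- l0); rewrite normrN; move: dlT; rewrite /T; nra.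
have dlL : dl * ln L <= eta / 4 by have := normr_ge0 l0; move: dlT; rewrite /T; nra.
have [ep ep0 epE] : exists2 ep, 0 < ep & ep = eta / 4 by exists (eta / 4) => //; rewrite divr_gt0.
pose W (v : R * R) := V p q P dl ep (v.1 +i* v.2).
(* [kap] is so small that dl ln kap outweighs the bound [B] for the other terms, and small enough
   for z0 to stay in the region. *)
have [kap kap0 [kapq kapB]] : exists2 kap, 0 < kap & kap <= cabs q.[z0] /\ B + dl * ln kap + ep < 3 / 4 * eta.
  exists (Num.min (cabs q.[z0]) (expR ((- `|B| - eta) / dl))).
    by rewrite lt_min cq0 expR_gt0.
  split; first by rewrite ge_min lexx.
  have h : ln (Num.min (cabs q.[z0]) (expR ((- `|B| - eta) / dl))) <= (- `|B| - eta) / dl.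
    rewrite -[leRHS]expRK ler_ln ?posrE ?expR_gt0 ?lt_min ?cq0 ?expR_gt0//.
    by rewrite ge_min lexx orbT.
  have : dl * ln (Num.min (cabs q.[z0]) (expR ((- `|B| - eta) / dl))) <= - `|B| - eta.
    by rewrite -ler_pdivlMl// [dl^-1 * _]mulrC.
  by have := ler_norm B; lra.
pose K : set (R * R) := D `&` [set v | kap <= cabs q.[v.1 +i* v.2]].
have Kc : compact K.
  apply: (@subclosed_compact _ _ D).
  - apply: closedI; last exact: (closed_comp (fun v _ => qc v) (@closed_ge R kap)).
    exact: closed_unit_disc.
  - exact: closed_unit_disc_compact.
  - by move=> v [].
have Kz0 : K (complex.Re z0, complex.Im z0).
  by split; [exact: disc|rewrite /=; case: z0 {bd qz0 z01 lt0 eta eta0 l0 T T0 dlT dll dlL epE kapB} cq0 kapq].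
have KWc : {within K, continuous W}.
  apply: continuous_in_subspaceT => v; rewrite inE => -[_ /= vq].
  have q0 : 0 < cabs q.[v.1 +i* v.2] := lt_le_trans kap0 vq.
  rewrite /W /V; apply: cvgD.
    apply: cvgB; last exact: Pr.
    apply: cvgD; first exact: mc.
    apply: cvgMr.
    exact: (cvg_comp _ (@ln R) (qc v) (continuous_ln q0)).
  apply: cvgMr; under eq_fun do rewrite sq_cabs; rewrite sq_cabs.
  apply: cvgD.
    by apply: (@cvgM _ _ _ _ (fun v : R * R => v.1) (fun v : R * R => v.1)); exact: cvg_fst.
  by apply: (@cvgM _ _ _ _ (fun v : R * R => v.2) (fun v : R * R => v.2)); exact: cvg_snd.
have [v1 + Wmax] := @compact_EVT_max _ R W K (ex_intro _ _ Kz0) Kc KWc.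
rewrite inE => -[v1D /= v1q]; pose z1 := v1.1 +i* v1.2.
have Wz0 : 3 / 4 * eta <= V p q P dl ep z1.
  have := Wmax (complex.Re z0, complex.Im z0); rewrite inE => /(_ Kz0).
  rewrite /W/= -/z1 => h; apply: le_trans h.
  have -> : complex.Re z0 +i* complex.Im z0 = z0 by case: (z0).
  rewrite /V -/l0; have : 0 <= ep * cabs z0 ^+ 2 by rewrite mulr_ge0 ?sqr_ge0// ltW.
  by rewrite /eta in dll *; lra.
have z1le : cabs z1 <= 1.
  by rewrite -ler_sqr ?nnegrE ?cabs_ge0// sq_cabs expr1n.
have qz1 : 0 < cabs q.[z1] := lt_le_trans kap0 v1q.
have epz : ep * cabs z1 ^+ 2 <= ep.
  by rewrite ler_piMr ?(ltW ep0)// -[leRHS](expr1n _ 2) ler_sqr ?nnegrE ?cabs_ge0.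
have z1lt : cabs z1 < 1.
  rewrite lt_neqAle z1le andbT; apply/negP => /eqP z1E.
  have z1n : z1 != 0 by rewrite -cabs_eq0 z1E oner_neq0.
  have [t _ tE] := polar z1n; rewrite z1E mul1r in tE.
  have := bd t; rewrite -tE => h.
  have : ln (cabs q.[z1]) <= ln L by rewrite ler_ln ?posrE ?hL//; lra.
  move=> lq; have : dl * ln (cabs q.[z1]) <= dl * ln L by rewrite ler_pM2l.
  by move: Wz0; rewrite /V; lra.
have q1lt : kap < cabs q.[z1].
  rewrite lt_neqAle v1q andbT; apply/negP => /eqP kE.
  have := hB _ z1le; move: Wz0; rewrite /V -kE; lra.
have /(_ _)/nbhs_ballP[r1 /= r10 h1] := cvgr_gt _ (qc v1) _ q1lt.
pose rho := Num.min r1 (1 - cabs z1).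
have rho0 : 0 < rho by rewrite lt_min r10 subr_gt0.
apply: (@no_interior_max p q P dl ep z1 rho p1 _ rho0 ep0); first by rewrite -cabs_gt0.
move=> h hr; have h1r : cabs h < r1 by rewrite (lt_le_trans hr)// ge_min lexx.
have h2r : cabs h < 1 - cabs z1 by rewrite (lt_le_trans hr)// ge_min lexx orbT.
pose v := (v1.1 + complex.Re h, v1.2 + complex.Im h).
have vE : v.1 +i* v.2 = z1 + h by rewrite /v /z1; case: (h).
have Kv : K v.
  split.
    rewrite /D/= -[_ + _]/(v.1 ^+ 2 + v.2 ^+ 2) -sq_cabs vE -[leRHS](expr1n _ 2) ler_sqr ?nnegrE ?cabs_ge0//.
    by have := cabsD_le z1 h; lra.
  rewrite /=; apply: ltW; apply: (h1 v); split; rewrite /= /ball/= opprD addNKr normrN.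
    exact: le_lt_trans (norm_Re_le h) h1r.
  exact: le_lt_trans (norm_Im_le h) h1r.
by have := Wmax v; rewrite inE => /(_ Kv); rewrite /W vE.
Qed.

(** The origin is a zero of q, where [subharmonic_le] does not apply. If Re P were negative at 0,
    continuity would put it below the minorant near 0, so q would vanish at all small positive
    reals. *)
Lemma minorant_max_principle p q P : 1 < p -> q != 0 -> q.[0] = 0 ->
  (forall t, minorant p q.[cis t] <= complex.Re P.[cis t]) -> 0 <= complex.Re P.[0].
Proof.
move=> p1 qn0 q0 bd; rewrite leNgt; apply/negP => P0.
have p0 : 0 < p by lra.
have [qr qi] := polynomial_continuous q; have [Pr _] := polynomial_continuous P.
have mc := minorant_comp_continuous p0 qr qi.
have fc : continuous (fun v : R * R => complex.Re P.[v.1 +i* v.2] - minorant p q.[v.1 +i* v.2]).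
  by move=> v; apply: cvgB; [exact: Pr|exact: mc].
have f0 : complex.Re P.[0 +i* 0] - minorant p q.[0 +i* 0] < 0.
  by rewrite -[0 +i* 0]/(0 : R[i]) q0 minorant0// subr0.
have /(_ _)/nbhs_ballP[r /= r0 hr] := cvgr_lt _ (fc (0, 0)) 0 f0.
have small x : 0 < x -> x < r -> x <= 1 -> root q (x%:C).
  move=> x0 xr x1; apply/negPn/negP => qx.
  have xc : cabs (x%:C : R[i]) <= 1 by rewrite cabs_real gtr0_norm.
  have := subharmonic_le p1 bd qx xc.
  have : complex.Re P.[x +i* 0] - minorant p q.[x +i* 0] < 0.
    apply: (hr (x, 0)); split; rewrite /= /ball/= sub0r normrN ?normr0//.
    by rewrite gtr0_norm.
  by rewrite -[x +i* 0]/(x%:C); lra.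
pose m := Num.min r 1.
have m0 : 0 < m by rewrite lt_min r0 ltr01.
have mr : m <= r by rewrite ge_min lexx.
have m1 : m <= 1 by rewrite ge_min lexx orbT.
(* These are [size q] distinct roots, one more than the degree allows; k + 2 keeps each point
   strictly below m. *)
pose rs := [seq (m / (k.+2)%:R)%:C | k <- iota 0 (size q)].
have k2 (k : nat) : 1 < (k.+2%:R : R) by rewrite ltr1n.
have : (size rs < size q)%N.
  apply: max_poly_roots => //.
    apply/allP => _ /mapP[k _ ->].
    have mk : m / k.+2%:R < m by rewrite ltr_pdivrMr ?ltr_pMr//; apply: lt_trans (k2 k).
    by apply: small; [rewrite divr_gt0// (lt_trans _ (k2 k))|exact: lt_le_trans mr|exact: ltW (lt_le_trans mk m1)].
  rewrite map_inj_uniq ?iota_uniq// => i j /complexI /(mulfI (lt0r_neq0 m0)) /invr_inj /eqP.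
  by rewrite eqr_nat => /eqP[].
by rewrite size_map size_iota ltnn.
Qed.

End maximum_principle.

(** * Integration over the circle *)

Section arc_integral.
Context {R : realType}.
Local Notation mu := (@arc_measure R).
Local Notation leb := (@lebesgue_measure R).
Local Notation J := (`[0, 2 * pi]%classic : set R).
Implicit Types (f g h : R -> R).

(** The measure is carried by [0, 2 pi], so integrals and measurability are stated on the whole
    line. *)
Definition arc_integrable g := mu.-integrable setT (EFin \o g).
Definition arc_integral g : R := Rintegral mu setT g.

Let mJ : measurable (J : set (measurableTypeR R)). Proof. exact: measurable_itv. Qed.

Lemma pi2_gt0 : 0 < 2 * pi :> R. Proof. by rewrite mulr_gt0// pi_gt0. Qed.

Lemma arc_measureE A : mu A = leb (A `&` J). Proof. by []. Qed.

Lemma arc_measureT : mu setT = (2 * pi)%:E.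
Proof.
rewrite arc_measureE setTI lebesgue_measure_itv/= lte_fin pi2_gt0.
by rewrite -EFinB subr0.
Qed.

Lemma arc_measure_setC : mu (~` J) = 0%E.
Proof. by rewrite arc_measureE setICl measure0. Qed.

Lemma arc_integrableM g : arc_integrable g -> measurable_fun setT g.
Proof. by move=> /measurable_int/measurable_EFinP. Qed.

Lemma arc_integrable_bounded g M : measurable_fun setT g -> (forall t, `|g t| <= M) ->
  arc_integrable g.
Proof.
move=> mg gM; apply: measurable_bounded_integrable => //.
- by rewrite -[ltLHS]/(mu setT) arc_measureT ltry.
- by exists M; split; [exact: num_real|move=> x Mx t _; exact: le_trans (gM t) (ltW Mx)].
Qed.

Lemma arc_integrable_cst k : arc_integrable (fun=> k).
Proof. by apply: (@arc_integrable_bounded _ `|k|) => //; exact: measurable_cst. Qed.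

Lemma arc_integrableD f g : arc_integrable f -> arc_integrable g ->
  arc_integrable (fun t => f t + g t).
Proof.
by move=> fi gi; have := integrableD measurableT fi gi.
Qed.

Lemma arc_integrableZ k f : arc_integrable f -> arc_integrable (fun t => k * f t).
Proof. by move=> fi; have := integrableZl measurableT k fi. Qed.

Lemma arc_integrableN f : arc_integrable f -> arc_integrable (fun t => - f t).
Proof.
by move=> /(arc_integrableZ (-1)); under [fun t => -1 * _]eq_fun do rewrite mulN1r.
Qed.

Lemma arc_integrableB f g : arc_integrable f -> arc_integrable g ->
  arc_integrable (fun t => f t - g t).
Proof. by move=> fi gi; apply: arc_integrableD => //; exact: arc_integrableN. Qed.

Lemma arc_integrable_norm f : arc_integrable f -> arc_integrable (fun t => `|f t|).
Proof. by move=> fi; exact: integrable_norm. Qed.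

Lemma arc_integrable_le f g : measurable_fun setT f -> arc_integrable g ->
  (forall t, `|f t| <= g t) -> arc_integrable f.
Proof.
move=> mf gi fg; apply: (@le_integrable _ _ _ mu setT _ _ (EFin \o g)) => //.
  exact/measurable_EFinP.
by move=> t _ /=; rewrite lee_fin (le_trans (fg t))// ler_norm.
Qed.

Lemma arc_integrableM_bounded f g M : arc_integrable f -> measurable_fun setT g ->
  (forall t, `|g t| <= M) -> arc_integrable (fun t => f t * g t).
Proof.
move=> fi mg gM; apply: (@arc_integrable_le _ (fun t => M * `|f t|)).
- by apply: measurable_funM => //; exact: arc_integrableM.
- exact/arc_integrableZ/arc_integrable_norm.
- by move=> t; rewrite normrM mulrC ler_wpM2r.
Qed.

Lemma arc_integrable_sum (I : Type) (r : seq I) (F : I -> R -> R) :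
  (forall i, arc_integrable (F i)) -> arc_integrable (fun t => \sum_(i <- r) F i t).
Proof.
move=> Fi; elim: r => [|i r ih].
  by under eq_fun do rewrite big_nil; exact: arc_integrable_cst.
by under eq_fun do rewrite big_cons; exact: arc_integrableD.
Qed.

Lemma arc_integralD f g : arc_integrable f -> arc_integrable g ->
  arc_integral (fun t => f t + g t) = arc_integral f + arc_integral g.
Proof. by move=> fi gi; exact: RintegralD. Qed.

Lemma arc_integralB f g : arc_integrable f -> arc_integrable g ->
  arc_integral (fun t => f t - g t) = arc_integral f - arc_integral g.
Proof. by move=> fi gi; exact: RintegralB. Qed.

Lemma arc_integralZ k f : arc_integrable f ->
  arc_integral (fun t => k * f t) = k * arc_integral f.
Proof. by move=> fi; exact: RintegralZl. Qed.

Lemma arc_integral_sum (I : Type) (r : seq I) (F : I -> R -> R) :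
  (forall i, arc_integrable (F i)) ->
  arc_integral (fun t => \sum_(i <- r) F i t) = \sum_(i <- r) arc_integral (F i).
Proof.
move=> Fi; elim: r => [|i r ih].
  rewrite big_nil; under [X in arc_integral X]eq_fun do rewrite big_nil.
  by rewrite /arc_integral Rintegral_cst// mul0r.
rewrite big_cons; under [X in arc_integral X]eq_fun do rewrite big_cons.
by rewrite arc_integralD ?ih//; exact: arc_integrable_sum.
Qed.

Lemma arc_integral_cst k : arc_integral (fun=> k) = k * (2 * pi).
Proof. by rewrite /arc_integral Rintegral_cst// -[mu _]/(mu setT) arc_measureT. Qed.

Lemma arc_integralE g : arc_integrable g -> arc_integral g = fine (\int[leb]_(t in J) (g t)%:E).
Proof.
move=> gi; rewrite /arc_integral /Rintegral.
rewrite (@negligible_integral _ _ _ mu setT (~` J)) ?arc_measure_setC//; last exact: measurableC.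
rewrite setTD setCK; congr fine; apply: eq_measure_integral => A mA AJ.
by rewrite arc_measureE; congr (leb _); apply/setIidPl.
Qed.

(** The complement of [0, 2 pi] is null, so both functions may first be replaced by 0 there. *)
Lemma le_arc_integral f g : arc_integrable f -> arc_integrable g ->
  (forall t, 0 <= t <= 2 * pi -> f t <= g t) -> arc_integral f <= arc_integral g.
Proof.
move=> fi gi fg.
have dec u : arc_integrable u -> arc_integral u = arc_integral (u \_ J).
  move=> ui; rewrite /arc_integral -Rintegral_mkcond /Rintegral.
  rewrite (@negligible_integral _ _ _ mu setT (~` J)) ?arc_measure_setC//; last exact: measurableC.
  by rewrite setTD setCK.
have ri u : arc_integrable u -> arc_integrable (u \_ J).
  move=> ui; rewrite /arc_integrable -restrict_EFin.
  by apply/integrable_restrict => //; rewrite setTI; exact: integrableS ui.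
rewrite (dec f fi) (dec g gi); apply: le_Rintegral => //; [exact: ri|exact: ri|].
move=> t _; rewrite /patch; case: ifPn => // tJ.
by apply: fg; move: tJ; rewrite inE/= in_itv.
Qed.

Lemma arc_integral_ge0 f : (forall t, 0 <= f t) -> 0 <= arc_integral f.
Proof. by move=> f0; apply: Rintegral_ge0. Qed.

Lemma norm_arc_integral_le f : arc_integrable f -> `|arc_integral f| <= arc_integral (fun t => `|f t|).
Proof. by move=> fi; apply: le_normr_Rintegral. Qed.

Lemma eq_arc_integral f g : f =1 g -> arc_integral f = arc_integral g.
Proof. by move=> /funext ->. Qed.

Lemma continuous_measurable f : continuous f -> measurable_fun setT f.
Proof. exact: continuous_measurable_fun. Qed.

Lemma measurable_cosM (k : R) : measurable_fun setT (fun t : R => cos (k * t)).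
Proof.
apply: continuous_measurable_fun => t.
apply: (@continuous_comp _ _ _ (fun t : R => k * t) (@cos R)); last exact: continuous_cos.
exact: mulrl_continuous.
Qed.

Lemma measurable_sinM (k : R) : measurable_fun setT (fun t : R => sin (k * t)).
Proof.
apply: continuous_measurable_fun => t.
apply: (@continuous_comp _ _ _ (fun t : R => k * t) (@sin R)); last exact: continuous_sin.
exact: mulrl_continuous.
Qed.

Lemma arc_integrable_cos (k : R) : arc_integrable (fun t : R => cos (k * t)).
Proof. by apply: (@arc_integrable_bounded _ 1); [exact: measurable_cosM|move=> t; exact: cos_max]. Qed.

Lemma arc_integrable_sin (k : R) : arc_integrable (fun t : R => sin (k * t)).
Proof. by apply: (@arc_integrable_bounded _ 1); [exact: measurable_sinM|move=> t; exact: sin_max]. Qed.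

Lemma arc_integral_derive f F : (forall t : R, is_derive t 1 F (f t)) -> continuous f ->
  arc_integrable f -> arc_integral f = F (2 * pi) - F 0.
Proof.
move=> FD fc fi; rewrite arc_integralE// (@continuous_FTC2 _ f F 0 (2 * pi) pi2_gt0) -?EFinB//.
- exact: continuous_subspaceT.
- split.
  + by move=> t _; case: (FD t).
  + by apply: cvg_at_right_filter; exact: is_derive_continuous (FD 0).
  + by apply: cvg_at_left_filter; exact: is_derive_continuous (FD (2 * pi)).
- by move=> t _; rewrite derive1E; case: (FD t).
Qed.

Lemma cis_2pi n : cis (n%:R * (2 * pi)) = 1 :> R[i].
Proof.
rewrite -cisX; have -> : cis (2 * pi) = 1 :> R[i]; last by rewrite expr1n.
by rewrite /cis mulr_natl cos2pi sin2pi.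
Qed.

Lemma cos_2pi n : cos (n%:R * (2 * pi)) = 1 :> R.
Proof. exact: (congr1 (@complex.Re R) (cis_2pi n)). Qed.

Lemma sin_2pi n : sin (n%:R * (2 * pi)) = 0 :> R.
Proof. exact: (congr1 (@complex.Im R) (cis_2pi n)). Qed.

Let continuous_cosM (k : R) : continuous (fun t : R => cos (k * t)).
Proof.
move=> t; apply: (@continuous_comp _ _ _ (fun t : R => k * t) (@cos R)); last exact: continuous_cos.
exact: mulrl_continuous.
Qed.

Let continuous_sinM (k : R) : continuous (fun t : R => sin (k * t)).
Proof.
move=> t; apply: (@continuous_comp _ _ _ (fun t : R => k * t) (@sin R)); last exact: continuous_sin.
exact: mulrl_continuous.
Qed.

Lemma arc_integral_cos n : arc_integral (fun t : R => cos (n%:R * t)) = if n == 0%N then 2 * pi else 0.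
Proof.
case: eqP => [->|/eqP n0].
  under [X in arc_integral X]eq_fun do rewrite mul0r cos0.
  by rewrite arc_integral_cst mul1r.
have n0' : (n%:R : R) != 0 by rewrite pnatr_eq0.
have FD (t : R) : is_derive t 1 (fun t => sin (n%:R * t) / n%:R) (cos (n%:R * t)).
  by derive => //; field.
rewrite (arc_integral_derive FD (@continuous_cosM _) (arc_integrable_cos _)).
by rewrite sin_2pi mulr0 sin0 subrr.
Qed.

Lemma arc_integral_sin n : arc_integral (fun t : R => sin (n%:R * t)) = 0.
Proof.
case: (eqVneq n 0%N) => [->|n0].
  under [X in arc_integral X]eq_fun do rewrite mul0r sin0.
  by rewrite arc_integral_cst mul0r.
have n0' : (n%:R : R) != 0 by rewrite pnatr_eq0.
have FD (t : R) : is_derive t 1 (fun t => - (cos (n%:R * t) / n%:R)) (sin (n%:R * t)).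
  by derive => //; field.
rewrite (arc_integral_derive FD (@continuous_sinM _) (arc_integrable_sin _)).
by rewrite cos_2pi mulr0 cos0 subrr.
Qed.

End arc_integral.

(** * Fejer means *)

Section fejer_kernel.
Context {R : realType}.
Implicit Types (x s t : R) (u v : R -> R) (n m : nat).

(** The exponential coefficients 1 - |m| / n of the Fejer kernel, with m and -m grouped into one
    cosine. *)
Definition fejer_weight n m : R := if m == 0%N then 1 else 2 * (1 - m%:R / n%:R).

Definition fejer n x : R := \sum_(0 <= m < n) fejer_weight n m * cos (m%:R * x).

Let dirichlet n x : R := \sum_(0 <= m < n.+1) (if m == 0%N then 1 else 2) * cos (m%:R * x).

Let dirichletE n x : dirichlet n x * (1 - cos x) = cos (n%:R * x) - cos (n.+1%:R * x).
Proof.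
elim: n => [|n ih]; first by rewrite /dirichlet big_nat1 eqxx !mul0r cos0 !mul1r.
rewrite /dirichlet big_nat_recr//= mulrDl -[\sum_(_ <= _ < _) _]/(dirichlet n x) ih.
have e1 : n.+2%:R * x = n.+1%:R * x + x by rewrite -natr1 mulrDl mul1r.
have e2 : n%:R * x = n.+1%:R * x - x by rewrite -[n.+1%:R]natr1 mulrDl mul1r addrK.
by rewrite e1 e2 !cosD cosN sinN; ring.
Qed.

(** n times the Fejer kernel is the sum of the first n Dirichlet kernels, and each of these becomes
    a difference of two cosines when multiplied by 1 - cos x, so the sum telescopes. *)
Let fejer_closed n x : n%:R * fejer n x * (1 - cos x) = 1 - cos (n%:R * x).
Proof.
have step k : k.+1%:R * fejer k.+1 x = k%:R * fejer k x + dirichlet k x.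
  have E j : j%:R * fejer j x = \sum_(0 <= m < j) (if m == 0%N then j%:R else 2 * (j%:R - m%:R)) * cos (m%:R * x).
    rewrite /fejer big_distrr/=; apply: eq_big_nat => m /andP[_ mj].
    have j0 : (j%:R : R) != 0 by rewrite pnatr_eq0 -lt0n (leq_ltn_trans _ mj).
    by rewrite /fejer_weight; case: ifP => _; field.
  rewrite !E /dirichlet [X in _ + X]big_nat_recr//= big_nat_recr//= addrA -big_split/=.
  congr (_ + _); last by case: k => [|k] /=; rewrite -?natr1; ring.
  by apply: eq_big_nat => m _; case: ifP => _; rewrite -[k.+1%:R]natr1; ring.
elim: n => [|n ih]; first by rewrite !mul0r cos0 subrr.
by rewrite step mulrDl ih dirichletE; ring.
Qed.

Lemma fejer_ge0 n x : (0 < n)%N -> 0 <= fejer n x.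
Proof.
move=> n0; have n0' : 0 < n%:R :> R by rewrite ltr0n.
(* The closed form says nothing where 1 - cos x = 0; there all the cosines equal 1 and the weights
   are nonnegative. *)
have [c1|c1] := eqVneq (cos x) 1.
  have s0 : sin x = 0 by apply: cos1sin0; rewrite c1 normr1.
  have cm m : cos (m%:R * x) = 1.
    have : cis (m%:R * x) = 1 :> R[i] by rewrite -cisX /cis c1 s0 expr1n.
    by move=> /(congr1 (@complex.Re R)).
  rewrite /fejer big_nat_cond; apply: sumr_ge0 => m; rewrite andbT => /andP[_ mn].
  rewrite cm mulr1 /fejer_weight; case: ifP => // _.
  by rewrite mulr_ge0// subr_ge0 ler_pdivrMr// mul1r ler_nat ltnW.
have c2 : 0 < 1 - cos x.
  by rewrite subr_gt0 lt_neqAle c1/=; apply: le_trans (cos_max x); exact: ler_norm.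
have : 0 <= n%:R * fejer n x * (1 - cos x).
  by rewrite fejer_closed subr_ge0; apply: le_trans (cos_max _); exact: ler_norm.
by rewrite pmulr_lge0// pmulr_rge0.
Qed.

Definition fejer_mean n u t : R := (2 * pi)^-1 * arc_integral (fun s => u s * fejer n (t - s)).

Definition cos_coef u m : R := arc_integral (fun s => u s * cos (m%:R * s)).
Definition sin_coef u m : R := arc_integral (fun s => u s * sin (m%:R * s)).

Let integrable_cos u m : arc_integrable u -> arc_integrable (fun s => u s * cos (m%:R * s)).
Proof.
by move=> ui; apply: (@arc_integrableM_bounded _ _ _ 1) => //;
  [exact: measurable_cosM|move=> t; exact: cos_max].
Qed.

Let integrable_sin u m : arc_integrable u -> arc_integrable (fun s => u s * sin (m%:R * s)).
Proof.
by move=> ui; apply: (@arc_integrableM_bounded _ _ _ 1) => //;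
  [exact: measurable_sinM|move=> t; exact: sin_max].
Qed.

Let fejer_expand n u t s : u s * fejer n (t - s) =
  \sum_(0 <= m < n) (fejer_weight n m * cos (m%:R * t) * (u s * cos (m%:R * s))
                   + fejer_weight n m * sin (m%:R * t) * (u s * sin (m%:R * s))).
Proof.
rewrite /fejer big_distrr/=; apply: eq_bigr => m _.
by rewrite mulrBr cosB; ring.
Qed.

Let integrable_term n u t m : arc_integrable u -> arc_integrable (fun s =>
  fejer_weight n m * cos (m%:R * t) * (u s * cos (m%:R * s))
                   + fejer_weight n m * sin (m%:R * t) * (u s * sin (m%:R * s))).
Proof.
by move=> ui; apply: arc_integrableD; apply: arc_integrableZ; [exact: integrable_cos|exact: integrable_sin].
Qed.

Lemma fejer_integrable n u t : arc_integrable u -> arc_integrable (fun s => u s * fejer n (t - s)).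
Proof.
move=> ui; under eq_fun do rewrite fejer_expand.
by apply: arc_integrable_sum => m; exact: integrable_term.
Qed.

Lemma fejer_meanE n u t : arc_integrable u -> fejer_mean n u t =
  \sum_(0 <= m < n) fejer_weight n m / (2 * pi) *
     (cos_coef u m * cos (m%:R * t) + sin_coef u m * sin (m%:R * t)).
Proof.
move=> ui; rewrite /fejer_mean (eq_arc_integral (fejer_expand n u t)).
rewrite arc_integral_sum; last by move=> m; exact: integrable_term.
rewrite big_distrr/=; apply: eq_bigr => m _.
rewrite arc_integralD; [|exact/arc_integrableZ/integrable_cos|exact/arc_integrableZ/integrable_sin].
rewrite !arc_integralZ; [|exact: integrable_sin|exact: integrable_cos].
by rewrite -/(cos_coef u m) -/(sin_coef u m); ring.
Qed.

Lemma fejer_meanD n u v t : arc_integrable u -> arc_integrable v ->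
  fejer_mean n (fun s => u s + v s) t = fejer_mean n u t + fejer_mean n v t.
Proof.
move=> ui vi; rewrite /fejer_mean -mulrDr -arc_integralD; [|exact: fejer_integrable..].
by congr (_ * _); apply: eq_arc_integral => s; rewrite mulrDl.
Qed.

Lemma fejer_meanZ n k u t : arc_integrable u ->
  fejer_mean n (fun s => k * u s) t = k * fejer_mean n u t.
Proof.
move=> ui; rewrite /fejer_mean mulrCA -[in RHS]arc_integralZ; last exact: fejer_integrable.
by congr (_ * _); apply: eq_arc_integral => s; rewrite mulrA.
Qed.

Lemma fejer_meanB n u v t : arc_integrable u -> arc_integrable v ->
  fejer_mean n (fun s => u s - v s) t = fejer_mean n u t - fejer_mean n v t.
Proof.
move=> ui vi; rewrite /fejer_mean -mulrBr -arc_integralB; [|exact: fejer_integrable..].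
by congr (_ * _); apply: eq_arc_integral => s; rewrite mulrBl.
Qed.

Lemma fejer_mean_le n u v t : (0 < n)%N -> arc_integrable u -> arc_integrable v ->
  (forall s : R, 0 <= s <= 2 * pi -> u s <= v s) -> fejer_mean n u t <= fejer_mean n v t.
Proof.
move=> n0 ui vi uv; rewrite /fejer_mean ler_pM2l ?invr_gt0 ?pi2_gt0//.
apply: le_arc_integral; [exact: fejer_integrable..|].
by move=> s sI; rewrite ler_wpM2r ?fejer_ge0// uv.
Qed.

Let arc_integral_cos_shift k t :
  arc_integral (fun s => cos (k%:R * (t - s))) = if k == 0%N then 2 * pi else 0.
Proof.
under [X in arc_integral X]eq_fun do rewrite mulrBr cosB.
rewrite arc_integralD; [|exact/arc_integrableZ/arc_integrable_cos|exact/arc_integrableZ/arc_integrable_sin].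
rewrite !arc_integralZ; [|exact: arc_integrable_sin|exact: arc_integrable_cos].
rewrite arc_integral_cos arc_integral_sin mulr0 addr0.
by case: eqP => [->|]; rewrite ?mulr0// mul0r cos0 mul1r.
Qed.

Let integrable_cos_shift k t : arc_integrable (fun s => cos (k%:R * (t - s))).
Proof.
under eq_fun do rewrite mulrBr cosB.
by apply: arc_integrableD; apply: arc_integrableZ; [exact: arc_integrable_cos|exact: arc_integrable_sin].
Qed.

Lemma fejer_mean_cst n k t : (0 < n)%N -> fejer_mean n (fun=> k) t = k.
Proof.
move=> n0; rewrite /fejer_mean arc_integralZ; last first.
  by have := fejer_integrable n t (arc_integrable_cst 1); under eq_fun do rewrite mul1r.
rewrite arc_integral_sum; last by move=> m; apply: arc_integrableZ; exact: integrable_cos_shift.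
case: n n0 => // n _; rewrite big_nat_recl//= big1 ?addr0; last first.
  move=> m _; rewrite arc_integralZ; last exact: integrable_cos_shift.
  by rewrite arc_integral_cos_shift/= mulr0.
rewrite arc_integralZ; last exact: integrable_cos_shift.
rewrite arc_integral_cos_shift /fejer_weight/=; have := @pi_gt0 R; move: (pi : R) => P P0.
by field; rewrite gt_eqF.
Qed.

(** Multiplying the kernel by cos (s - t) shifts its frequencies by one, so only the term m = 1 has
    a mean, equal to 1 - 1 / n. *)
Lemma fejer_mean_versine n t : (0 < n)%N ->
  fejer_mean n (fun s => 1 - cos (s - t)) t = n%:R^-1.
Proof.
move=> n0; have n0' : (n%:R : R) != 0 by rewrite pnatr_eq0 -lt0n.
have cosi : arc_integrable (fun s : R => cos (s - t)).
  have := integrable_cos_shift 1 t; under eq_fun do rewrite mul1r -cosN opprB.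
  by [].
rewrite fejer_meanB//; last exact: arc_integrable_cst.
rewrite fejer_mean_cst// /fejer_mean.
have -> : arc_integral (fun s => cos (s - t) * fejer n (t - s)) =
  arc_integral (fun s => \sum_(0 <= m < n) (fejer_weight n m / 2 * cos (m.+1%:R * (t - s))
     (* The lower frequency is |m - 1|, hence 1 at m = 0, where the natural-number predecessor would
        give 0. *)
     + fejer_weight n m / 2 * cos ((if m == 0 then 1 else m.-1)%N%:R * (t - s)))).
  apply: eq_arc_integral => s; rewrite /fejer big_distrr/=; apply: eq_bigr => m _.
  rewrite -cosN opprB; case: m => [|m]/=.
    rewrite mul0r cos0 mulr1.
    by move: (fejer_weight n 0) => w; rewrite !mul1r; field.
  move: (t - s) => x; rewrite (_ : m.+2%:R * x = m.+1%:R * x + x); last by rewrite -[m.+2%:R]natr1; ring.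
  rewrite (_ : m%:R * x = m.+1%:R * x - x); last by rewrite -[m.+1%:R]natr1; ring.
  by rewrite !cosD cosN sinN; move: (fejer_weight _ _) => w; field.
rewrite arc_integral_sum; last first.
  by move=> m; apply: arc_integrableD; apply: arc_integrableZ; exact: integrable_cos_shift.
rewrite (_ : \sum_(_ <= _ < _) _ = \sum_(0 <= m < n) (if m == 1%N then 2 * pi * (1 - n%:R^-1) else 0)); last first.
  apply: eq_bigr => m _; rewrite arc_integralD; [|apply/arc_integrableZ/integrable_cos_shift..].
  rewrite !arc_integralZ; [|exact: integrable_cos_shift..].
  rewrite !arc_integral_cos_shift/= mulr0 add0r; case: m => [|[|m]]/=; rewrite ?mulr0//.
  by rewrite /fejer_weight/=; field.
case: n n0 n0' => [//|[|n]] _ n0'; first by rewrite big_nat1/= mulr0 subr0 invr1.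
rewrite big_nat_recl//= big_nat_recl//= big1 ?addr0 ?add0r; last by [].
have := @pi_gt0 R; move: (pi : R) => P P0.
by field; rewrite gt_eqF//; lra.
Qed.

(** Korovkin's argument: by positivity of the kernel, the error is controlled by the mean of the
    single test function 1 - cos (s - t), which is 1 / n. *)
Lemma fejer_mean_korovkin n u t k e C : (0 < n)%N -> arc_integrable u ->
  (forall s : R, 0 <= s <= 2 * pi -> `|u s - k| <= e + C * (1 - cos (s - t))) ->
  `|fejer_mean n u t - k| <= e + C / n%:R.
Proof.
move=> n0 ui uk.
have cosi : arc_integrable (fun s : R => 1 - cos (s - t)).
  apply: arc_integrableB; first exact: arc_integrable_cst.
  have := integrable_cos_shift 1 t; under eq_fun do rewrite mul1r -cosN opprB.
  by [].
have maj : arc_integrable (fun s : R => e + C * (1 - cos (s - t))).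
  by apply: arc_integrableD; [exact: arc_integrable_cst|exact: arc_integrableZ].
have mE : fejer_mean n (fun s : R => e + C * (1 - cos (s - t))) t = e + C / n%:R.
  rewrite fejer_meanD ?fejer_meanZ ?fejer_mean_versine ?fejer_mean_cst//; [exact: arc_integrable_cst|exact: arc_integrableZ].
have ukE : fejer_mean n (fun s => u s - k) t = fejer_mean n u t - k.
  by rewrite fejer_meanB ?fejer_mean_cst//; exact: arc_integrable_cst.
have uki : arc_integrable (fun s => u s - k) by apply: arc_integrableB => //; exact: arc_integrable_cst.
rewrite -ukE -mE ler_norml; apply/andP; split; last first.
  by apply: fejer_mean_le => // s sI; apply: le_trans (uk s sI); exact: ler_norm.
rewrite -mulN1r -fejer_meanZ//; apply: fejer_mean_le => //; first exact: arc_integrableZ.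
by move=> s sI; rewrite mulN1r lerNl; apply: le_trans (uk s sI); rewrite -normrN; exact: ler_norm.
Qed.

Lemma fejer_mean_integrable n u : arc_integrable u -> arc_integrable (fejer_mean n u).
Proof.
move=> ui; have -> : fejer_mean n u = fun t => \sum_(0 <= m < n) (fejer_weight n m / (2 * pi) *
     (cos_coef u m * cos (m%:R * t) + sin_coef u m * sin (m%:R * t))).
  by apply/funext => t; exact: fejer_meanE.
apply: arc_integrable_sum => m; apply: arc_integrableZ; apply: arc_integrableD; apply: arc_integrableZ.
  exact: arc_integrable_cos.
exact: arc_integrable_sin.
Qed.

Lemma arc_integral_fejer_mean n u : (0 < n)%N -> arc_integrable u ->
  arc_integral (fejer_mean n u) = arc_integral u.
Proof.
move=> n0 ui; have -> : fejer_mean n u = fun t => \sum_(0 <= m < n) (fejer_weight n m / (2 * pi) *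
     (cos_coef u m * cos (m%:R * t) + sin_coef u m * sin (m%:R * t))).
  by apply/funext => t; exact: fejer_meanE.
have ti m : arc_integrable (fun t => cos_coef u m * cos (m%:R * t) + sin_coef u m * sin (m%:R * t)).
  by apply: arc_integrableD; apply: arc_integrableZ; [exact: arc_integrable_cos|exact: arc_integrable_sin].
rewrite arc_integral_sum; last by move=> m; apply: arc_integrableZ.
have tE m : arc_integral (fun t => fejer_weight n m / (2 * pi) *
     (cos_coef u m * cos (m%:R * t) + sin_coef u m * sin (m%:R * t))) =
     if m == 0%N then arc_integral u else 0.
  rewrite arc_integralZ// arc_integralD; [|exact/arc_integrableZ/arc_integrable_cos|exact/arc_integrableZ/arc_integrable_sin].
  rewrite !arc_integralZ; [|exact: arc_integrable_sin|exact: arc_integrable_cos].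
  rewrite arc_integral_cos arc_integral_sin; case: m => [|m]/=; last by rewrite !mulr0 addr0 mulr0.
  rewrite (_ : cos_coef u 0 = arc_integral u); first by have := @pi_gt0 R; move: (pi : R) => P P0; rewrite /fejer_weight/=; field; rewrite gt_eqF.
  by apply: eq_arc_integral => s; rewrite mul0r cos0 mulr1.
under eq_bigr do rewrite tE.
by case: n n0 {tE} => // n _; rewrite big_nat_recl//= big1 ?addr0.
Qed.

(** A polynomial whose real part on the circle is the Fejer mean and whose real part at 0 is the
    mean of u; it plays the role of the harmonic majorant in the maximum principle. *)
Definition fejer_poly n u : {poly R[i]} :=
  \sum_(0 <= m < n) (((fejer_weight n m / (2 * pi))%:C * (cos_coef u m -i* sin_coef u m))%:P * 'X^m).

Lemma fejer_poly_cis n u t : arc_integrable u ->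
  fejer_mean n u t = complex.Re (fejer_poly n u).[cis t].
Proof.
move=> ui; rewrite fejer_meanE// /fejer_poly horner_sum raddf_sum/=.
apply: eq_bigr => m _; rewrite hornerM hornerC hornerXn cisX -[X in complex.Re X]mulrA Re_realM; congr (_ * _).
by rewrite ReM/=; ring.
Qed.

Lemma fejer_poly0 n u : (0 < n)%N -> complex.Re (fejer_poly n u).[0] = (2 * pi)^-1 * arc_integral u.
Proof.
case: n => // n _; rewrite /fejer_poly horner_sum big_nat_recl//= big1 ?addr0; last first.
  by move=> m _; rewrite hornerM hornerC hornerXn expr0n/= mulr0.
rewrite hornerM hornerC hornerXn expr0 mulr1 Re_realM.
congr (_ * _); first by rewrite /fejer_weight/= mul1r.
by apply: eq_arc_integral => s; rewrite mul0r cos0 mulr1.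
Qed.

End fejer_kernel.

(** * Uniform and L^1 convergence of Fejer means, and the sub-mean value inequality *)

Section uniform_approximation.
Context {R : realType}.
Local Notation mu := (@arc_measure R).
Local Notation leb := (@lebesgue_measure R).
Local Notation J := (`[0, 2 * pi]%classic : set R).
Implicit Types (g u v : R -> R) (n : nat).

Lemma cis_representative (t : R) : exists2 t' : R, 0 <= t' <= 2 * pi & cis t' = cis t.
Proof.
have p0 := @pi_gt0 R.
have c1 : cabs (cis t) = 1 by exact/eqP/cabs_cis.
have cn0 : cis t != 0 by rewrite -cabs_eq0 c1 oner_eq0.
have [x + xE] := polar cn0; rewrite c1 mul1r in xE; rewrite ler_norml => /andP[x1 x2].
have [x0|x0] := leP 0 x; first by exists x => //; lra.
exists (x + 2 * pi); first by lra.
by have := @cis_2pi R 1; rewrite mul1r cisD => ->; rewrite mulr1.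
Qed.

Lemma ge0_arc_integralE (f : R -> \bar R) : measurable_fun setT f -> (forall t, (0 <= f t)%E) ->
  (\int[mu]_t f t = \int[leb]_(t in J) f t)%E.
Proof.
move=> mf f0.
rewrite (@ge0_negligible_integral _ _ _ mu setT (~` J)) ?arc_measure_setC//; last exact: measurableC.
rewrite setTD setCK; apply: eq_measure_integral => A mA AJ.
by rewrite arc_measureE; congr (leb _); apply/setIidPl.
Qed.

Lemma arc_integrableP g : measurable_fun setT g ->
  leb.-integrable J (EFin \o g) <-> arc_integrable g.
Proof.
move=> mg; have mgE : measurable_fun setT (EFin \o g) by exact/measurable_EFinP.
have gE : (\int[mu]_t `|(EFin \o g) t| = \int[leb]_(t in J) `|(EFin \o g) t|)%E.
  by apply: ge0_arc_integralE => //; exact: measurableT_comp.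
split => /integrableP[_ h]; apply/integrableP; split; rewrite ?gE// -?gE//.
by apply: (@measurable_funS _ _ _ _ setT) => //.
Qed.

Lemma continuous_arc_integrable u : continuous u -> arc_integrable u.
Proof.
move=> uc; apply/arc_integrableP; first exact: continuous_measurable.
by apply: continuous_compact_integrable; [exact: segment_compact|exact: continuous_subspaceT].
Qed.

Lemma eq_cis_itv (s t : R) : 0 <= s <= 2 * pi -> 0 <= t <= 2 * pi -> cos (s - t) = 1 ->
  s = t \/ `|s - t| = 2 * pi.
Proof.
move=> /andP[s0 s1] /andP[t0 t1] c1; have p0 := @pi_gt0 R.
pose x := `|s - t| / 2.
have sx : sin x = 0.
  have : cos (x + x) = 1.
    rewrite -splitr; have [_|_] := ger0P (s - t); first by [].
    by rewrite cosN.
  rewrite cosD -!expr2 => h; have := cos2Dsin2 x => h2.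
  by apply/eqP; rewrite -sqrf_eq0; apply/eqP; lra.
have xpi : x <= pi.
  by rewrite ler_pdivrMr// ler_norml; apply/andP; split; lra.
have [st|st] := eqVneq s t; [by left|right].
have x0 : 0 < x by rewrite divr_gt0// normr_gt0 subr_eq0.
move: xpi; rewrite le_eqVlt => /orP[/eqP xpi|xpi].
  by rewrite -xpi /x; field.
by have := @sin_gt0_pi R x; rewrite x0 xpi sx ltxx => /(_ isT).
Qed.

(** On the compact set |u s - u t| >= e the points s and t differ on the circle, as u agrees at both
    ends, so 1 - cos (s - t) has a positive minimum [m] there. Then C = M / m works, with [M] the
    largest oscillation of u. *)
Lemma circular_modulus u e : continuous u -> u 0 = u (2 * pi) -> 0 < e ->
  exists2 C, 0 <= C & forall s t, 0 <= s <= 2 * pi -> 0 <= t <= 2 * pi ->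
    `|u s - u t| <= e + C * (1 - cos (s - t)).
Proof.
move=> uc up e0.
pose Q : set (R * R) := `[0, 2 * pi]%classic `*` `[0, 2 * pi]%classic.
have Qc : compact Q by apply: compact_setX; exact: segment_compact.
have d1 : continuous (fun v : R * R => `|u v.1 - u v.2|).
  move=> v; apply: cvg_norm; apply: cvgB.
    exact: (cvg_comp fst u cvg_fst (uc v.1)).
  exact: (cvg_comp snd u cvg_snd (uc v.2)).
have d2 : continuous (fun v : R * R => 1 - cos (v.1 - v.2)).
  move=> v; apply: cvgB; first exact: cvg_cst.
  have h : (w.1 - w.2) @[w --> v] --> (v.1 - v.2) by apply: cvgB; [exact: cvg_fst|exact: cvg_snd].
  exact: (cvg_comp (fun w : R * R => w.1 - w.2) (@cos R) h (@continuous_cos R (v.1 - v.2))).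
have Q0 : Q !=set0.
  by exists (0, 0); split; rewrite /= in_itv/= lexx ltW ?pi2_gt0.
have [v0 _ v0max] := compact_EVT_max Q0 Qc (continuous_subspaceT d1).
pose M := `|u v0.1 - u v0.2|.
have uM s t : 0 <= s <= 2 * pi -> 0 <= t <= 2 * pi -> `|u s - u t| <= M.
  by move=> sI tI; apply: (v0max (s, t)); rewrite inE; split; rewrite /= in_itv.
pose K := Q `&` [set v | e <= `|u v.1 - u v.2|].
have Kc : compact K.
  apply: (@subclosed_compact _ _ Q) => //; last by move=> v [].
  apply: closedI; first by apply: compact_closed => //; exact: norm_hausdorff.
  by apply: (@closed_comp _ _ _ [set x | e <= x]) => [v _|]; [exact: d1|exact: closed_ge].
have [[k Kk]|K0] := pselect (K !=set0); last first.
  exists 0 => // s t sI tI; rewrite mul0r addr0 leNgt; apply/negP => h.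
  by apply: K0; exists (s, t); split; [split; rewrite /= in_itv|exact: ltW].
have [v1 + v1min] := compact_EVT_min (ex_intro _ _ Kk) Kc (continuous_subspaceT d2).
rewrite inE => -[v1Q v1e].
pose m := 1 - cos (v1.1 - v1.2).
have m0 : 0 < m.
  rewrite lt_neqAle subr_ge0 (le_trans _ (cos_max (v1.1 - v1.2))) ?ler_norm// andbT eq_sym subr_eq0.
  apply/eqP => /esym c1; have [v1I v2I] := v1Q.
  have [uE|] := eq_cis_itv v1I v2I c1.
    by move: v1e; rewrite /= uE subrr normr0 leNgt e0.
  move: v1I v2I v1e; rewrite /= !in_itv/= => /andP[a0 a1] /andP[b0 b1] ab.
  have [_ abE|_ abE] := ger0P (v1.1 - v1.2).
    have [aE bE] : v1.1 = 2 * pi /\ v1.2 = 0 by split; lra.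
    by move: ab; rewrite aE bE up subrr normr0 leNgt e0.
  have [aE bE] : v1.1 = 0 /\ v1.2 = 2 * pi by split; lra.
  by move: ab; rewrite aE bE up subrr normr0 leNgt e0.
have M0 : 0 <= M by exact: normr_ge0.
exists (M / m) => [|s t sI tI]; first by rewrite divr_ge0// ltW.
have cs0 : 0 <= 1 - cos (s - t) by rewrite subr_ge0 (le_trans _ (cos_max (s - t))) ?ler_norm.
have [h|h] := leP (`|u s - u t|) e.
  by apply: le_trans h _; rewrite lerDl mulr_ge0// divr_ge0// ltW.
apply: le_trans (uM s t sI tI) _; apply: ler_wpDl; first exact: ltW.
have mc : m <= 1 - cos (s - t).
  by apply: (v1min (s, t)); rewrite inE; split; [split; rewrite /= in_itv|exact: ltW].
by rewrite mulrAC ler_pdivlMr// ler_wpM2l.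
Qed.

Lemma fejer_mean_uniform u e : continuous u -> u 0 = u (2 * pi) -> 0 < e ->
  exists N, forall n (t : R), (N <= n)%N -> 0 <= t <= 2 * pi -> `|fejer_mean n.+1 u t - u t| <= e.
Proof.
move=> uc up e0; have ui := continuous_arc_integrable uc.
have [C C0 H] := circular_modulus uc up (divr_gt0 e0 (ltr0Sn _ 1)).
pose N := Num.trunc (2 * C / e).
exists N => n t Nn tI.
apply: le_trans (fejer_mean_korovkin (isT : (0 < n.+1)%N) ui (fun s sI => H s t sI tI)) _.
have : 2 * C / e < n.+1%:R.
  by apply: lt_le_trans (truncnS_gt _) _; rewrite ler_nat.
rewrite ltr_pdivrMr// => h.
have n0 : (0 : R) < n.+1%:R by rewrite ltr0n.
rewrite [leRHS]splitr lerD2l.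
by rewrite ler_pdivrMr//; lra.
Qed.

Lemma continuous_polynomial_cis (q : {poly R[i]}) :
  continuous (fun t : R => complex.Re q.[cis t]) /\ continuous (fun t : R => complex.Im q.[cis t]).
Proof.
have [qr qi] := polynomial_continuous q.
have h t : (cos x, sin x) @[x --> t] --> ((cos t, sin t) : R * R).
  exact: (cvg_pair (@continuous_cos R t) (@continuous_sin R t)).
split => t; rewrite /continuous_at.
  exact: (cvg_comp (fun x : R => (cos x, sin x)) (fun v : R * R => complex.Re q.[v.1 +i* v.2]) (h t) (qr (cos t, sin t))).
exact: (cvg_comp (fun x : R => (cos x, sin x)) (fun v : R * R => complex.Im q.[v.1 +i* v.2]) (h t) (qi (cos t, sin t))).
Qed.

(** The Fejer polynomial of t -> minorant p q(exp (i t)), raised by a small constant, dominates that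
    function on the circle; its real part at 0 is the mean plus the constant. *)
Lemma minorant_mean_ge0 p (q : {poly R[i]}) : 1 < p -> q.[0] = 0 ->
  0 <= arc_integral (fun t => minorant p q.[cis t]).
Proof.
move=> p1 q0; have p0 : 0 < p by lra.
have [->|qn0] := eqVneq q 0.
  by under eq_arc_integral do rewrite horner0 minorant0//; rewrite arc_integral_cst mul0r.
pose u t := minorant p q.[cis t].
have [qr qi] := continuous_polynomial_cis q.
have uc : continuous u by exact: minorant_comp_continuous.
have up : u 0 = u (2 * pi) by rewrite /u; have := @cis_2pi R 1; rewrite mul1r cis0 => ->.
apply/ler_addgt0Pr => e e0.
have e0' : 0 < e / (2 * pi) by rewrite divr_gt0// pi2_gt0.
have [N /(_ N _ (leqnn N)) HN] := fejer_mean_uniform uc up e0'.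
have := @minorant_max_principle _ p q (fejer_poly N.+1 u + (e / (2 * pi))%:C%:P) p1 qn0 q0.
rewrite hornerD hornerC ReD fejer_poly0//= => H.
rewrite -(pmulr_rge0 _ (_ : 0 < (2 * pi)^-1 :> R)) ?invr_gt0 ?pi2_gt0//.
rewrite mulrDr [X in _ + X]mulrC; apply: H => t'; have [t tI <-] := cis_representative t'.
rewrite hornerD hornerC ReD -fejer_poly_cis ?continuous_arc_integrable//=.
by have := HN t tI; rewrite ler_norml -/(u t); lra.
Qed.

Let is_derive_scaled_power (a : R) n (t : R) : a != 0 ->
  is_derive t 1 (fun t : R => (n.+1%:R * a)^-1 * (a * t) ^+ n.+1) ((a * t) ^+ n).
Proof.
move=> a0; have D1 : is_derive t 1 (fun t : R => a * t) a by derive => //; ring.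
have -> : (fun t : R => (n.+1%:R * a)^-1 * (a * t) ^+ n.+1) =
    (n.+1%:R * a)^-1 \*: ((fun t : R => a * t) ^+ n.+1).
  by apply/funext => x; rewrite exprfctE.
apply: is_derive_eq; rewrite /GRing.scale/=.
by move: (_ ^+ n) => y; field; rewrite a0 nat1r pnatr_eq0.
Qed.

(** A continuous approximation [k] may disagree at the two ends. Subtracting d (t / (2 pi))^n with d
    = k (2 pi) - k 0 repairs this at the L^1 cost |d| 2 pi / (n + 1). *)
Lemma continuous_periodic_dense u e : arc_integrable u -> 0 < e ->
  exists v, [/\ continuous v, v 0 = v (2 * pi) & arc_integral (fun t => `|u t - v t|) <= e].
Proof.
move=> ui e0; have mu' := arc_integrableM ui; have e2 : 0 < e / 2 by lra.
have /arc_integrableP -/(_ mu') uJ := ui.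
have Jfin : (leb J < +oo)%E by rewrite lebesgue_measure_itv/= lte_fin pi2_gt0 -EFinB ltry.
have [g_ [gc gi glim]] := approximation_continuous_integrable (measurable_itv _) Jfin uJ.
have [k [kc ki ke]] : exists k : R -> R, [/\ continuous k, leb.-integrable J (EFin \o k) &
    arc_integral (fun t => `|u t - k t|) <= e / 2].
  move/fine_cvgP: glim => [[m _ fin] /cvgrPdist_le/(_ _ e2)[q _ /(_ (m + q)%N (leq_addl _ _))]].
  rewrite sub0r normrN /= => h; exists (g_ (m + q)%N); split => //.
  have gi' : arc_integrable (g_ (m + q)%N) by exact: continuous_arc_integrable.
  rewrite arc_integralE; last exact/arc_integrable_norm/arc_integrableB.
  by apply: le_trans (ler_norm _) _.
pose d := k (2 * pi) - k 0.
have p0 := @pi2_gt0 R.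
pose n := (Num.trunc (`|d| * (2 * pi) / (e / 2))).+1.
pose a : R := (2 * pi)^-1.
have a0 : a != 0 by rewrite invr_eq0 gt_eqF.
pose c t : R := (a * t) ^+ n.
have cc : continuous c.
  move=> t; apply: (@continuous_comp _ _ _ (fun t : R => a * t) (fun x : R => x ^+ n)); last exact: exprn_continuous.
  exact: mulrl_continuous.
have cE : arc_integral c = 2 * pi / n.+1%:R.
  rewrite (arc_integral_derive (fun t => is_derive_scaled_power n t a0) cc (continuous_arc_integrable cc)).
  by rewrite mulr0 expr0n/= mulr0 subr0 mulVf ?gt_eqF// expr1n mulr1 invfM invrK mulrC.
have ui' := continuous_arc_integrable kc; have ci := continuous_arc_integrable cc.
exists (fun t => k t - d * c t); split.
- by move=> t; apply: cvgB; [exact: kc|apply: cvgM; [exact: cvg_cst|exact: cc]].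
- by rewrite /c mulr0 mulVf ?gt_eqF// expr1n /n expr0n/= /d; ring.
have maj : arc_integrable (fun t => `|u t - k t| + `|d| * c t).
  by apply: arc_integrableD; [exact/arc_integrable_norm/arc_integrableB|exact: arc_integrableZ].
apply: le_trans (le_arc_integral _ maj _) _.
- by apply: arc_integrable_norm; apply: arc_integrableB => //; apply: arc_integrableB => //; exact: arc_integrableZ.
- move=> t /andP[t0 _]; rewrite (_ : u t - _ = (u t - k t) + d * c t); last by ring.
  apply: le_trans (ler_normD _ _) _; rewrite lerD2l normrM ler_wpM2l// ger0_norm//.
  by rewrite exprn_ge0// mulr_ge0// invr_ge0 ltW.
rewrite arc_integralD; [|exact/arc_integrable_norm/arc_integrableB|exact: arc_integrableZ].
rewrite arc_integralZ// cE [leRHS]splitr lerD// mulrA ler_pdivrMr ?ltr0n//.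
have := truncnS_gt (`|d| * (2 * pi) / (e / 2)); rewrite ltr_pdivrMr// => h.
apply: le_trans (ltW h) _; rewrite mulrC ler_wpM2l//; first exact: ltW.
by rewrite ler_nat /n.
Qed.

Lemma norm_fejer_mean_le n u t : (0 < n)%N -> arc_integrable u ->
  `|fejer_mean n u t| <= fejer_mean n (fun s => `|u s|) t.
Proof.
move=> n0 ui; have ni := arc_integrable_norm ui.
rewrite ler_norml; apply/andP; split; last by apply: fejer_mean_le => // s _; exact: ler_norm.
rewrite -mulN1r -fejer_meanZ//; apply: fejer_mean_le => //; first exact: arc_integrableZ.
by move=> s _; rewrite mulN1r lerNl -normrN; exact: ler_norm.
Qed.

(** Fejer means contract the L^1 norm, so convergence extends from the dense class of continuous
    periodic functions. *)
Lemma fejer_mean_cvg u e : arc_integrable u -> 0 < e ->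
  exists N, forall n, (N <= n)%N -> arc_integral (fun t => `|fejer_mean n.+1 u t - u t|) <= e.
Proof.
move=> ui e0; have e4 : 0 < e / 4 by lra.
have [v [vc vp uv]] := continuous_periodic_dense ui e4.
have vi := continuous_arc_integrable vc; have p0 := @pi2_gt0 R.
have e2 : 0 < e / 2 / (2 * pi) by rewrite divr_gt0//; lra.
have [N HN] := fejer_mean_uniform vc vp e2.
exists N => n Nn; have uvi := arc_integrableB ui vi; have uvn := arc_integrable_norm uvi.
have fi w : arc_integrable w -> arc_integrable (fejer_mean n.+1 w) by exact: fejer_mean_integrable.
have maj : arc_integrable (fun t => fejer_mean n.+1 (fun s => `|u s - v s|) t + `|u t - v t| + e / 2 / (2 * pi)).
  by apply: arc_integrableD; [apply: arc_integrableD => //; exact: fi|exact: arc_integrable_cst].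
apply: le_trans (le_arc_integral _ maj _) _.
- by apply: arc_integrable_norm; apply: arc_integrableB => //; exact: fi.
- move=> t tI; have := HN n t Nn tI.
  have := norm_fejer_mean_le t (isT : (0 < n.+1)%N) uvi; rewrite fejer_meanB//.
  move: (fejer_mean _ (fun s => `|u s - v s|) t) (fejer_mean _ u t) (fejer_mean _ v t) => x y z h1 h2.
  rewrite (_ : y - u t = (y - z) + (z - v t) - (u t - v t)); last by ring.
  apply: le_trans (ler_normB _ _) _; apply: le_trans (lerD (ler_normD _ _) (lexx _)) _; lra.
rewrite arc_integralD; [|by apply: arc_integrableD => //; exact: fi|exact: arc_integrable_cst].
rewrite arc_integralD//; last exact: fi.
rewrite arc_integral_fejer_mean// arc_integral_cst mulfVK ?gt_eqF//; lra.
Qed.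

End uniform_approximation.

(** * The class L^p *)

Section Lp_class.
Context {R : realType}.
Local Notation mu := (@arc_measure R).
Implicit Types (u v : R -> R) (n : nat) (p x y : R) (F G : R -> R[i]).

(** Young's inequality for x and y^(p - 1), rewritten as the tangent-line form of convexity; it is
    the source of the Jensen, Lipschitz and Bernoulli estimates below. *)
Lemma powR_tangent p x y : 1 < p -> 0 <= x -> 0 <= y ->
  y `^ p + p * y `^ (p - 1) * (x - y) <= x `^ p.
Proof.
move=> p1 x0 y0; have p0 : 0 < p by lra.
have q0 : 0 < p / (p - 1) by rewrite divr_gt0// subr_gt0.
have pq : p^-1 + (p / (p - 1))^-1 = 1 by field; rewrite ?subr_eq0 gt_eqF//= gt_eqF.
have := conjugate_powR x0 (powR_ge0 y (p - 1)) p0 q0 pq.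
have -> : (y `^ (p - 1)) `^ (p / (p - 1)) = y `^ p.
  by rewrite -powRrM; congr (_ `^ _); field; rewrite subr_eq0 gt_eqF.
have yp : y `^ (p - 1) * y = y `^ p.
  have [->|yn0] := eqVneq y 0; first by rewrite mulr0 powR0 ?gt_eqF.
  by rewrite -{2}[y]powRr1// -powRD ?subrK// yn0 implybT.
have -> : y `^ p / (p / (p - 1)) = (y `^ p * (p - 1)) / p.
  by field; rewrite ?subr_eq0 gt_eqF//= gt_eqF.
rewrite -mulrDl ler_pdivlMr// => h; rewrite -subr_ge0.
rewrite [leRHS](_ : _ = x `^ p + y `^ p * (p - 1) - x * y `^ (p - 1) * p
   + p * (y `^ (p - 1) * y - y `^ p)); last by ring.
by rewrite yp subrr mulr0 addr0 subr_ge0.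
Qed.

Lemma arc_integral_dominated (U : nat -> R -> R) u v : (forall n, measurable_fun setT (U n)) ->
  measurable_fun setT u -> (forall t, U n t @[n --> \oo] --> u t) -> arc_integrable v ->
  (forall n t, `|U n t| <= v t) ->
  arc_integral (U n) @[n --> \oo] --> arc_integral u.
Proof.
move=> mU mu_ Uu vi Uv.
have mU' n : measurable_fun setT (EFin \o U n) by exact/measurable_EFinP.
have mu' : measurable_fun setT (EFin \o u) by exact/measurable_EFinP.
have lim' : {ae mu, forall t, setT t -> (EFin \o U n) t @[n --> \oo] --> (EFin \o u) t}.
  by apply: aeW => t _; apply: cvg_EFin (Uu t); exact: nearW.
have bd : {ae mu, forall t n, setT t -> (`|(EFin \o U n) t| <= (EFin \o v) t)%E}.
  by apply: aeW => t n _; rewrite lee_fin.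
have [ui _ lim] := @dominated_convergence _ _ _ mu setT measurableT (fun n => EFin \o U n) (EFin \o u) (EFin \o v) mU' mu' lim' vi bd.
rewrite /arc_integral /Rintegral; apply: fine_cvg.
by rewrite fineK//; exact: integrable_fin_num ui.
Qed.

Lemma measurable_fun_powR p u : measurable_fun setT u -> measurable_fun setT (fun t => u t `^ p).
Proof. by move=> mu_; exact: (measurableT_comp (measurable_powR p)). Qed.

(** The class [in_Lp] in the parameter t, with integrability of the p-th power in place of
    finiteness of the norm. *)
Definition Lp p F := [/\ measurable_fun setT (fun t => complex.Re (F t)),
  measurable_fun setT (fun t => complex.Im (F t)) &
  arc_integrable (fun t => cabs (F t) `^ p)].

Lemma measurable_cabs F : measurable_fun setT (fun t => complex.Re (F t)) ->
  measurable_fun setT (fun t => complex.Im (F t)) -> measurable_fun setT (fun t => cabs (F t)).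
Proof.
move=> mr mi.
have -> : (fun t => cabs (F t)) = (fun x => Num.sqrt x) \o
   (fun t => complex.Re (F t) ^+ 2 + complex.Im (F t) ^+ 2).
  by apply/funext => t; rewrite /=; case: (F t).
apply: measurableT_comp; first exact: continuous_measurable_fun (@sqrt_continuous R).
by apply: measurable_funD; exact: measurable_funX.
Qed.

Lemma le_one_powR p x : 1 < p -> 0 <= x -> x <= 1 + x `^ p.
Proof.
move=> p1 x0; have := powR_tangent p1 x0 ler01; have := powR_ge0 x p.
by rewrite !powR1 mulr1; have [x1|x1] := leP x 1; nra.
Qed.

Lemma Lp_integrable p F : 1 < p -> Lp p F -> [/\ arc_integrable (fun t => complex.Re (F t)),
  arc_integrable (fun t => complex.Im (F t)) & arc_integrable (fun t => cabs (F t))].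
Proof.
move=> p1 [mr mi Fp].
have maj : arc_integrable (fun t => 1 + cabs (F t) `^ p).
  by apply: arc_integrableD => //; exact: arc_integrable_cst.
have B t := le_one_powR p1 (cabs_ge0 (F t)).
split; apply: arc_integrable_le maj _ => //; try exact: measurable_cabs; move=> t; apply: le_trans (B t).
- exact: norm_Re_le.
- exact: norm_Im_le.
- by rewrite ger0_norm// cabs_ge0.
Qed.

Lemma Lp_bounded p F M : measurable_fun setT (fun t => complex.Re (F t)) ->
  measurable_fun setT (fun t => complex.Im (F t)) -> 0 <= p -> (forall t, cabs (F t) <= M) -> Lp p F.
Proof.
move=> mr mi p0 FM; split => //; apply: (@arc_integrable_bounded _ _ (M `^ p)).
  by apply: measurable_fun_powR; exact: measurable_cabs.
move=> t; rewrite ger0_norm ?powR_ge0// ge0_ler_powR// ?nnegrE ?cabs_ge0//.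
by rewrite (le_trans (cabs_ge0 (F t))).
Qed.

Lemma powR_addl_le p x y : 0 <= p -> 0 <= x -> 0 <= y -> (x + y) `^ p <= 2 `^ p * (x `^ p + y `^ p).
Proof.
move=> p0 x0 y0; wlog xy : x y x0 y0 / x <= y.
  by move=> H; case/orP: (le_total x y) => h; [exact: H|rewrite addrC [X in _ * X]addrC; exact: H].
apply: (@le_trans _ _ ((2 * y) `^ p)); first by apply: ge0_ler_powR => //; rewrite ?nnegrE; lra.
by rewrite powRM// ler_wpM2l ?powR_ge0// lerDr powR_ge0.
Qed.

Lemma LpD p F G : 0 <= p -> Lp p F -> Lp p G -> Lp p (fun t => F t + G t).
Proof.
move=> p0 [mFr mFi Fp] [mGr mGi Gp].
have mr : measurable_fun setT (fun t => complex.Re (F t + G t)).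
  by under eq_fun do rewrite ReD; exact: measurable_funD.
have mi : measurable_fun setT (fun t => complex.Im (F t + G t)).
  by under eq_fun do rewrite ImD; exact: measurable_funD.
split => //.
apply: (@arc_integrable_le _ _ (fun t => 2 `^ p * (cabs (F t) `^ p + cabs (G t) `^ p))).
- by apply: measurable_fun_powR; exact: measurable_cabs.
- by apply: arc_integrableZ; exact: arc_integrableD.
- move=> t; rewrite ger0_norm ?powR_ge0//.
  apply: le_trans (powR_addl_le p0 (cabs_ge0 _) (cabs_ge0 _)).
  by apply: ge0_ler_powR => //; rewrite ?nnegrE ?addr_ge0 ?cabs_ge0 ?cabsD_le.
Qed.

Lemma LpN p F : Lp p F -> Lp p (fun t => - F t).
Proof.
move=> [mr mi Fp]; split; last by under eq_fun do rewrite cabsN.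
  by under eq_fun do rewrite ReN; exact: measurableT_comp.
by under eq_fun do rewrite ImN; exact: measurableT_comp.
Qed.

Lemma LpB p F G : 0 <= p -> Lp p F -> Lp p G -> Lp p (fun t => F t - G t).
Proof. by move=> p0 Fp Gp; apply: LpD => //; exact: LpN. Qed.

Let integral_powRE p u : (forall t, 0 <= u t) ->
  (\int[mu]_t `|((u t) `^ p)%:E| = \int[mu]_t (`| (u t)%:E | `^ p))%E.
Proof.
by move=> u0; apply: eq_integral => t _; rewrite !abse_EFin poweR_EFin ger0_norm ?powR_ge0// ger0_norm.
Qed.

Lemma Lnorm_ltyP p u : 0 < p -> measurable_fun setT u -> (forall t, 0 <= u t) ->
  (Lnorm mu p%:E (fun t => (u t)%:E) < +oo)%E <-> arc_integrable (fun t => u t `^ p).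
Proof.
move=> p0 mu_ u0; have pn0 : p != 0 by rewrite gt_eqF.
have mp : measurable_fun setT (EFin \o (fun t => u t `^ p)) by apply/measurable_EFinP; exact: measurable_fun_powR.
split => h.
  apply/integrableP; split => //; rewrite integral_powRE// -(powR_Lnorm _ _ pn0).
  exact: poweR_lty.
move/integrableP: h => [_]; rewrite integral_powRE// -(powR_Lnorm _ _ pn0) => h.
exact: lty_poweRy h.
Qed.

Lemma LnormE p u : 0 < p -> measurable_fun setT u -> (forall t, 0 <= u t) ->
  arc_integrable (fun t => u t `^ p) ->
  Lnorm mu p%:E (fun t => (u t)%:E) = ((arc_integral (fun t => u t `^ p)) `^ p^-1)%:E.
Proof.
move=> p0 mu_ u0 ui; have pn0 : p != 0 by rewrite gt_eqF.
rewrite unlock -integral_powRE//.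
under eq_integral do rewrite gee0_abs ?lee_fin ?powR_ge0//.
rewrite -poweR_EFin /arc_integral /Rintegral fineK//.
exact: integrable_fin_num.
Qed.

Lemma in_LpP p (f : circle R -> R[i]) : 0 < p -> in_Lp p f <-> Lp p (fun t => f (expi t)).
Proof.
move=> p0; split=> [[mr mi h]|[mr mi h]]; split => //.
  by apply/Lnorm_ltyP => //; [exact: measurable_cabs|move=> t; exact: cabs_ge0].
by apply/Lnorm_ltyP => //; [exact: measurable_cabs|move=> t; exact: cabs_ge0].
Qed.

Definition fejer_cmean n F t : R[i] :=
  fejer_mean n (fun s => complex.Re (F s)) t +i* fejer_mean n (fun s => complex.Im (F s)) t.

(** Rotating by minus the argument of the mean turns its modulus into the mean of a real part, to
    which positivity of the kernel applies. *)
Lemma cabs_fejer_cmean_le p n F t : (0 < n)%N -> 1 < p -> Lp p F ->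
  cabs (fejer_cmean n F t) <= fejer_mean n (fun s => cabs (F s)) t.
Proof.
move=> n0 p1 Fp; have [ri ii ci] := Lp_integrable p1 Fp.
have [w0|w0] := eqVneq (fejer_cmean n F t) 0.
  rewrite w0 cabs0 -[leLHS](@fejer_mean_cst _ n 0 t n0); apply: fejer_mean_le => //.
    exact: arc_integrable_cst.
  by move=> s _; exact: cabs_ge0.
have [x _ wE] := polar w0.
have -> : cabs (fejer_cmean n F t) = complex.Re (fejer_cmean n F t * cis (- x)).
  by rewrite {2}wE -mulrA -cisD subrr cis0 mulr1.
have -> : complex.Re (fejer_cmean n F t * cis (- x)) =
    fejer_mean n (fun s => cos x * complex.Re (F s) + sin x * complex.Im (F s)) t.
  rewrite fejer_meanD; [|exact: arc_integrableZ..].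
  by rewrite !fejer_meanZ// ReM /= cosN sinN; ring.
apply: fejer_mean_le => //; first by apply: arc_integrableD; exact: arc_integrableZ.
move=> s _; have -> : cos x * complex.Re (F s) + sin x * complex.Im (F s) = complex.Re (F s * cis (- x)).
  by rewrite ReM /= cosN sinN; ring.
apply: le_trans (ler_norm _) _; apply: le_trans (norm_Re_le _) _.
by rewrite cabsM (eqP (cabs_cis _)) mulr1.
Qed.

(** Jensen through the tangent line at [Y], the mean of |F|: the linear term averages to 0. *)
Lemma fejer_cmean_jensen p n F t : (0 < n)%N -> 1 < p -> Lp p F ->
  cabs (fejer_cmean n F t) `^ p <= fejer_mean n (fun s => cabs (F s) `^ p) t.
Proof.
move=> n0 p1 Fp; have [ri ii ci] := Lp_integrable p1 Fp; have [_ _ Fi] := Fp.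
set Y := fejer_mean n (fun s => cabs (F s)) t.
have Yle := cabs_fejer_cmean_le t n0 p1 Fp.
have Y0 : 0 <= Y by exact: le_trans (cabs_ge0 _) Yle.
apply: (@le_trans _ _ (Y `^ p)).
  by apply: ge0_ler_powR => //; rewrite ?nnegrE ?cabs_ge0//; lra.
have ci2 : arc_integrable (fun s => cabs (F s) - Y) by apply: arc_integrableB => //; exact: arc_integrable_cst.
have ci3 : arc_integrable (fun s => Y `^ p + p * Y `^ (p - 1) * (cabs (F s) - Y)).
  by apply: arc_integrableD; [exact: arc_integrable_cst|exact: arc_integrableZ].
have -> : Y `^ p = fejer_mean n (fun s => Y `^ p + p * Y `^ (p - 1) * (cabs (F s) - Y)) t.
  rewrite fejer_meanD//; [|exact: arc_integrable_cst|exact: arc_integrableZ].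
  rewrite fejer_mean_cst// fejer_meanZ// fejer_meanB//; last exact: arc_integrable_cst.
  by rewrite fejer_mean_cst// subrr mulr0 addr0.
by apply: fejer_mean_le => // s _; apply: powR_tangent => //; exact: cabs_ge0.
Qed.

Lemma continuous_fejer_mean n u : arc_integrable u -> continuous (fejer_mean n u).
Proof.
move=> ui; have -> : fejer_mean n u = fun t => complex.Re (fejer_poly n u).[cis t].
  by apply/funext => t; exact: fejer_poly_cis.
by have [] := continuous_polynomial_cis (fejer_poly n u).
Qed.

Lemma fejer_cmean_Lp p n F : (0 < n)%N -> 1 < p -> Lp p F -> Lp p (fejer_cmean n F).
Proof.
move=> n0 p1 Fp; have [ri ii ci] := Lp_integrable p1 Fp; have [_ _ Fi] := Fp.
have mr : measurable_fun setT (fun t => complex.Re (fejer_cmean n F t)).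
  exact: continuous_measurable (continuous_fejer_mean ri).
have mi : measurable_fun setT (fun t => complex.Im (fejer_cmean n F t)).
  exact: continuous_measurable (continuous_fejer_mean ii).
split => //; apply: arc_integrable_le (fejer_mean_integrable n Fi) _.
  by apply: measurable_fun_powR; exact: measurable_cabs.
by move=> t; rewrite ger0_norm ?powR_ge0// fejer_cmean_jensen.
Qed.

Lemma fejer_cmean_contraction p n F : (0 < n)%N -> 1 < p -> Lp p F ->
  arc_integral (fun t => cabs (fejer_cmean n F t) `^ p) <= arc_integral (fun t => cabs (F t) `^ p).
Proof.
move=> n0 p1 Fp; have [_ _ Fi] := Fp; have [_ _ si] := fejer_cmean_Lp n0 p1 Fp.
rewrite -[leRHS](arc_integral_fejer_mean n0 Fi); apply: le_arc_integral => //.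
  exact: fejer_mean_integrable.
by move=> t _; exact: fejer_cmean_jensen.
Qed.

Lemma fejer_cmean_cvg p F e : 1 < p -> Lp p F -> 0 < e ->
  exists N, forall n, (N <= n)%N -> arc_integral (fun t => cabs (fejer_cmean n.+1 F t - F t)) <= e.
Proof.
move=> p1 Fp e0; have [ri ii ci] := Lp_integrable p1 Fp.
have e2 : 0 < e / 2 by lra.
have [N1 H1] := fejer_mean_cvg ri e2; have [N2 H2] := fejer_mean_cvg ii e2.
exists (maxn N1 N2) => n; rewrite geq_max => /andP[/H1 h1 /H2 h2].
have rn := arc_integrable_norm (arc_integrableB (fejer_mean_integrable n.+1 ri) ri).
have in_ := arc_integrable_norm (arc_integrableB (fejer_mean_integrable n.+1 ii) ii).
rewrite [leRHS]splitr; apply: le_trans (lerD h1 h2); rewrite -arc_integralD//.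
apply: le_arc_integral.
- have [//] := Lp_integrable p1 (LpB (ltW (lt_trans ltr01 p1)) (fejer_cmean_Lp (isT : (0 < n.+1)%N) p1 Fp) Fp).
- exact: arc_integrableD.
- by move=> t _; apply: le_trans (cabs_le_ReIm _) _; rewrite ReB ImB.
Qed.

End Lp_class.

(** * Fourier coefficients *)

Section fourier_coefficients.
Context {R : realType}.
Local Notation mu := (@arc_measure R).
Implicit Types (u v : R -> R) (p x y : R) (F G : R -> R[i]) (k : int) (q : {poly R[i]}).

Definition cintegrable F := arc_integrable (fun t => complex.Re (F t)) /\
  arc_integrable (fun t => complex.Im (F t)).

Lemma cintegralE F : cintegral F = arc_integral (fun t => complex.Re (F t)) +i*
  arc_integral (fun t => complex.Im (F t)).
Proof. by []. Qed.

Lemma cintegrableD F G : cintegrable F -> cintegrable G -> cintegrable (fun t => F t + G t).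
Proof.
move=> [fr fi] [gr gi]; split.
  by under eq_fun do rewrite ReD; exact: arc_integrableD.
by under eq_fun do rewrite ImD; exact: arc_integrableD.
Qed.

Lemma cintegralD F G : cintegrable F -> cintegrable G ->
  cintegral (fun t => F t + G t) = cintegral F + cintegral G.
Proof.
move=> [fr fi] [gr gi]; rewrite !cintegralE.
rewrite (eq_arc_integral (fun t => ReD (F t) (G t))) (eq_arc_integral (fun t => ImD (F t) (G t))).
by rewrite !arc_integralD.
Qed.

Lemma cintegrableN F : cintegrable F -> cintegrable (fun t => - F t).
Proof.
move=> [fr fi]; split.
  by under eq_fun do rewrite ReN; exact: arc_integrableN.
by under eq_fun do rewrite ImN; exact: arc_integrableN.
Qed.

Lemma cintegralN F : cintegrable F -> cintegral (fun t => - F t) = - cintegral F.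
Proof.
move=> [fr fi]; rewrite !cintegralE.
rewrite (eq_arc_integral (fun t => ReN (F t))) (eq_arc_integral (fun t => ImN (F t))).
have E w : arc_integrable w -> arc_integral (fun t => - w t) = - arc_integral w.
  by move=> wi; rewrite -mulN1r -arc_integralZ//; apply: eq_arc_integral => t; rewrite mulN1r.
by rewrite !E.
Qed.

Lemma cintegrable_sum (I : Type) (r : seq I) (f : I -> R -> R[i]) :
  (forall i, cintegrable (f i)) -> cintegrable (fun t => \sum_(i <- r) f i t).
Proof.
move=> fi; elim: r => [|i r ih].
  by under eq_fun do rewrite big_nil; split; exact: arc_integrable_cst.
by under eq_fun do rewrite big_cons; exact: cintegrableD.
Qed.

Lemma cintegral_sum (I : Type) (r : seq I) (f : I -> R -> R[i]) :
  (forall i, cintegrable (f i)) ->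
  cintegral (fun t => \sum_(i <- r) f i t) = \sum_(i <- r) cintegral (f i).
Proof.
move=> fi; elim: r => [|i r ih].
  rewrite big_nil; under [X in cintegral X]eq_fun do rewrite big_nil.
  by rewrite cintegralE !arc_integral_cst !mul0r.
rewrite big_cons; under [X in cintegral X]eq_fun do rewrite big_cons.
by rewrite cintegralD ?ih//; exact: cintegrable_sum.
Qed.

Lemma cintegral_norm_le F : cintegrable F -> arc_integrable (fun t => cabs (F t)) ->
  cabs (cintegral F) <= 2 * arc_integral (fun t => cabs (F t)).
Proof.
move=> [fr fi] fc; apply: le_trans (cabs_le_ReIm _) _; rewrite cintegralE /=.
have B w : arc_integrable w -> (forall t, `|w t| <= cabs (F t)) ->
    `|arc_integral w| <= arc_integral (fun t => cabs (F t)).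
  move=> wi wF; apply: le_trans (norm_arc_integral_le wi) _.
  by apply: le_arc_integral => //; exact: arc_integrable_norm.
have := B _ fr (fun t => norm_Re_le (F t)); have := B _ fi (fun t => norm_Im_le (F t)); lra.
Qed.

(** The factor [b] stands for the sign of the frequency, so that positive and negative frequencies
    are integrated at once. *)
Let trig (a : R[i]) (b : R) (n : nat) : let F := (fun t => a * (cos (n%:R * t) +i* (b * sin (n%:R * t)))) in
  cintegrable F /\ cintegral F = if n == 0%N then a * (2 * pi)%:C else 0.
Proof.
case: a => a1 a2 F.
have ci := arc_integrable_cos (n%:R : R); have si := arc_integrable_sin (n%:R : R).
have re t : complex.Re (F t) = a1 * cos (n%:R * t) + (- (a2 * b)) * sin (n%:R * t).
  by rewrite /F ReM /=; ring.
have im t : complex.Im (F t) = a2 * cos (n%:R * t) + a1 * b * sin (n%:R * t).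
  by rewrite /F ImM /=; ring.
split.
  by split; [under eq_fun do rewrite re|under eq_fun do rewrite im]; apply: arc_integrableD; exact: arc_integrableZ.
rewrite cintegralE (eq_arc_integral re) (eq_arc_integral im).
rewrite !arc_integralD; try exact: arc_integrableZ.
rewrite !arc_integralZ// arc_integral_sin arc_integral_cos !mulr0 !addr0.
by case: eqP => _; apply: complex_eqP; rewrite ?(ReM, ImM) /= ?mulr0 ?subr0 ?add0r ?addr0//; ring.
Qed.

Let trig_cis (a : R[i]) k : exists (b : R) (n : nat), (n == 0%N) = (k == 0) /\
  (fun t : R => a * cis (k%:~R * t)) = (fun t => a * (cos (n%:R * t) +i* (b * sin (n%:R * t)))).
Proof.
case: k => n; [exists 1, n|exists (-1), n.+1]; split => //; apply/funext => t; rewrite /cis.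
  by rewrite mul1r.
by rewrite NegzE mulrNz mulNr cosN sinN mulN1r.
Qed.

Lemma cintegrable_cis (a : R[i]) k : cintegrable (fun t : R => a * cis (k%:~R * t)).
Proof. by have [b [n [_ ->]]] := trig_cis a k; have [] := trig a b n. Qed.

Lemma cintegral_cis (a : R[i]) k : cintegral (fun t : R => a * cis (k%:~R * t)) = if k == 0 then a * (2 * pi)%:C else 0.
Proof. by have [b [n [<- ->]]] := trig_cis a k; have [] := trig a b n. Qed.

(* 2 pi times the Fourier coefficient of index k *)
Definition fourier F k : R[i] := cintegral (fun t => F t * cis (- (k%:~R * t))).

Lemma fourier_coefE (f : circle R -> R[i]) k :
  fourier_coef f k = ((2 * pi)^-1)%:C * fourier (fun t => f (expi t)) k.
Proof. by []. Qed.

Lemma cintegrable_mul_cis F k : cintegrable F -> cintegrable (fun t => F t * cis (- (k%:~R * t))).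
Proof.
move=> [fr fi].
have cM (u : R -> R) : arc_integrable u -> arc_integrable (fun t => u t * cos (- (k%:~R * t))).
  move=> ui; apply: (@arc_integrableM_bounded _ _ _ 1) => //; last by move=> t; exact: cos_max.
  by under eq_fun do rewrite -mulNr; exact: measurable_cosM.
have sM (u : R -> R) : arc_integrable u -> arc_integrable (fun t => u t * sin (- (k%:~R * t))).
  move=> ui; apply: (@arc_integrableM_bounded _ _ _ 1) => //; last by move=> t; exact: sin_max.
  by under eq_fun do rewrite -mulNr; exact: measurable_sinM.
split.
  by under eq_fun do rewrite ReM /=; apply: arc_integrableB; [exact: cM|exact: sM].
by under eq_fun do rewrite ImM /=; apply: arc_integrableD; [exact: sM|exact: cM].
Qed.

Lemma fourierB F G k : cintegrable F -> cintegrable G ->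
  fourier (fun t => F t - G t) k = fourier F k - fourier G k.
Proof.
move=> Fi Gi; rewrite /fourier -cintegralN; last exact: cintegrable_mul_cis.
rewrite -cintegralD; [|exact: cintegrable_mul_cis|by apply: cintegrableN; exact: cintegrable_mul_cis].
by congr cintegral; apply/funext => t; rewrite mulrBl.
Qed.

Lemma fourier_norm_le F k : cintegrable F -> arc_integrable (fun t => cabs (F t)) ->
  cabs (fourier F k) <= 2 * arc_integral (fun t => cabs (F t)).
Proof.
move=> Fi Fc; have E t : cabs (F t * cis (- (k%:~R * t))) = cabs (F t).
  by rewrite cabsM (eqP (cabs_cis _)) mulr1.
rewrite -(eq_arc_integral E); apply: cintegral_norm_le; first exact: cintegrable_mul_cis.
by under eq_fun do rewrite E.
Qed.

Lemma fourier_sum (c : nat -> R[i]) N k :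
  fourier (fun t => \sum_(0 <= m < N) c m * cis t ^+ m) k =
  if k is Posz m then if (m < N)%N then c m * (2 * pi)%:C else 0 else 0.
Proof.
have E t : (\sum_(0 <= m < N) c m * cis t ^+ m) * cis (- (k%:~R * t)) =
    \sum_(0 <= m < N) c m * cis ((m%:Z - k)%:~R * t).
  rewrite big_distrl/=; apply: eq_bigr => m _.
  by rewrite cisX -mulrA -cisD; congr (_ * cis _); rewrite intrB mulrBl.
rewrite /fourier; under [X in cintegral X]eq_fun do rewrite E.
rewrite cintegral_sum; last by move=> m; exact: cintegrable_cis.
under eq_bigr do rewrite cintegral_cis subr_eq0.
case: k {E} => n; last by rewrite big1.
case: ifPn => nN; last first.
  rewrite big_nat_cond big1// => m; rewrite andbT => /andP[_ mN]; case: ifPn => // /eqP[mn].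
  by move: nN; rewrite -mn mN.
rewrite (bigD1_seq n)/= ?mem_index_iota ?iota_uniq// eqxx big1 ?addr0// => m mn.
by rewrite eqz_nat (negbTE mn).
Qed.

Lemma fejer_cmeanE n F t : cintegrable F -> fejer_cmean n F t =
  \sum_(0 <= m < n) (fejer_weight n m / (2 * pi) / 2)%:C *
    (fourier F m%:Z * cis (m%:R * t) + fourier F (- m%:Z) * cis (- (m%:R * t))).
Proof.
move=> [fr fi].
have cI (u : R -> R) (m : nat) : arc_integrable u -> arc_integrable (fun t => u t * cos (m%:R * t)).
  move=> ui; apply: (@arc_integrableM_bounded _ _ _ 1) => //; last by move=> ?; exact: cos_max.
  exact: measurable_cosM.
have sI (u : R -> R) (m : nat) : arc_integrable u -> arc_integrable (fun t => u t * sin (m%:R * t)).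
  move=> ui; apply: (@arc_integrableM_bounded _ _ _ 1) => //; last by move=> ?; exact: sin_max.
  exact: measurable_sinM.
pose rF t := complex.Re (F t); pose iF t := complex.Im (F t).
have fp (m : nat) : fourier F m%:Z = (cos_coef rF m + sin_coef iF m) +i* (cos_coef iF m - sin_coef rF m).
  rewrite /fourier cintegralE; apply: complex_eqP => /=.
    rewrite -arc_integralD; [|exact: cI|exact: sI].
    by apply: eq_arc_integral => s; rewrite ReM /= cosN sinN; ring.
  rewrite -arc_integralB; [|exact: cI|exact: sI].
  by apply: eq_arc_integral => s; rewrite ImM /= cosN sinN; ring.
have fm (m : nat) : fourier F (- m%:Z) = (cos_coef rF m - sin_coef iF m) +i* (cos_coef iF m + sin_coef rF m).
  rewrite /fourier cintegralE; apply: complex_eqP => /=.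
    rewrite -arc_integralB; [|exact: cI|exact: sI].
    by apply: eq_arc_integral => s; rewrite ReM /= mulrNz mulNr opprK; ring.
  rewrite -arc_integralD; [|exact: cI|exact: sI].
  by apply: eq_arc_integral => s; rewrite ImM /= mulrNz mulNr opprK; ring.
apply: complex_eqP; rewrite [LHS]/= fejer_meanE//.
  rewrite (big_morph _ (@ReD R) (erefl : complex.Re (0 : R[i]) = 0)); apply: eq_bigr => m _.
  rewrite Re_realM fp fm ReD !ReM /= cosN sinN.
  by move: (fejer_weight n m / (2 * pi)) => w; field.
rewrite (big_morph _ (@ImD R) (erefl : complex.Im (0 : R[i]) = 0)); apply: eq_bigr => m _.
rewrite Im_realM fp fm ImD !ImM /= cosN sinN.
by move: (fejer_weight n m / (2 * pi)) => w; field.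
Qed.

Lemma fejer_cmean_analytic n F : cintegrable F -> (forall m : nat, (0 < m)%N -> fourier F (- m%:Z) = 0) ->
  exists q, forall t, fejer_cmean n F t = q.[cis t].
Proof.
move=> Fi F0.
exists (\sum_(0 <= m < n) (((fejer_weight n m / (2 * pi) / 2)%:C *
    (* At m = 0 the indices m and -m coincide, so the coefficient counts twice against the halved
       weight. *)
    (if m == 0%N then fourier F m%:Z *+ 2 else fourier F m%:Z))%:P * 'X^m)) => t.
rewrite fejer_cmeanE// horner_sum; apply: eq_bigr => m _.
rewrite hornerM hornerC hornerXn cisX -[RHS]mulrA; congr (_ * _).
case: m => [|m]; last by rewrite (F0 m.+1)// mul0r addr0.
by rewrite /= !mul0r !oppr0 cis0 !mulr1 mulr2n.
Qed.

(** The vanishing of the coefficient at 0 gives [q.[0] = 0], which later makes the product of the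
    two polynomials vanish at the origin. *)
Lemma fejer_cmean_coanalytic n F : cintegrable F -> (forall m : nat, fourier F m%:Z = 0) ->
  exists2 q, q.[0] = 0 & forall t, fejer_cmean n F t = conjc q.[cis t].
Proof.
move=> Fi F0.
exists (\sum_(0 <= m < n) (((fejer_weight n m / (2 * pi) / 2)%:C *
    conjc (fourier F (- m%:Z)))%:P * 'X^m)).
  rewrite horner_sum big1// => -[|m] _; rewrite hornerM hornerC hornerXn.
    by rewrite oppr0 F0 rmorph0 mulr0 mul0r.
  by rewrite expr0n /= mulr0.
have conjM (z w : R[i]) : conjc (z * w) = conjc z * conjc w by exact: rmorphM.
move=> t; rewrite fejer_cmeanE// horner_sum rmorph_sum; apply: eq_bigr => m _.
rewrite hornerM hornerC hornerXn cisX F0 mul0r add0r [RHS]conjM [X in _ = X * _]conjM.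
have conjK (z : R[i]) : conjc (conjc z) = z by exact: conjcK.
have conjR (x : R) : conjc (x%:C : R[i]) = x%:C by exact: conjc_real.
by rewrite conjK conjR -cisN -[RHS]mulrA.
Qed.

End fourier_coefficients.

(** * The upper bound *)

Section upper_bound.
Context {R : realType}.
Local Notation mu := (@arc_measure R).
Implicit Types (u v : R -> R) (p x y : R) (F G H : R -> R[i]) (k : int) (q : {poly R[i]}).

Lemma Lp_continuous p F : 0 < p -> continuous (fun t => complex.Re (F t)) ->
  continuous (fun t => complex.Im (F t)) -> Lp p F.
Proof.
move=> p0 fr fi; split; [exact: continuous_measurable|exact: continuous_measurable|].
have fc := cabs_continuous fr fi.
apply: continuous_arc_integrable => t.
have -> : (fun t => cabs (F t) `^ p) = (fun t => `|cabs (F t)| `^ p).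
  by apply/funext => s; rewrite ger0_norm// cabs_ge0.
exact: (cvg_comp (fun t => cabs (F t)) (fun x : R => `|x| `^ p) (fc t) (@continuous_norm_powR R p p0 _)).
Qed.

Lemma Lp_polynomial p q : 0 < p -> Lp p (fun t => q.[cis t]).
Proof. by move=> p0; have [qr qi] := continuous_polynomial_cis q; exact: Lp_continuous. Qed.

Lemma Lp_cintegrable p F : 1 < p -> Lp p F -> cintegrable F.
Proof. by move=> p1 Fp; have [? ?] := Lp_integrable p1 Fp. Qed.

Lemma Lnorm_powR_lt p F e : 0 < p -> Lp p F -> 0 < e ->
  (Lnorm mu p%:E (fun t => (cabs (F t))%:E) < e%:E)%E ->
  arc_integral (fun t => cabs (F t) `^ p) <= e `^ p.
Proof.
move=> p0 [fr fi Fi] e0; rewrite LnormE//; [|exact: measurable_cabs|by move=> t; exact: cabs_ge0].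
rewrite lte_fin => /ltW h; set I := arc_integral _ in h *.
have I0 : 0 <= I by apply: arc_integral_ge0 => t; exact: powR_ge0.
have -> : I = (I `^ p^-1) `^ p by rewrite -powRrM mulVf ?gt_eqF// powRr1.
by apply: ge0_ler_powR => //; rewrite ?nnegrE ?powR_ge0// ltW.
Qed.

(** Applying x <= 1 + x^p to x = |F| / e and multiplying by e gives a bound linear in e. *)
Lemma Lp_small_integral p F e : 1 < p -> Lp p F -> 0 < e ->
  (Lnorm mu p%:E (fun t => (cabs (F t))%:E) < e%:E)%E ->
  arc_integral (fun t => cabs (F t)) <= e * (2 * pi + 1).
Proof.
move=> p1 Fp e0 h; have p0 : 0 < p by lra.
have Ip := Lnorm_powR_lt p0 Fp e0 h.
have [_ _ ci] := Lp_integrable p1 Fp; have [_ _ Fi] := Fp.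
have maj : arc_integrable (fun t => e + e * e^-1 `^ p * cabs (F t) `^ p).
  by apply: arc_integrableD; [exact: arc_integrable_cst|exact: arc_integrableZ].
apply: le_trans (le_arc_integral ci maj _) _.
  move=> t _; have ei : 0 <= e^-1 by rewrite invr_ge0 ltW.
  have := le_one_powR p1 (mulr_ge0 ei (cabs_ge0 (F t))).
  rewrite powRM ?cabs_ge0// => hh.
  rewrite -(ler_pM2l e0) in hh; rewrite mulrA mulfV ?gt_eqF// mul1r in hh.
  by apply: le_trans hh _; rewrite mulrDr mulr1 mulrA.
rewrite arc_integralD; [|exact: arc_integrable_cst|exact: arc_integrableZ].
rewrite arc_integral_cst arc_integralZ// [leRHS]mulrDr mulr1 lerD2l.
apply: (@le_trans _ _ (e * e^-1 `^ p * e `^ p)).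
  by rewrite ler_wpM2l// mulr_ge0 ?powR_ge0// ltW.
rewrite -mulrA -powRM ?invr_ge0 ?(ltW e0)// mulVf ?gt_eqF// powR1 mulr1//.
Qed.

(** Convergence in norm implies convergence in L^1, hence of every Fourier coefficient, and the k-th
    coefficient of the partial sums is eventually constant. This is the information about the chosen
    limit that the upper bound uses. *)
Lemma riesz_fourier p (f g : circle R -> R[i]) k : 1 < p -> in_Lp p f -> in_Lp p g ->
  Lpnorm p (fun z => cabs (analytic_sum f N z - g z)) @[N --> \oo] --> 0%E ->
  fourier (fun t => g (expi t)) k = if (0 <= k)%R then fourier (fun t => f (expi t)) k else 0.
Proof.
move=> p1 fL gL lim; have p0 : 0 < p by lra.
have /(in_LpP _ p0) fp := fL; have /(in_LpP _ p0) gp := gL.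
pose S N (t : R) := analytic_sum f N (expi t).
have SE N : S N = fun t => \sum_(0 <= m < N) fourier_coef f m%:Z * cis t ^+ m by [].
have Sp N : Lp p (S N).
  have -> : S N = fun t => (\sum_(0 <= m < N) ((fourier_coef f m%:Z)%:P * 'X^m)).[cis t].
    apply/funext => t; rewrite SE horner_sum; apply: eq_bigr => m _.
    by rewrite hornerM hornerC hornerXn.
  exact: Lp_polynomial.
have Sk : exists N0, forall N, (N0 <= N)%N ->
    fourier (S N) k = if (0 <= k)%R then fourier (fun t => f (expi t)) k else 0.
  case: k => m; last by exists 0%N => N _; rewrite SE fourier_sum.
  exists m.+1 => N mN; rewrite SE fourier_sum /= mN fourier_coefE mulrC mulrA.
  have <- : (2 * pi * (2 * pi)^-1)%:C = (2 * pi)%:C * ((2 * pi)^-1)%:C :> R[i] by exact: rmorphM.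
  by rewrite mulfV ?gt_eqF ?pi2_gt0// mul1r.
have [N0 HN0] := Sk.
apply/eqP; rewrite -subr_eq0 -cabs_eq0 eq_le cabs_ge0 andbT; apply/ler_addgt0Pr => e e0; rewrite add0r.
have c0 : 0 < 2 * (2 * pi + 1) :> R by have := @pi_gt0 R; lra.
have e1 : 0 < e / (2 * (2 * pi + 1)) by rewrite divr_gt0.
have e1' : (0 < (e / (2 * (2 * pi + 1)))%:E)%E by rewrite lte_fin.
have [N1 _ HN1] := lim _ (open_ereal_lt' e1').
pose N := maxn N0 N1.
have h1 : (Lnorm mu p%:E (fun t => (cabs (S N t - g (expi t)))%:E) < (e / (2 * (2 * pi + 1)))%:E)%E.
  exact: (HN1 N (leq_maxr _ _)).
have dp : Lp p (fun t => S N t - g (expi t)) by apply: LpB => //; exact: ltW.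
have [_ _ dci] := Lp_integrable p1 dp.
have := fourier_norm_le k (Lp_cintegrable p1 dp) dci.
rewrite fourierB; [|exact: Lp_cintegrable p1 _|exact: Lp_cintegrable p1 _].
rewrite HN0 ?leq_maxl// cabsB => h2; apply: le_trans h2 _.
have := Lp_small_integral p1 dp e1 h1.
rewrite -(ler_pM2l (ltr0Sn R 1)) => h3; apply: le_trans h3 _.
by rewrite le_eqVlt; apply/orP; left; apply/eqP; field; rewrite gt_eqF//; have := @pi_gt0 R; lra.
Qed.

(** The tangent inequality at the truncated maximum of x and y: its slope is at most p M^(p - 1),
    and the truncated maximum changes by at most the sum of the changes of its arguments. *)
Lemma powR_max_diff_le p M x y x' y' : 1 < p -> 0 <= M -> 0 <= x -> 0 <= y -> 0 <= x' -> 0 <= y' ->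
  Num.min (Num.max x y) M `^ p <=
  Num.min (Num.max x' y') M `^ p + p * M `^ (p - 1) * (`|x' - x| + `|y' - y|).
Proof.
move=> p1 M0 x0 y0 x'0 y'0.
have mM a b : 0 <= Num.max a b -> 0 <= Num.min (Num.max a b) M by move=> h; rewrite le_min h M0.
have m0 : 0 <= Num.max x y by rewrite le_max x0.
have m0' : 0 <= Num.max x' y' by rewrite le_max x'0.
set A := Num.min (Num.max x y) M; set B := Num.min (Num.max x' y') M.
have A0 : 0 <= A by exact: mM. have B0 : 0 <= B by exact: mM.
have AM : A <= M by rewrite ge_min lexx orbT.
have AB : A - B <= `|x' - x| + `|y' - y|.
  rewrite lerBlDr /A /B ge_min; case: (leP (Num.max x' y') M) => h.
    apply/orP; left; rewrite ge_max; apply/andP; split.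
      have : x' <= Num.max x' y' by rewrite le_max lexx.
      have := ler_norm (x - x'); rewrite distrC; have := normr_ge0 (y' - y); lra.
    have : y' <= Num.max x' y' by rewrite le_max lexx orbT.
    have := ler_norm (y - y'); rewrite distrC; have := normr_ge0 (x' - x); lra.
  by apply/orP; right; rewrite lerDr addr_ge0.
have := powR_tangent p1 B0 A0.
have Am : A `^ (p - 1) <= M `^ (p - 1) by apply: ge0_ler_powR => //; rewrite ?nnegrE //; lra.
have p0 : 0 < p by lra.
have : p * A `^ (p - 1) * (A - B) <= p * M `^ (p - 1) * (`|x' - x| + `|y' - y|).
  have s0 : 0 <= `|x' - x| + `|y' - y| by rewrite addr_ge0.
  apply: (@le_trans _ _ (p * A `^ (p - 1) * (`|x' - x| + `|y' - y|))).
    by rewrite ler_wpM2l// mulr_ge0 ?powR_ge0// ltW.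
  by rewrite ler_wpM2r// ler_wpM2l// ltW.
by rewrite -[B - A]opprB mulrN; lra.
Qed.

Lemma measurable_max u v : measurable_fun setT u -> measurable_fun setT v ->
  measurable_fun setT (fun t => Num.max (u t) (v t)).
Proof. by move=> mu_ mv; exact: measurable_maxr. Qed.

Lemma max_Lp p G H : 1 < p -> Lp p G -> Lp p H ->
  arc_integrable (fun t => Num.max (cabs (G t)) (cabs (H t)) `^ p).
Proof.
move=> p1 [gr gi Gi] [hr hi Hi].
apply: (@arc_integrable_le _ _ (fun t => cabs (G t) `^ p + cabs (H t) `^ p)).
- by apply: measurable_fun_powR; apply: measurable_max; exact: measurable_cabs.
- exact: arc_integrableD.
- move=> t; rewrite ger0_norm ?powR_ge0//.
  by case: (leP (cabs (G t)) (cabs (H t))) => _; rewrite ?lerDl ?lerDr powR_ge0.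
Qed.

Lemma min_max_Lp p M G H : 1 < p -> 0 <= M -> Lp p G -> Lp p H ->
  arc_integrable (fun t => Num.min (Num.max (cabs (G t)) (cabs (H t))) M `^ p).
Proof.
move=> p1 M0 Gp Hp; have [gr gi _] := Gp; have [hr hi _] := Hp.
apply: arc_integrable_le (max_Lp p1 Gp Hp) _.
  apply: measurable_fun_powR; apply: measurable_minr => //.
  by apply: measurable_max; exact: measurable_cabs.
move=> t; have m0 : 0 <= Num.max (cabs (G t)) (cabs (H t)) by rewrite le_max cabs_ge0.
rewrite ger0_norm ?powR_ge0//; apply: ge0_ler_powR; rewrite ?nnegrE ?le_min ?m0//; first lra.
by rewrite ge_min lexx.
Qed.

(* Subharmonicity handles Fejer means; truncation at height M makes the
   functional Lipschitz, so that L^1 convergence of the means suffices. *)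
Lemma truncated_max_le p M F G H : 1 < p -> 0 <= M -> Lp p F -> Lp p G -> Lp p H ->
  (forall t, F t = G t + H t) -> (forall m : nat, (0 < m)%N -> fourier G (- m%:Z) = 0) ->
  (forall m : nat, fourier H m%:Z = 0) ->
  arc_integral (fun t => Num.min (Num.max (cabs (G t)) (cabs (H t))) M `^ p) <=
  (1 / sin (pi / p)) `^ p * arc_integral (fun t => cabs (F t) `^ p).
Proof.
move=> p1 M0 Fp Gp Hp FGH G0 H0; have p0 : 0 < p by lra.
set a := (1 / sin (pi / p)) `^ p; have a0 : 0 <= a by exact: powR_ge0.
have [b b0 pw] := minorant_inequality p1.
have Gci := Lp_cintegrable p1 Gp; have Hci := Lp_cintegrable p1 Hp.
pose c := p * M `^ (p - 1); have c0 : 0 <= c by rewrite mulr_ge0 ?powR_ge0// ltW.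
have sG n : Lp p (fejer_cmean n.+1 G) := fejer_cmean_Lp (isT : (0 < n.+1)%N) p1 Gp.
have sH n : Lp p (fejer_cmean n.+1 H) := fejer_cmean_Lp (isT : (0 < n.+1)%N) p1 Hp.
(* The means of G and H are polynomials w and conj z on the circle, with z vanishing at 0. The
   pointwise inequality is integrated, and the minorant term is dropped because its mean is
   nonnegative. *)
have fejer_bound n : arc_integral (fun t =>
    Num.max (cabs (fejer_cmean n.+1 G t)) (cabs (fejer_cmean n.+1 H t)) `^ p) <=
    a * arc_integral (fun t => cabs (F t) `^ p).
  have [w wE] := fejer_cmean_analytic n.+1 Gci G0.
  have [z z0 zE] := fejer_cmean_coanalytic n.+1 Hci H0.
  have FE t : fejer_cmean n.+1 F t = w.[cis t] + conjc z.[cis t].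
    rewrite -wE -zE /fejer_cmean; apply: complex_eqP => /=.
      rewrite -fejer_meanD; [|by case: Gci|by case: Hci].
      by congr fejer_mean; apply/funext => s; rewrite FGH ReD.
    rewrite -fejer_meanD; [|by case: Gci|by case: Hci].
    by congr fejer_mean; apply/funext => s; rewrite FGH ImD.
  have Fi : Lp p (fejer_cmean n.+1 F) := fejer_cmean_Lp (isT : (0 < n.+1)%N) p1 Fp.
  have [_ _ Fii] := Fi.
  have mi : arc_integrable (fun t => minorant p (w * z).[cis t]).
    apply: continuous_arc_integrable.
    by have [qr qi] := continuous_polynomial_cis (w * z); exact: minorant_comp_continuous.
  have m0 : 0 <= arc_integral (fun t => minorant p (w * z).[cis t]).
    by apply: minorant_mean_ge0 => //; rewrite hornerM z0 mulr0.
  apply: (@le_trans _ _ (a * arc_integral (fun t => cabs (fejer_cmean n.+1 F t) `^ p))); last first.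
    by apply: ler_wpM2l a0 _ _ _; exact: fejer_cmean_contraction p1 Fp.
  apply: (@le_trans _ _ (a * arc_integral (fun t => cabs (fejer_cmean n.+1 F t) `^ p)
      - b * arc_integral (fun t => minorant p (w * z).[cis t]))); last first.
    by rewrite gerBl mulr_ge0.
  rewrite -!arc_integralZ// -arc_integralB; [|exact: arc_integrableZ|exact: arc_integrableZ].
  apply: le_arc_integral.
  - exact: max_Lp p1 (sG n) (sH n).
  - by apply: arc_integrableB; exact: arc_integrableZ.
  - move=> t _; have := pw w.[cis t] z.[cis t].
    by rewrite hornerM FE wE zE cabsJ.
apply/ler_addgt0Pr => e e0.
(* The denominator uses c + 1 since c = 0 when M = 0. *)
have d0 : 0 < e / (2 * (c + 1)) by rewrite divr_gt0//; lra.
have [N1 H1] := fejer_cmean_cvg p1 Gp d0; have [N2 H2] := fejer_cmean_cvg p1 Hp d0.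
pose n := maxn N1 N2.
have := H1 n (leq_maxl _ _); have := H2 n (leq_maxr _ _) => {H1 H2}.
have [_ _ dG] := Lp_integrable p1 (LpB (ltW p0) (sG n) Gp).
have [_ _ dH] := Lp_integrable p1 (LpB (ltW p0) (sH n) Hp).
move=> hH hG.
have maj : arc_integrable (fun t => Num.max (cabs (fejer_cmean n.+1 G t)) (cabs (fejer_cmean n.+1 H t)) `^ p
   + c * (cabs (fejer_cmean n.+1 G t - G t) + cabs (fejer_cmean n.+1 H t - H t))).
  by apply: arc_integrableD; [exact: max_Lp p1 (sG n) (sH n)|apply: arc_integrableZ; exact: arc_integrableD].
apply: le_trans (le_arc_integral (min_max_Lp p1 M0 Gp Hp) maj _) _.
  move=> t _; apply: le_trans (powR_max_diff_le p1 M0 (cabs_ge0 (G t)) (cabs_ge0 (H t))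
    (cabs_ge0 (fejer_cmean n.+1 G t)) (cabs_ge0 (fejer_cmean n.+1 H t))) _.
  apply: lerD.
    set x := cabs (fejer_cmean _ G t); set y := cabs (fejer_cmean _ H t).
    have m0 : 0 <= Num.max x y by rewrite le_max cabs_ge0.
    by apply: ge0_ler_powR; rewrite ?nnegrE ?le_min ?m0 ?M0 ?(ltW p0)// ge_min lexx.
  by rewrite -/c ler_wpM2l// lerD// cabs_distB.
rewrite arc_integralD; [|exact: max_Lp p1 (sG n) (sH n)|by apply: arc_integrableZ; exact: arc_integrableD].
rewrite arc_integralZ ?arc_integralD//; last exact: arc_integrableD.
apply: lerD (fejer_bound n) _.
have c1 : 0 < 2 * (c + 1) by lra.
apply: (@le_trans _ _ ((c + 1) * (e / (2 * (c + 1)) + e / (2 * (c + 1))))).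
  apply: ler_pM => //; rewrite ?lerDl ?lerD//.
  by rewrite addr_ge0// arc_integral_ge0// => t; exact: cabs_ge0.
by rewrite le_eqVlt; apply/orP; left; apply/eqP; field; rewrite gt_eqF//; lra.
Qed.

(** The truncation height runs through the integers; at each t it is eventually inactive, and the
    untruncated power dominates. *)
Lemma max_le p F G H : 1 < p -> Lp p F -> Lp p G -> Lp p H ->
  (forall t, F t = G t + H t) -> (forall m : nat, (0 < m)%N -> fourier G (- m%:Z) = 0) ->
  (forall m : nat, fourier H m%:Z = 0) ->
  arc_integral (fun t => Num.max (cabs (G t)) (cabs (H t)) `^ p) <=
  (1 / sin (pi / p)) `^ p * arc_integral (fun t => cabs (F t) `^ p).
Proof.
move=> p1 Fp Gp Hp FGH G0 H0; have p0 : 0 < p by lra.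
pose U n t := Num.min (Num.max (cabs (G t)) (cabs (H t))) n%:R `^ p.
have mi := max_Lp p1 Gp Hp.
have m0 t : 0 <= Num.max (cabs (G t)) (cabs (H t)) by rewrite le_max cabs_ge0.
have Ui n : arc_integrable (U n) by exact: min_max_Lp.
have lim : arc_integral (U n) @[n --> \oo] --> arc_integral (fun t => Num.max (cabs (G t)) (cabs (H t)) `^ p).
  apply: (arc_integral_dominated _ _ _ mi).
  - by move=> n; exact: arc_integrableM.
  - exact: arc_integrableM.
  - move=> t; apply: cvg_near_cst.
    exists (Num.trunc (Num.max (cabs (G t)) (cabs (H t)))).+1 => // n /= hn.
    rewrite /U min_l//; apply: ltW; apply: lt_le_trans (truncnS_gt _) _.
    by rewrite ler_nat.
  - move=> n t; rewrite ger0_norm ?powR_ge0//; apply: ge0_ler_powR; rewrite ?nnegrE ?le_min ?m0 ?ler0n ?(ltW p0)//.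
    by rewrite ge_min lexx.
apply: (ler_cvg_to lim (cvg_cst _)); apply: nearW => n.
exact: truncated_max_le.
Qed.

End upper_bound.

(** * The upper bound for the Riesz projections *)

Section riesz_upper.
Context {R : realType}.
Local Notation mu := (@arc_measure R).
Implicit Types (u v : R -> R) (p s x y K : R) (F : R -> R[i]) (f : circle R -> R[i]).

Lemma Lnorm_le p K u F : 0 < p -> 0 <= K -> measurable_fun setT u -> (forall t, 0 <= u t) ->
  arc_integrable (fun t => u t `^ p) -> Lp p F ->
  arc_integral (fun t => u t `^ p) <= K `^ p * arc_integral (fun t => cabs (F t) `^ p) ->
  (Lnorm mu p%:E (fun t => (u t)%:E) <= K%:E * Lnorm mu p%:E (fun t => (cabs (F t))%:E))%E.
Proof.
move=> p0 K0 mu_ u0 ui [fr fi Fi] h.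
rewrite !LnormE//; try by [exact: measurable_cabs|move=> t; exact: cabs_ge0].
rewrite -EFinM lee_fin.
have pos (w : R -> R) : 0 <= arc_integral (fun t => w t `^ p).
  by apply: arc_integral_ge0 => t; exact: powR_ge0.
have -> : K = (K `^ p) `^ p^-1 by rewrite -powRrM mulfV ?gt_eqF// powRr1.
have I0 := pos (fun t => cabs (F t)).
rewrite -[leRHS]powRM ?powR_ge0//.
have ri : 0 <= p^-1 by rewrite invr_ge0 ltW.
exact: (ge0_ler_powR ri (pos u) (mulr_ge0 (powR_ge0 K p) I0) h).
Qed.

Lemma max_le_lnorm s x y : 0 < s -> 0 <= x -> 0 <= y ->
  Num.max x y <= (x `^ s + y `^ s) `^ s^-1.
Proof.
move=> s0 x0 y0; have m0 : 0 <= Num.max x y by rewrite le_max x0.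
have -> : Num.max x y = (Num.max x y `^ s) `^ s^-1 by rewrite -powRrM mulfV ?gt_eqF// powRr1.
apply: ge0_ler_powR; rewrite ?nnegrE ?addr_ge0 ?powR_ge0 ?invr_ge0 ?(ltW s0)//.
by case: (leP x y) => _; rewrite ?lerDl ?lerDr powR_ge0.
Qed.

Lemma lnorm_le_max s x y : 0 < s -> 0 <= x -> 0 <= y ->
  (x `^ s + y `^ s) `^ s^-1 <= 2 `^ s^-1 * Num.max x y.
Proof.
move=> s0 x0 y0; have m0 : 0 <= Num.max x y by rewrite le_max x0.
have mE : Num.max x y = (Num.max x y `^ s) `^ s^-1 by rewrite -powRrM mulfV ?gt_eqF// powRr1.
rewrite mE -(powRM _ (ler0n R 2) (powR_ge0 _ s)).
apply: ge0_ler_powR; rewrite ?nnegrE ?mulr_ge0 ?addr_ge0 ?powR_ge0 ?invr_ge0 ?(ltW s0)//.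
rewrite mulr_natl mulr2n; apply: lerD; apply: ge0_ler_powR; rewrite ?nnegrE ?(ltW s0)//.
  by rewrite le_max lexx.
by rewrite le_max lexx orbT.
Qed.

Lemma sin_pi_div p : 1 < p -> 0 < sin (pi / p) <= 1.
Proof.
move=> p1; have p0 : 0 < p by lra.
have pi0 := @pi_gt0 R.
rewrite sin_gt0_pi ?sin_le1 ?divr_gt0//= ltr_pdivrMr// ltr_pMr//.
Qed.

Lemma riesz_max_le p f : 1 < p -> in_Lp p f ->
  let g t := riesz_plus p f (expi t) in let h t := riesz_minus p f (expi t) in
  [/\ Lp p g, Lp p h & arc_integral (fun t => Num.max (cabs (g t)) (cabs (h t)) `^ p) <=
  (1 / sin (pi / p)) `^ p * arc_integral (fun t => cabs (f (expi t)) `^ p)].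
Proof.
move=> p1 fL g h; have p0 : 0 < p by lra.
have /(in_LpP _ p0) fp := fL.
have [[g0 Pg0]|no] := pselect (exists g0, [set g | in_Lp p g /\
    Lpnorm p (fun z => cabs (analytic_sum f N z - g z)) @[N --> \oo] --> 0%E] g0).
  have [gL lim] : [set g | in_Lp p g /\
    Lpnorm p (fun z => cabs (analytic_sum f N z - g z)) @[N --> \oo] --> 0%E] (riesz_plus p f).
    exact: (xgetPex _ (ex_intro _ _ Pg0)).
  have /(in_LpP _ p0) gp := gL.
  have hp : Lp p h by apply: LpB => //; exact: ltW.
  have coef k := riesz_fourier k p1 fL gL lim.
  split => //; apply: max_le => //.
  - by move=> t; rewrite /h /riesz_minus addrC subrK.
  - by move=> m m0; rewrite coef; case: m m0.
  - move=> m; rewrite /h /riesz_minus fourierB; [|exact: Lp_cintegrable p1 _|exact: Lp_cintegrable p1 _].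
    by rewrite coef /= subrr.
(* When no limit exists, [xget] returns its default 0. Then P+ f = 0 and P- f = f, and the bound
   follows from 1 / sin (pi / p) >= 1. *)
have g0 : g = fun=> 0.
  by apply/funext => t; rewrite /g /riesz_plus xgetPN// => x Px; apply: no; exists x.
have hE : h = fun t => f (expi t).
  by apply/funext => t; rewrite /h /riesz_minus -/(g t) g0 subr0.
rewrite hE g0; split => //.
  by apply: (@Lp_bounded _ _ _ 0); [exact: measurable_cst|exact: measurable_cst|exact: ltW|move=> t; rewrite cabs0].
have /andP[s0 s1] := sin_pi_div p1.
have a1 : 1 <= (1 / sin (pi / p)) `^ p.
  apply: (@le_trans _ _ (1 `^ p)); first by rewrite powR1.
  have le1 : 1 <= 1 / sin (pi / p) by rewrite ler_pdivlMr// mul1r.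
  exact: (ge0_ler_powR (ltW p0) (ler01 : 1 \in Num.nneg) (le_trans ler01 le1) le1).
apply: (@le_trans _ _ (arc_integral (fun t => cabs (f (expi t)) `^ p))).
  rewrite le_eqVlt; apply/orP; left; apply/eqP; apply: eq_arc_integral => t.
  by rewrite cabs0 max_r// cabs_ge0.
by rewrite ler_peMl// arc_integral_ge0// => t; exact: powR_ge0.
Qed.

Lemma riesz_upper_bound s p : 0 < s -> 1 < p -> riesz_bound s p (2 `^ s^-1 * (1 / sin (pi / p))).
Proof.
move=> s0 p1 f fL; have p0 : 0 < p by lra.
have /(in_LpP _ p0) fp := fL; have [gp hp mle] := riesz_max_le p1 fL.
move: gp hp mle; set g := fun t => riesz_plus p f (expi t); set h := fun t => riesz_minus p f (expi t).
move=> gp hp mle.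
have /andP[sp0 sp1] := sin_pi_div p1.
pose u t := (cabs (g t) `^ s + cabs (h t) `^ s) `^ s^-1.
have u0 t : 0 <= u t by exact: powR_ge0.
have [gr gi Gi] := gp; have [hr hi Hi] := hp.
have mu_ : measurable_fun setT u.
  by apply: measurable_fun_powR; apply: measurable_funD; apply: measurable_fun_powR; exact: measurable_cabs.
have m0 t : 0 <= Num.max (cabs (g t)) (cabs (h t)) by rewrite le_max cabs_ge0.
have mi : arc_integrable (fun t => Num.max (cabs (g t)) (cabs (h t)) `^ p) by exact: max_Lp.
have ub t : u t `^ p <= (2 `^ s^-1) `^ p * Num.max (cabs (g t)) (cabs (h t)) `^ p.
  rewrite -powRM ?powR_ge0//; apply: ge0_ler_powR; rewrite ?nnegrE ?mulr_ge0 ?powR_ge0 ?(ltW p0)//.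
  by apply: lnorm_le_max; rewrite ?cabs_ge0.
have maj := arc_integrableZ ((2 `^ s^-1) `^ p) mi.
have ui : arc_integrable (fun t => u t `^ p).
  apply: arc_integrable_le maj _; first exact: measurable_fun_powR.
  by move=> t; rewrite ger0_norm ?powR_ge0.
apply: (@Lnorm_le p _ u (fun t => f (expi t))) => //.
  by rewrite mulr_ge0 ?powR_ge0 ?divr_ge0// ltW.
rewrite powRM ?powR_ge0 ?divr_ge0 ?(ltW sp0)// -mulrA.
apply: le_trans (le_arc_integral ui maj (fun t _ => ub t)) _.
by rewrite arc_integralZ// ler_wpM2l ?powR_ge0.
Qed.

End riesz_upper.

(** * The lower bound *)

Section cauchy_power.
Context {R : realType}.
Implicit Types (s t x y : R) (F G : R -> R[i]) (k : int).

Lemma cintegrableZ (a : R[i]) F : cintegrable F -> cintegrable (fun t => a * F t).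
Proof.
move=> [fr fi]; split.
  by under eq_fun do rewrite ReM; apply: arc_integrableB; exact: arc_integrableZ.
by under eq_fun do rewrite ImM; apply: arc_integrableD; exact: arc_integrableZ.
Qed.

Lemma cintegralZ (a : R[i]) F : cintegrable F -> cintegral (fun t => a * F t) = a * cintegral F.
Proof.
move=> [fr fi]; rewrite !cintegralE.
rewrite (eq_arc_integral (fun t => ReM a (F t))) (eq_arc_integral (fun t => ImM a (F t))).
rewrite arc_integralB ?arc_integralD ?arc_integralZ//; try exact: arc_integrableZ.
by apply: complex_eqP; rewrite ?ReM ?ImM.
Qed.

Definition ccontinuous F := continuous (fun t => complex.Re (F t)) /\
  continuous (fun t => complex.Im (F t)).

Lemma ccontinuous_cst (a : R[i]) : ccontinuous (fun=> a).
Proof. by split => t; exact: cvg_cst. Qed.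

Lemma ccontinuousD F G : ccontinuous F -> ccontinuous G -> ccontinuous (fun t => F t + G t).
Proof.
move=> [fr fi] [gr gi]; split.
  rewrite (_ : (fun t => _) = (fun t => complex.Re (F t) + complex.Re (G t))).
    by move=> t; exact: (cvgD (fr t) (gr t)).
  by apply/funext => t; rewrite ReD.
rewrite (_ : (fun t => _) = (fun t => complex.Im (F t) + complex.Im (G t))).
  by move=> t; exact: (cvgD (fi t) (gi t)).
by apply/funext => t; rewrite ImD.
Qed.

Lemma ccontinuousM F G : ccontinuous F -> ccontinuous G -> ccontinuous (fun t => F t * G t).
Proof.
move=> [fr fi] [gr gi]; split.
  rewrite (_ : (fun t => _) = (fun t => complex.Re (F t) * complex.Re (G t) - complex.Im (F t) * complex.Im (G t))).
    by move=> t; exact: (cvgB (cvgM (fr t) (gr t)) (cvgM (fi t) (gi t))).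
  by apply/funext => t; rewrite ReM.
rewrite (_ : (fun t => _) = (fun t => complex.Re (F t) * complex.Im (G t) + complex.Im (F t) * complex.Re (G t))).
  by move=> t; exact: (cvgD (cvgM (fr t) (gi t)) (cvgM (fi t) (gr t))).
by apply/funext => t; rewrite ImM.
Qed.

Lemma ccontinuous_cis (v : R -> R) : continuous v -> ccontinuous (fun t => cis (v t)).
Proof.
move=> vc; split => t.
  exact: (cvg_comp v (@cos R) (vc t) (@continuous_cos R (v t))).
exact: (cvg_comp v (@sin R) (vc t) (@continuous_sin R (v t))).
Qed.

Lemma ccontinuous_real (v : R -> R) : continuous v -> ccontinuous (fun t => (v t)%:C).
Proof. by move=> vc; split => t; [exact: vc|exact: cvg_cst]. Qed.

Variables (p rho : R).
Hypotheses (p1 : 1 < p) (rho0 : 0 < rho) (rho1 : rho < 1).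

(** These are the real and imaginary parts, the squared modulus, the logarithm of the modulus and
    the argument of 1 - rho exp (i t). The real part is positive, so atan gives the principal
    argument. *)
Definition cauchy_re t : R := 1 - rho * cos t.
Definition cauchy_im t : R := - (rho * sin t).
Definition cauchy_sqr t : R := cauchy_re t ^+ 2 + cauchy_im t ^+ 2.
Definition cauchy_log t : R := ln (cauchy_sqr t) / 2.
Definition cauchy_arg t : R := atan (cauchy_im t / cauchy_re t).

Lemma cauchy_re_gt0 t : 0 < cauchy_re t.
Proof.
have := cos_max t; rewrite ler_norml => /andP[_ c1].
rewrite subr_gt0; apply: le_lt_trans rho1; rewrite -[leRHS]mulr1 ler_wpM2l//; exact: ltW.
Qed.

Lemma cauchy_sqr_gt0 t : 0 < cauchy_sqr t.
Proof. by rewrite ltr_pwDl ?sqr_ge0// exprn_gt0// cauchy_re_gt0. Qed.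

Lemma cauchy_sqrE t : cauchy_sqr t = 1 - 2 * rho * cos t + rho ^+ 2.
Proof.
rewrite /cauchy_sqr /cauchy_re /cauchy_im.
rewrite [LHS](_ : _ = 1 - 2 * rho * cos t + rho ^+ 2 * (cos t ^+ 2 + sin t ^+ 2)); last by ring.
by rewrite cos2Dsin2 mulr1.
Qed.

Lemma is_derive_cauchy_log t : is_derive t 1 cauchy_log (rho * sin t / cauchy_sqr t).
Proof.
have m0 := cauchy_sqr_gt0 t; rewrite /cauchy_log.
have -> : cauchy_sqr = fun t => 1 - 2 * rho * cos t + rho ^+ 2.
  by apply/funext => s; exact: cauchy_sqrE.
rewrite cauchy_sqrE in m0; derive; [exact: m0|by []|].
by field; rewrite gt_eqF.
Qed.

Lemma is_derive_cauchy_arg t : is_derive t 1 cauchy_arg (- (rho * (cos t - rho)) / cauchy_sqr t).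
Proof.
have r0 := cauchy_re_gt0 t; have m0 := cauchy_sqr_gt0 t.
have c2 := cos2Dsin2 t; rewrite /cauchy_sqr /cauchy_im /cauchy_re in r0 m0 *.
have r0' : 1 - rho * cos t != 0 by rewrite gt_eqF.
rewrite /cauchy_arg /cauchy_im /cauchy_re; derive; first exact: r0'.
have m0' : (1 - rho * cos t) ^+ 2 + (- (rho * sin t)) ^+ 2 != 0 by rewrite gt_eqF.
have -> : - (rho * (cos t - rho)) = - (rho * cos t) * (1 - rho * cos t) + (rho * sin t) ^+ 2.
  rewrite [RHS](_ : _ = - (rho * cos t) + rho ^+ 2 * (cos t ^+ 2 + sin t ^+ 2)); last by ring.
  by rewrite c2; ring.
move: (cos t) (sin t) r0' m0' => a b r0' m0'.
field.
by rewrite m0' r0'.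
Qed.

Lemma expR_cauchy_log t : expR (cauchy_log t) = Num.sqrt (cauchy_sqr t).
Proof.
have m0 := cauchy_sqr_gt0 t.
have <- : expR (cauchy_log t) ^+ 2 = cauchy_sqr t.
  by rewrite expr2 -expRD /cauchy_log -splitr lnK.
by rewrite sqrtr_sqr ger0_norm// expR_ge0.
Qed.

Lemma cauchy_polar t : 1 - rho%:C * cis t = (expR (cauchy_log t))%:C * cis (cauchy_arg t).
Proof.
rewrite expR_cauchy_log -polar_atan ?cauchy_re_gt0//.
by apply: complex_eqP; rewrite /= /cauchy_re /cauchy_im; ring.
Qed.

(* the principal branch of (1 - rho w)^(-1/p) *)
Definition cauchy_root (w : R[i]) : R[i] :=
  (expR (- (ln ((1 - rho * complex.Re w) ^+ 2 + (- (rho * complex.Im w)) ^+ 2) / 2 / p)))%:C *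
  cis (- (atan (- (rho * complex.Im w) / (1 - rho * complex.Re w)) / p)).

Lemma cauchy_root_cis t :
  cauchy_root (cis t) = (expR (- (cauchy_log t / p)))%:C * cis (- (cauchy_arg t / p)).
Proof. by []. Qed.

Lemma continuous_cauchy_log : continuous cauchy_log.
Proof. by move=> t; exact: is_derive_continuous (is_derive_cauchy_log t). Qed.

Lemma continuous_cauchy_arg : continuous cauchy_arg.
Proof. by move=> t; exact: is_derive_continuous (is_derive_cauchy_arg t). Qed.

Lemma continuous_cauchy_root : ccontinuous (fun t => cauchy_root (cis t)).
Proof.
apply: ccontinuousM; first apply: ccontinuous_real => t.
  have h : (- (cauchy_log s / p)) @[s --> t] --> - (cauchy_log t / p).
    exact: (cvgN (cvgM (@continuous_cauchy_log t) (cvg_cst _))).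
  exact: (cvg_comp (fun s => - (cauchy_log s / p)) (@expR R) h (@continuous_expR R _)).
by apply: ccontinuous_cis => t; exact: (cvgN (cvgM (@continuous_cauchy_arg t) (cvg_cst _))).
Qed.

Lemma cintegrable_continuous F : ccontinuous F -> cintegrable F.
Proof. by move=> [fr fi]; split; exact: continuous_arc_integrable. Qed.

Lemma cintegrable_cauchy_root : cintegrable (fun t => cauchy_root (cis t)).
Proof. exact: cintegrable_continuous continuous_cauchy_root. Qed.

Lemma cis_int2pi k : cis (k%:~R * (2 * pi)) = 1 :> R[i].
Proof.
case: k => n; first exact: cis_2pi.
by rewrite NegzE mulrNz mulNr cisN cis_2pi rmorph1.
Qed.

(* the derivative of (1 - rho z) F(z) z^(-k), with z = e^{it}, is
   i (rho (k - 1 + 1/p) z - k) F(z) z^(-k), and integrates to 0 *)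
Lemma fourier_cauchy_root_rec k :
  (k%:~R)%:C * fourier (fun t => cauchy_root (cis t)) k =
  (rho * (k%:~R - 1 + p^-1))%:C * fourier (fun t => cauchy_root (cis t)) (k - 1).
Proof.
have p0 : 0 < p := lt_trans ltr01 p1.
(* With this exponent, [e t] and [psi t] are the modulus and the argument of (1 - rho z) F(z)
   z^(-k). *)
pose al : R := 1 - p^-1; pose psi t : R := al * cauchy_arg t - k%:~R * t.
pose e t : R := expR (al * cauchy_log t).
pose dL t := rho * sin t / cauchy_sqr t; pose dA t := - (rho * (cos t - rho)) / cauchy_sqr t.
pose D t := (al * dL t +i* (al * dA t - k%:~R)) * ((e t)%:C * cis (psi t)).
have ge t : is_derive t 1 e (e t * (al * dL t)).
  have H := has_derive_expf (has_derive_mul (has_derive_const al t) (is_derive_cauchy_log t)).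
  by apply: has_derive_eq H _; rewrite mul0r add0r.
have gpsi t : is_derive t 1 psi (al * dA t - k%:~R).
  have H := has_derive_sub (has_derive_mul (has_derive_const al t) (is_derive_cauchy_arg t))
    (has_derive_mul (has_derive_const (k%:~R : R) t) (has_derive_var t)).
  by apply: has_derive_eq H _; rewrite !mul0r !add0r mulr1.
have gre t : is_derive t 1 (fun t => e t * cos (psi t)) (complex.Re (D t)).
  have H := has_derive_mul (ge t) (has_derive_cosf (gpsi t)).
  by apply: has_derive_eq H _; rewrite /D ReM Re_realM Im_realM /=; ring.
have gim t : is_derive t 1 (fun t => e t * sin (psi t)) (complex.Im (D t)).
  have H := has_derive_mul (ge t) (has_derive_sinf (gpsi t)).
  by apply: has_derive_eq H _; rewrite /D ImM Re_realM Im_realM /=; ring.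
have DE t : D t = (0 +i* (rho * (k%:~R - al))) * (cauchy_root (cis t) * cis (- ((k - 1)%:~R * t))) +
    (0 +i* (- k%:~R)) * (cauchy_root (cis t) * cis (- (k%:~R * t))).
  have e1 : (e t)%:C * cis (psi t) = (1 - rho%:C * cis t) * (cauchy_root (cis t) * cis (- (k%:~R * t))).
    rewrite cauchy_polar cauchy_root_cis /e /psi.
    have -> : al * cauchy_log t = cauchy_log t + - (cauchy_log t / p) by rewrite /al; ring.
    have -> : al * cauchy_arg t - k%:~R * t = cauchy_arg t + (- (cauchy_arg t / p) + - (k%:~R * t)) by rewrite /al; ring.
    by rewrite expRD rmorphM !cisD; ring.
  have e2 : cis (- ((k - 1)%:~R * t)) = cis t * cis (- (k%:~R * t)).
    by rewrite -cisD; congr cis; rewrite intrB; ring.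
  (* The logarithmic derivative has 1 - rho z as its only denominator; once it is cleared, an
     expression affine in z remains, hence two consecutive coefficients. *)
  have e3 : (al * dL t +i* (al * dA t - k%:~R)) * (1 - rho%:C * cis t) =
      (0 +i* (rho * (k%:~R - al))) * cis t + (0 +i* (- k%:~R)).
    have m0 : cauchy_sqr t != 0 by rewrite gt_eqF// cauchy_sqr_gt0.
    have mE := cauchy_sqrE t; have c2 := cos2Dsin2 t.
    apply: complex_eqP; rewrite ?ReD ?ImD ?ReM ?ImM /= /dL /dA.
      rewrite [LHS](_ : _ = al * rho * sin t * ((1 - 2 * rho * cos t + rho ^+ 2) / cauchy_sqr t) - k%:~R * rho * sin t).
        by rewrite -mE mulfV//; ring.
      by field.
    rewrite [LHS](_ : _ = - al * rho * cos t * ((1 - 2 * rho * cos t + rho ^+ 2) / cauchy_sqr t) - k%:~R * (1 - rho * cos t)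
       + al * rho ^+ 2 * (1 - (cos t ^+ 2 + sin t ^+ 2)) / cauchy_sqr t).
      by rewrite -mE mulfV// c2; ring.
    by field.
  by rewrite /D e1 e2 [LHS]mulrA e3; ring.
have Fi := cintegrable_cauchy_root.
have I1 := cintegrable_mul_cis (k - 1) Fi; have I2 := cintegrable_mul_cis k Fi.
have Dcc : ccontinuous D.
  have -> : D = fun t => (0 +i* (rho * (k%:~R - al))) * (cauchy_root (cis t) * cis (- ((k - 1)%:~R * t))) +
    (0 +i* (- k%:~R)) * (cauchy_root (cis t) * cis (- (k%:~R * t))) by apply/funext.
  have lc (a : R) : continuous (fun t => - (a * t)).
    by move=> t; apply: cvgN; exact: mulrl_continuous.
  by apply: ccontinuousD; (apply: ccontinuousM; [exact: ccontinuous_cst|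
    apply: ccontinuousM; [exact: continuous_cauchy_root|exact: ccontinuous_cis]]).
have D0 : cintegral D = 0.
  have [Dr Di] := Dcc; have [Dri Dii] := cintegrable_continuous Dcc.
  rewrite cintegralE (arc_integral_derive gre Dr Dri) (arc_integral_derive gim Di Dii).
  have eE : e (2 * pi) = e 0.
    rewrite /e; congr (expR (_ * _)); rewrite /cauchy_log !cauchy_sqrE.
    by have := @cos_2pi R 1; rewrite mul1r cos0 => ->.
  have cE : cis (psi (2 * pi)) = cis (psi 0) :> R[i].
    rewrite /psi mulr0 subr0 cisD cisN cis_int2pi rmorph1 mulr1; congr (cis (_ * _)).
    rewrite /cauchy_arg /cauchy_im /cauchy_re; have := @cos_2pi R 1; have := @sin_2pi R 1.
    by rewrite mul1r cos0 sin0 => -> ->.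
  have := congr1 (@complex.Re R) cE; have := congr1 (@complex.Im R) cE; rewrite /= eE => -> ->.
  by rewrite !subrr.
move: D0; have -> : D = fun t => (0 +i* (rho * (k%:~R - al))) * (cauchy_root (cis t) * cis (- ((k - 1)%:~R * t))) +
    (0 +i* (- k%:~R)) * (cauchy_root (cis t) * cis (- (k%:~R * t))) by apply/funext.
rewrite cintegralD; [|exact: cintegrableZ|exact: cintegrableZ].
rewrite !cintegralZ// -/(fourier _ _) -/(fourier _ _).
set X := fourier _ (k - 1); set Y := fourier _ k => XY.
have := congr1 (fun w : R[i] => (0 +i* (-1)) * w) XY.
rewrite mulr0 mulrDr !mulrA.
have -> : (0 +i* (-1)) * (0 +i* (rho * (k%:~R - al))) = (rho * (k%:~R - 1 + p^-1))%:C :> R[i].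
  by apply: complex_eqP; rewrite ?ReM ?ImM /= /al; ring.
have -> : (0 +i* (-1)) * (0 +i* (- k%:~R)) = - (k%:~R)%:C :> R[i].
  by apply: complex_eqP; rewrite ?ReM ?ImM ?ReN ?ImN /=; ring.
by move/eqP; rewrite mulNr subr_eq0 => /eqP ->.
Qed.

(** At k = 0 the left side of the recursion is 0 while the factor rho (1 / p - 1) on the right is
    not, so the coefficient at -1 vanishes. The factor stays nonzero for negative k, and the
    vanishing propagates downwards. *)
Lemma fourier_cauchy_root_neg (n : nat) : fourier (fun t => cauchy_root (cis t)) (- n.+1%:Z) = 0.
Proof.
have p0 : 0 < p := lt_trans ltr01 p1.
have pi1 : p^-1 < 1 by rewrite invf_lt1.
have real0 x : x%:C = 0 :> R[i] -> x = 0 by move=> /(congr1 (@complex.Re R)).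
elim: n => [|n ih].
  have := fourier_cauchy_root_rec 0; rewrite mul0r sub0r => /esym/eqP.
  rewrite mulf_eq0 => /orP[/eqP/real0/eqP|/eqP//].
  by rewrite mulf_eq0 gt_eqF//= => /eqP; move: pi1; clear; move=> *; exfalso; lra.
have := fourier_cauchy_root_rec (- n.+1%:Z); rewrite ih mulr0 => /esym/eqP.
rewrite mulf_eq0 => /orP[/eqP/real0/eqP|].
  rewrite mulf_eq0 gt_eqF//= mulrNz => /eqP.
  have : 0 <= (n.+1%:Z)%:~R :> R by exact: ler0n.
  move: (_%:~R) => x; move: pi1; clear; move=> *; exfalso; lra.
have -> : - n.+1%:Z - 1 = - n.+2%:Z by rewrite -opprD -[in RHS]addn1 PoszD.
by move/eqP.
Qed.

(** The recursion makes the ratio of consecutive coefficients rho (n + 1 / p) / (n + 1), which is at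
    most rho. *)
Lemma fourier_cauchy_root_pos (n : nat) : cabs (fourier (fun t => cauchy_root (cis t)) n%:Z) <=
  rho ^+ n * cabs (fourier (fun t => cauchy_root (cis t)) 0).
Proof.
have p0 : 0 < p := lt_trans ltr01 p1.
have pi1 : p^-1 < 1 by rewrite invf_lt1.
have pi0 : 0 < p^-1 by rewrite invr_gt0.
elim: n => [|n ih]; first by rewrite expr0 mul1r.
have n0 : 0 < (n.+1%:R : R) by rewrite ltr0n.
have := fourier_cauchy_root_rec n.+1%:Z.
rewrite (_ : n.+1%:Z - 1 = n%:Z); last by rewrite intS addrC addKr.
move=> /(congr1 (@cabs R)); rewrite !cabsM !cabs_real -!pmulrn (gtr0_norm n0).
rewrite (_ : n.+1%:R - 1 + p^-1 = n%:R + p^-1); last by rewrite -[n.+1%:R]natr1 addrK.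
have c0 : 0 <= rho * (n%:R + p^-1) by rewrite mulr_ge0 ?addr_ge0 ?ler0n// ltW.
rewrite (ger0_norm c0) => E.
rewrite -(ler_pM2l n0) E exprS.
apply: (@le_trans _ _ (rho * (n%:R + p^-1) * (rho ^+ n * cabs (fourier (fun t => cauchy_root (cis t)) 0)))).
  exact: ler_wpM2l c0 _ _ ih.
set Y := rho ^+ n * _.
have Y0 : 0 <= Y by rewrite mulr_ge0 ?exprn_ge0 ?cabs_ge0// ltW.
rewrite [leRHS](_ : _ = rho * n.+1%:R * Y); last by rewrite /Y; ring.
apply: ler_wpM2r => //; rewrite ler_wpM2l//; first exact: ltW.
by rewrite -[n.+1%:R]natr1 lerD2l ltW.
Qed.

Lemma arith_geometric_sum_le (N : nat) : (1 - rho) ^+ 2 * \sum_(0 <= m < N) m%:R * rho ^+ m <= 1.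
Proof.
have -> : (1 - rho) ^+ 2 * \sum_(0 <= m < N) m%:R * rho ^+ m =
    rho - rho ^+ N * (N%:R * (1 - rho) + rho).
  elim: N => [|N ih]; first by rewrite big_nil; ring.
  by rewrite big_nat_recr//= mulrDr ih [rho ^+ N.+1]exprS -[N.+1%:R]natr1; ring.
apply: (@le_trans _ _ rho); last exact: ltW.
rewrite gerBl mulr_ge0 ?exprn_ge0 ?(ltW rho0)// addr_ge0 ?(ltW rho0)// mulr_ge0// subr_ge0 ltW//.
Qed.

(** The Fejer means converge uniformly, and the N-th partial sum differs from the N-th mean by the
    sum of (m / N) a_m z^m / (2 pi), with a_m the unnormalised coefficients; by their geometric
    decay this is O(1 / N). *)
Lemma cauchy_root_partial_sums e : 0 < e -> exists N0, forall (N : nat) t, (N0 <= N)%N ->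
  cabs (\sum_(0 <= m < N) ((2 * pi)^-1)%:C * fourier (fun s => cauchy_root (cis s)) m%:Z * cis t ^+ m
    - cauchy_root (cis t)) <= e.
Proof.
move=> e0; have [fr fi] := continuous_cauchy_root.
have e4 : 0 < e / 4 by rewrite divr_gt0.
have c2 : cis 0 = cis (2 * pi) :> R[i] by have := @cis_2pi R 1; rewrite mul1r cis0 => ->.
have [N1 H1] := fejer_mean_uniform fr (congr1 (fun w => complex.Re (cauchy_root w)) c2) e4.
have [N2 H2] := fejer_mean_uniform fi (congr1 (fun w => complex.Im (cauchy_root w)) c2) e4.
set a := fourier _; pose A := cabs (a 0) / (1 - rho) ^+ 2.
have r1 : 0 < (1 - rho) ^+ 2 by rewrite exprn_gt0// subr_gt0.
have A0 : 0 <= A by rewrite divr_ge0 ?cabs_ge0// ltW.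
pose N3 := Num.trunc (2 * A / e).
exists (maxn N1 (maxn N2 N3)).+1 => -[//|N] t'; rewrite ltnS !geq_max => /and3P[n1 n2 n3].
have [t tI <-] := cis_representative t'.
have hF : cabs (fejer_cmean N.+1 (fun s => cauchy_root (cis s)) t - cauchy_root (cis t)) <= e / 2.
  apply: le_trans (cabs_le_ReIm _) _; rewrite ReB ImB /=.
  by have := lerD (H1 N t n1 tI) (H2 N t n2 tI); move: e4; lra.
have Fi := cintegrable_cauchy_root.
have FE : fejer_cmean N.+1 (fun s => cauchy_root (cis s)) t =
    \sum_(0 <= m < N.+1) ((1 - m%:R / N.+1%:R) / (2 * pi))%:C * a m%:Z * cis t ^+ m.
  rewrite fejer_cmeanE//; apply: eq_bigr => m _; rewrite cisX -/a.
  case: m => [|m].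
    rewrite /fejer_weight /= !mul0r !oppr0 cis0 !mulr1 addr0 -mulr2n.
    rewrite -[a 0 *+ 2]mulr_natl mulrA; congr (_ * _).
    have -> : (2 : R[i]) = (2 : R)%:C by rewrite rmorph_nat.
    by rewrite -rmorphM; congr (_%:C); rewrite mulfVK.
  rewrite /a fourier_cauchy_root_neg mul0r addr0 mulrA; congr (_%:C * _ * _).
  by rewrite /fejer_weight/=; move: (1 - _ / _) (2 * pi)^-1 => x y; field.
have dE : (\sum_(0 <= m < N.+1) ((2 * pi)^-1)%:C * a m%:Z * cis t ^+ m) -
    fejer_cmean N.+1 (fun s => cauchy_root (cis s)) t =
    \sum_(0 <= m < N.+1) (m%:R / N.+1%:R / (2 * pi))%:C * a m%:Z * cis (m%:R * t).
  rewrite FE -sumrB; apply: eq_bigr => m _; rewrite cisX -mulrBl -mulrBl; congr (_ * _ * _).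
  by rewrite -rmorphB; congr (_%:C); rewrite mulrBl mul1r opprB addrC subrK.
have hS : cabs (\sum_(0 <= m < N.+1) (m%:R / N.+1%:R / (2 * pi))%:C * a m%:Z * cis (m%:R * t)) <= e / 2.
  have N0 : 0 < N.+1%:R :> R by rewrite ltr0n.
  have pg := @pi2_gt0 R; have pg1 : (2 * pi)^-1 <= 1 :> R.
    by rewrite invf_le1//; have := @pi_ge2 R; lra.
  apply: (@le_trans _ _ (\sum_(0 <= m < N.+1) (m%:R * rho ^+ m) * (cabs (a 0) / N.+1%:R))).
    elim/big_rec2: _ => [|m y1 y2 _ ih]; first by rewrite cabs0.
    apply: le_trans (cabsD_le _ _) _; apply: lerD => //.
    rewrite !cabsM cabs_real (eqP (cabs_cis _)) mulr1 ger0_norm; last first.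
      by rewrite !mulr_ge0 ?invr_ge0 ?ler0n ?(ltW pg)// ltW.
    have am := fourier_cauchy_root_pos m.
    rewrite [leRHS](_ : _ = m%:R / N.+1%:R * (rho ^+ m * cabs (a 0))); last by ring.
    apply: ler_pM => //; rewrite ?cabs_ge0//.
      by rewrite !mulr_ge0 ?invr_ge0 ?ler0n ?(ltW pg)// ltW.
    by rewrite -[leRHS]mulr1 ler_wpM2l// divr_ge0 ?ler0n.
  rewrite -big_distrl/=.
  have sg := arith_geometric_sum_le N.+1.
  have sg' : \sum_(0 <= m < N.+1) m%:R * rho ^+ m <= ((1 - rho) ^+ 2)^-1.
    by rewrite -(ler_pM2l r1) mulfV ?(gt_eqF r1).
  apply: (@le_trans _ _ (A / N.+1%:R)).
    rewrite [leRHS](_ : _ = ((1 - rho) ^+ 2)^-1 * (cabs (a 0) / N.+1%:R)); last by rewrite /A; ring.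
    by rewrite ler_wpM2r// divr_ge0 ?cabs_ge0.
  rewrite ler_pdivrMr//.
  have := truncnS_gt (2 * A / e); rewrite ltr_pdivrMr// => h.
  have : (N3.+1%:R : R) <= N.+1%:R by rewrite ler_nat.
  rewrite -(ler_pM2r e0) /N3 => h2.
  by have := lt_le_trans h h2; lra.
rewrite (_ : _ - cauchy_root (cis t) = \sum_(0 <= m < N.+1) (m%:R / N.+1%:R / (2 * pi))%:C * a m%:Z * cis (m%:R * t) +
   (fejer_cmean N.+1 (fun s => cauchy_root (cis s)) t - cauchy_root (cis t))).
  by apply: le_trans (cabsD_le _ _) _; have := lerD hS hF; rewrite -splitr.
by rewrite -dE; ring.
Qed.

End cauchy_power.

(** * The test function and its Riesz projection *)

Section test_function.
Context {R : realType}.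
Local Notation mu := (@arc_measure R).
Implicit Types (t x y : R) (F G : R -> R[i]) (k : int).

Lemma Lp_ccontinuous p F : 0 < p -> ccontinuous F -> Lp p F.
Proof. by move=> p0 [fr fi]; exact: Lp_continuous. Qed.

Let N p F := Lnorm mu p%:E (fun t => (cabs (F t))%:E).

Lemma Lnorm_cabs_mono p F G : 0 < p -> Lp p F -> Lp p G -> (forall t, cabs (F t) <= cabs (G t)) ->
  (N p F <= N p G)%E.
Proof.
move=> p0 [fr fi Fi] Gp FG; have [_ _ Gi] := Gp.
rewrite -[leRHS]mul1e; apply: Lnorm_le => //; first exact: measurable_cabs.
  by move=> t; exact: cabs_ge0.
rewrite powR1 mul1r; apply: le_arc_integral => // t _.
exact: (ge0_ler_powR (ltW p0) (cabs_ge0 _) (cabs_ge0 _) (FG t)).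
Qed.

Lemma Lnorm_cabs_triangle p F G : 1 < p -> Lp p F -> Lp p G ->
  (N p F <= N p (fun t => F t - G t)%R + N p G)%E.
Proof.
move=> p1 Fp Gp; have p0 := lt_trans ltr01 p1.
have Dp : Lp p (fun t => F t - G t) by exact: LpB (ltW p0) Fp Gp.
have [dr di Di] := Dp; have [gr gi Gi] := Gp.
have md := measurable_cabs dr di; have mg := measurable_cabs gr gi.
apply: le_trans (minkowski_EFin mu md mg (ltW p1)).
pose H t : R[i] := (cabs (F t - G t) + cabs (G t))%:C.
have HE t : cabs (H t) = cabs (F t - G t) + cabs (G t).
  by rewrite cabs_real ger0_norm// addr_ge0 ?cabs_ge0.
have Hp : Lp p H.
  have realp (u : R -> R) : measurable_fun setT u -> arc_integrable (fun t => `|u t| `^ p) -> Lp p (fun t => (u t)%:C).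
    move=> mu_ ui; split; [exact: mu_|exact: (@measurable_cst _ _ _ _ setT (0 : R))|].
    by under eq_fun do rewrite cabs_real.
  have -> : H = fun t => (cabs (F t - G t))%:C + (cabs (G t))%:C.
    by apply/funext => t; rewrite /H rmorphD.
  apply: LpD (ltW p0) (realp _ md _) (realp _ mg _).
    by under eq_fun do rewrite ger0_norm ?cabs_ge0//.
  by under eq_fun do rewrite ger0_norm ?cabs_ge0//.
have le : (N p F <= N p H)%E.
  apply: Lnorm_cabs_mono => // t; rewrite HE.
  by rewrite -{1}[F t](subrK (G t)); exact: cabsD_le.
apply: le_trans le _; rewrite /N.
by under eq_fun do rewrite HE.
Qed.

(** The factor z moves the frequency n to n + 1 before conjugation, so an analytic F yields strictly
    negative frequencies only. *)
Lemma fourier_conj F k : cintegrable F ->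
  fourier (fun t => conjc (cis t * F t)) k = conjc (fourier F (- (k + 1))).
Proof.
move=> Fi; have E t : conjc (cis t * F t) * cis (- (k%:~R * t)) =
    conjc (F t * cis (- ((- (k + 1))%:~R * t))).
  have conjM (z w : R[i]) : conjc (z * w) = conjc z * conjc w by exact: rmorphM.
  rewrite !conjM -!cisN opprK [conjc (F t) * _]mulrC mulrAC -cisD; congr (cis _ * _).
  by rewrite intrN intrD; ring.
have [cr ci] := cintegrable_mul_cis (- (k + 1)) Fi.
rewrite /fourier; under [X in cintegral X]eq_fun do rewrite E.
rewrite !cintegralE; apply: complex_eqP => /=.
  by apply: eq_arc_integral => t; rewrite ReJ.
rewrite -mulN1r -arc_integralZ//; apply: eq_arc_integral => t; by rewrite mulN1r ImJ.
Qed.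

Variables (p rho c : R).
Hypotheses (p1 : 1 < p) (rho0 : 0 < rho) (rho1 : rho < 1).

Local Notation F := (fun t => cauchy_root p rho (cis t)).

Definition extremal (w : R[i]) : R[i] := cauchy_root p rho w + c%:C * conjc (w * cauchy_root p rho w).
Local Notation G := (fun t => extremal (cis t)).

Let conj_part : ccontinuous (fun t => conjc (cis t * F t)).
Proof.
have Fc := continuous_cauchy_root p rho0 rho1.
have [zr zi] := ccontinuousM (ccontinuous_cis (fun t => @cvg_id _ (nbhs t))) Fc.
split; first by under eq_fun do rewrite ReJ.
under eq_fun do rewrite ImJ.
by move=> t; exact: (cvgN (zi t)).
Qed.

Lemma continuous_extremal : ccontinuous G.
Proof.
apply: ccontinuousD; first exact: continuous_cauchy_root.
by apply: ccontinuousM; [exact: ccontinuous_cst|exact: conj_part].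
Qed.

Lemma fourier_extremal (n : nat) : fourier G n%:Z = fourier F n%:Z.
Proof.
have Fi := cintegrable_cauchy_root p rho0 rho1.
have Gi := cintegrable_continuous continuous_extremal.
have Zi := cintegrable_continuous conj_part.
apply/eqP; rewrite -subr_eq0 -fourierB//.
have -> : (fun t => G t - F t) = fun t => c%:C * conjc (cis t * F t).
  by apply/funext => t; rewrite /extremal addrC addKr.
rewrite /fourier; under [X in cintegral X]eq_fun do rewrite -mulrA.
rewrite cintegralZ; last exact: cintegrable_mul_cis.
rewrite -/(fourier _ _) fourier_conj// -PoszD addn1 fourier_cauchy_root_neg//.
by rewrite conjc0 mulr0.
Qed.

Let f (z : circle R) : R[i] := extremal (sval z).
Let S (n : nat) t : R[i] := analytic_sum f n (expi t).

Let SE n t : S n t = \sum_(0 <= m < n) ((2 * pi)^-1)%:C * fourier F m%:Z * cis t ^+ m.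
Proof. by apply: eq_bigr => m _; rewrite fourier_coefE fourier_extremal. Qed.

Let Sc n : ccontinuous (S n).
Proof.
have -> : S n = fun t => (\sum_(0 <= m < n) ((((2 * pi)^-1)%:C * fourier F m%:Z)%:P * 'X^m)).[cis t].
  apply/funext => t; rewrite SE horner_sum; apply: eq_bigr => m _.
  by rewrite hornerM hornerC hornerXn.
exact: continuous_polynomial_cis.
Qed.

Let p0 : 0 < p. Proof. exact: lt_trans ltr01 p1. Qed.
Let Fp : Lp p F. Proof. exact: Lp_ccontinuous p0 (continuous_cauchy_root p rho0 rho1). Qed.
Let Gp : Lp p G. Proof. exact: Lp_ccontinuous p0 continuous_extremal. Qed.
Let Sp n : Lp p (S n). Proof. exact: Lp_ccontinuous p0 (Sc n). Qed.

Let S_cvg : N p (fun t => S n t - F t) @[n --> \oo] --> 0%E.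
Proof.
have Dp n : Lp p (fun t => S n t - F t) by exact: LpB (ltW p0) (Sp n) Fp.
have NE n : N p (fun t => S n t - F t) = ((arc_integral (fun t => cabs (S n t - F t) `^ p)) `^ p^-1)%:E.
  have [dr di Di] := Dp n; rewrite /N LnormE//; first exact: measurable_cabs.
  by move=> t; exact: cabs_ge0.
under eq_fun do rewrite NE.
apply: cvg_EFin; first exact: nearW.
apply/cvgrPdist_le => e e0; pose w : R := (2 * pi) `^ p^-1.
have w0 : 0 < w by rewrite powR_gt0 ?pi2_gt0.
have [N0 HN] := cauchy_root_partial_sums p1 rho0 rho1 (divr_gt0 e0 w0).
exists N0 => // n /= n0; rewrite sub0r normrN ger0_norm ?powR_ge0//.
have [_ _ Di] := Dp n.
have ew0 : 0 <= e / w by rewrite divr_ge0 ?ltW.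
have ->: e = (((e / w) `^ p) * (2 * pi)) `^ p^-1.
  rewrite powRM ?powR_ge0 ?(ltW (@pi2_gt0 R))// -powRrM mulfV ?gt_eqF// powRr1// -/w.
  by rewrite divfK ?gt_eqF.
apply: ge0_ler_powR; rewrite ?nnegrE ?invr_ge0 ?(ltW p0)//.
- by apply: arc_integral_ge0 => t; exact: powR_ge0.
- by rewrite mulr_ge0 ?powR_ge0 ?(ltW (@pi2_gt0 R)).
rewrite -arc_integral_cst; apply: le_arc_integral => //; first exact: arc_integrable_cst.
move=> t _; rewrite SE; have := HN n t n0 => h.
exact: (ge0_ler_powR (ltW p0) (cabs_ge0 _) ew0 h).
Qed.

(** The representative chosen for P+ f may differ from F on a null set. Both are limits of the same
    partial sums, so their norms are compared by the triangle inequality, and P+ f is dominated by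
    the s-norm of the pair. *)
Lemma riesz_bound_extremal s C : 0 < s -> riesz_bound s p C ->
  (N p F <= C%:E * N p G)%E.
Proof.
move=> s0 bd.
have fL : in_Lp p f by apply/(in_LpP _ p0); exact: Gp.
have FL : in_Lp p (fun z : circle R => cauchy_root p rho (sval z)) by apply/(in_LpP _ p0); exact: Fp.
have [gL lim] : [set g | in_Lp p g /\
    Lpnorm p (fun z => cabs (analytic_sum f N z - g z)) @[N --> \oo] --> 0%E] (riesz_plus p f).
  by apply: (@xgetPex _ (fun=> 0)); exists (fun z : circle R => cauchy_root p rho (sval z)).
have [gp hp _] := riesz_max_le p1 fL.
set g := fun t => riesz_plus p f (expi t) in gp.
set h := fun t => riesz_minus p f (expi t) in hp.
have Fg : (N p F <= N p g)%E.
  apply/lee_addgt0Pr => e e0.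
  have e2 : (0 < (e / 2)%:E)%E by rewrite lte_fin divr_gt0.
  have [N1 _ H1] := S_cvg (open_ereal_lt' e2).
  have [N2 _ H2] := lim _ (open_ereal_lt' e2).
  pose n := maxn N1 N2.
  have h1 : (N p (fun t => S n t - F t)%R < (e / 2)%:E)%E := H1 n (leq_maxl _ _).
  have h2 : (N p (fun t => S n t - g t)%R < (e / 2)%:E)%E := H2 n (leq_maxr _ _).
  have t1 := Lnorm_cabs_triangle p1 Fp (Sp n).
  have t2 := Lnorm_cabs_triangle p1 (Sp n) gp.
  have sym : N p (fun t => F t - S n t) = N p (fun t => S n t - F t).
    by congr Lnorm; apply/funext => t; rewrite cabsB.
  rewrite sym in t1; apply: le_trans t1 _.
  apply: le_trans (leeD (ltW h1) (le_trans t2 (leeD (ltW h2) (lexx _)))) _.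
  by rewrite addeA -EFinD -splitr addeC.
apply: le_trans Fg (le_trans _ (bd f fL)).
pose u t := (cabs (g t) `^ s + cabs (h t) `^ s) `^ s^-1.
have u0 t : 0 <= u t by exact: powR_ge0.
have uE t : cabs ((u t)%:C : R[i]) = u t by rewrite cabs_real ger0_norm.
have [gr gi Gi] := gp; have [hr hi Hi] := hp.
have mu_ : measurable_fun setT u.
  by apply: measurable_fun_powR; apply: measurable_funD; apply: measurable_fun_powR; exact: measurable_cabs.
have up : Lp p (fun t => (u t)%:C).
  split; [exact: mu_|exact: (@measurable_cst _ _ _ _ setT (0 : R))|].
  have mi := arc_integrableZ ((2 `^ s^-1) `^ p) (max_Lp p1 gp hp).
  apply: arc_integrable_le mi _.
    by under eq_fun do rewrite uE; exact: measurable_fun_powR.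
  move=> t; rewrite uE ger0_norm ?powR_ge0// -powRM ?powR_ge0//; last by rewrite le_max cabs_ge0.
  have := lnorm_le_max s0 (cabs_ge0 (g t)) (cabs_ge0 (h t)) => le.
  exact: (ge0_ler_powR (ltW p0) (u0 t) (le_trans (u0 t) le) le).
have -> : Lpnorm p (fun z => (cabs (riesz_plus p f z) `^ s + cabs (riesz_minus p f z) `^ s) `^ s^-1)
    = N p (fun t => (u t)%:C).
  by congr Lnorm; apply/funext => t; rewrite uE.
apply: Lnorm_cabs_mono => // t; rewrite uE.
by apply: le_trans (max_le_lnorm s0 (cabs_ge0 _) (cabs_ge0 _)); rewrite le_max lexx.
Qed.

Lemma riesz_bound_extremal_integral s C : 0 < s -> riesz_bound s p C ->
  0 < arc_integral (fun t => cabs (F t) `^ p) ->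
  0 < C /\ arc_integral (fun t => cabs (F t) `^ p) <= C `^ p * arc_integral (fun t => cabs (G t) `^ p).
Proof.
move=> s0 bd; have := riesz_bound_extremal s0 bd.
have [fr fi Fi] := Fp; have [gr gi Gi] := Gp.
have NE H : Lp p H -> N p H = ((arc_integral (fun t => cabs (H t) `^ p)) `^ p^-1)%:E.
  move=> [hr hi Hi]; rewrite /N LnormE//; first exact: measurable_cabs.
  by move=> t; exact: cabs_ge0.
rewrite (NE _ Fp) (NE _ Gp) -EFinM lee_fin.
set I := arc_integral _; set J := arc_integral _ => le I0.
have J0 : 0 <= J by apply: arc_integral_ge0 => t; exact: powR_ge0.
clearbody I J; have Ip : 0 < I `^ p^-1 by rewrite powR_gt0.
have C0 : 0 < C.
  rewrite ltNge; apply/negP => C0; have := lt_le_trans Ip le; rewrite ltNge => /negP; apply.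
  by rewrite mulr_le0_ge0 ?powR_ge0.
split=> //; have pn0 : p^-1 * p = 1 by rewrite mulVf ?gt_eqF ?p0.
have rt x : 0 <= x -> (x `^ p^-1) `^ p = x by move=> x0; rewrite -powRrM pn0 powRr1.
rewrite -{1}(rt I (ltW I0)) -(rt J J0) -(powRM p (ltW C0) (powR_ge0 J p^-1)).
exact: (ge0_ler_powR (ltW p0) (ltW Ip) (le_trans (ltW Ip) le) le).
Qed.

End test_function.

(** * Integral estimates for the test function *)

Section extremal_estimates.
Context {R : realType}.
Implicit Types (t x y : R).

(** The left side is one coordinate of the chord between two points of the circle, whose squared
    length is 2 - 2 cos (x - y). *)
Lemma cos_lipschitz x y : `|cos x - cos y| <= `|x - y|.
Proof.
rewrite -[leLHS]ger0_norm// -ler_sqr ?nnegrE// !real_normK ?num_real//.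
apply: le_trans (cos_ge_quadratic (x - y)).
have := cos2Dsin2 x; have := cos2Dsin2 y => hy hx.
rewrite cosB [leRHS](_ : _ = (cos x - cos y) ^+ 2 + (sin x - sin y) ^+ 2 +
  (1 - (cos x ^+ 2 + sin x ^+ 2)) + (1 - (cos y ^+ 2 + sin y ^+ 2))); last by ring.
by rewrite hx hy subrr !addr0 lerDl sqr_ge0.
Qed.

Variables (p rho : R).
Hypotheses (p1 : 1 < p) (rho0 : 0 < rho) (rho1 : rho < 1).

Local Notation L := (cauchy_log rho).
Local Notation A := (cauchy_arg rho).
Local Notation m2 := (cauchy_sqr rho).

Let m20 t : 0 < m2 t. Proof. exact: cauchy_sqr_gt0. Qed.

Let p0 : 0 < p. Proof. exact: lt_trans ltr01 p1. Qed.

Lemma cabs_cauchy_root t : cabs (cauchy_root p rho (cis t)) `^ p = expR (- L t).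
Proof.
rewrite cauchy_root_cis cabsM cabs_cisE mulr1 cabs_real ger0_norm ?expR_ge0// -expRM.
by congr expR; rewrite mulNr divfK// gt_eqF ?p0.
Qed.

Let invm_sqr t : expR (- L t) ^+ 2 = (m2 t)^-1.
Proof.
rewrite expRN exprVn expR_cauchy_log// sqr_sqrtr//; exact: ltW.
Qed.

(** This is |f / F|^2, as F has argument - A / p. At t = 0 and A = +- pi / 2 it would be 1 + c^2 + 2
    c cos (pi / p), which is smallest for c = - cos (pi / p), with value sin^2 (pi / p). *)
Definition extremal_factor c t := 1 + c ^+ 2 + 2 * c * cos (t - 2 * A t / p).

Lemma cabs_extremal c t : cabs (extremal p rho c (cis t)) `^ p =
  expR (- L t) * extremal_factor c t `^ (p / 2).
Proof.
rewrite /extremal cauchy_root_cis.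
set r := expR _; set th := - (A t / p).
have -> : (r%:C * cis th + c%:C * conjc (cis t * (r%:C * cis th)) : R[i]) =
   r%:C * (cis th * (1 + c%:C * cis (- (t + 2 * th)))).
  have -> : conjc (cis t * (r%:C * cis th)) = r%:C * cis (- (t + th)) :> R[i].
    rewrite cisN cisD; apply: complex_eqP; rewrite ?ReJ ?ImJ ?(ReM, ImM) /= ?ReJ ?ImJ; ring.
  have -> : cis (- (t + th)) = cis th * cis (- (t + 2 * th)) :> R[i].
    by rewrite -cisD; congr cis; ring.
  by ring.
have Ege : extremal_factor c t = cabs (1 + c%:C * cis (- (t + 2 * th)) : R[i]) ^+ 2.
  rewrite sqr_cabs ReD ImD Re_realM Im_realM /= sinN cosN /extremal_factor.
  have -> : t - 2 * A t / p = t + 2 * th by rewrite /th; ring.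
  have := cos2Dsin2 (t + 2 * th) => c2.
  rewrite [RHS](_ : _ = 1 + 2 * c * cos (t + 2 * th) + c ^+ 2 * (cos (t + 2 * th) ^+ 2 + sin (t + 2 * th) ^+ 2)).
    by rewrite c2; ring.
  by ring.
rewrite cabsM cabs_real ger0_norm ?expR_ge0// cabsM cabs_cisE mul1r powRM ?expR_ge0 ?cabs_ge0//.
rewrite -expRM Ege sqr_powR_half ?cabs_ge0//; congr (expR _ * _).
by rewrite mulNr divfK// gt_eqF ?p0.
Qed.

Lemma cauchy_reE t : cauchy_re rho t = expR (L t) * cos (A t).
Proof.
have := congr1 (@complex.Re R) (cauchy_polar rho0 rho1 t).
rewrite Re_realM /= => <-; rewrite /cauchy_re; ring.
Qed.

Lemma continuous_cauchy_sqr : continuous m2.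
Proof.
have -> : m2 = fun t => 1 - 2 * rho * cos t + rho ^+ 2 by apply/funext => s; exact: cauchy_sqrE.
move=> t; apply: cvgD; last exact: cvg_cst.
by apply: cvgB; [exact: cvg_cst|apply: cvgM; [exact: cvg_cst|exact: continuous_cos]].
Qed.

Lemma continuous_cauchy_re_div : continuous (fun t => cauchy_re rho t / m2 t).
Proof.
have re_c : continuous (cauchy_re rho).
  by move=> t; apply: cvgB; [exact: cvg_cst|apply: cvgM; [exact: cvg_cst|exact: continuous_cos]].
by move=> t; apply: cvgM; [exact: re_c|apply: cvgV; [exact: lt0r_neq0|exact: continuous_cauchy_sqr]].
Qed.

(** The integrand is the real part of 1 / (1 - rho z), and t - A t is a periodic function plus t
    whose derivative it is. The value is independent of rho. *)
Lemma arc_integral_cauchy_re : arc_integral (fun t => cauchy_re rho t / m2 t) = 2 * pi.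
Proof.
have dA := is_derive_cauchy_arg rho0 rho1.
have E t : cauchy_re rho t / m2 t = 1 - (- (rho * (cos t - rho)) / m2 t).
  have m0 := lt0r_neq0 (m20 t).
  rewrite -[1](mulfV m0) -mulrBl; congr (_ / _).
  by rewrite cauchy_sqrE /cauchy_re; ring.
have D (t : R) : is_derive t 1 (fun s => s - A s) (cauchy_re rho t / m2 t).
  rewrite E; exact: has_derive_sub (has_derive_var t) (dA t).
have c := continuous_cauchy_re_div.
rewrite (arc_integral_derive D c (continuous_arc_integrable c)).
have -> : A (2 * pi) = A 0.
  rewrite /cauchy_arg /cauchy_im /cauchy_re; have := @cos_2pi R 1; have := @sin_2pi R 1.
  by rewrite mul1r cos0 sin0 => -> ->.
by rewrite sub0r opprK subrK.
Qed.

Lemma continuous_inv_modulus : continuous (fun t => expR (- L t)).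
Proof.
move=> t; exact: (cvg_comp (fun s => - L s) (@expR R) (cvgN (@continuous_cauchy_log R rho rho0 rho1 t))
  (@continuous_expR R (- L t))).
Qed.

(** The derivative of (1 - t / pi) L(t) is integrated: the weight takes the values 1 and -1 at the
    two ends, so the boundary terms add up to - 2 ln (1 - rho). That derivative is at most 2 exp (-
    L), because |L'| <= exp (- L) and - L <= exp (- L). *)
Lemma arc_integral_inv_modulus_ge : - ln (1 - rho) <= arc_integral (fun t => expR (- L t)).
Proof.
have dL := is_derive_cauchy_log rho0 rho1; have pi0 := @pi_gt0 R; have pi2 := @pi_ge2 R.
pose D t := (1 - pi^-1 * t) * (rho * sin t / m2 t) - pi^-1 * L t.
have DD (t : R) : is_derive t 1 (fun s => (1 - pi^-1 * s) * L s) (D t).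
  have lin := has_derive_sub (has_derive_const (1 : R) t)
     (has_derive_mul (has_derive_const (pi^-1 : R) t) (has_derive_var t)).
  apply: has_derive_eq (has_derive_mul lin (dL t)) _; rewrite /D; ring.
have m2_c := continuous_cauchy_sqr.
have lc : continuous (fun t : R => 1 - pi^-1 * t).
  by move=> t; apply: cvgB; [exact: cvg_cst|exact: mulrl_continuous].
have Lc := @continuous_cauchy_log R rho rho0 rho1.
have Dc : continuous D.
  move=> t; apply: cvgB; apply: cvgM; [exact: lc|apply: cvgM|exact: cvg_cst|exact: Lc].
    by apply: cvgM; [exact: cvg_cst|exact: continuous_sin].
  by apply: cvgV; [exact: lt0r_neq0|exact: m2_c].
have Di := continuous_arc_integrable Dc; have Ii := continuous_arc_integrable continuous_inv_modulus.
have L0 : L 0 = ln (1 - rho).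
  have r1 : 0 < 1 - rho by rewrite subr_gt0.
  rewrite /cauchy_log cauchy_sqrE cos0 (_ : 1 - 2 * rho * 1 + rho ^+ 2 = (1 - rho) * (1 - rho)); last by ring.
  by rewrite lnM ?posrE//; move: (ln _) => x; field.
have L2 : L (2 * pi) = L 0.
  by rewrite /cauchy_log !cauchy_sqrE; have := @cos_2pi R 1; rewrite mul1r cos0 => ->.
have pin : pi^-1 * pi = 1 :> R by rewrite mulVf// gt_eqF.
have IE : arc_integral D = - 2 * ln (1 - rho).
  rewrite (arc_integral_derive DD Dc Di) L2 L0 mulrCA pin mulr0 subr0; ring.
have le : arc_integral D <= arc_integral (fun t => 2 * expR (- L t)).
  apply: le_arc_integral => //; first exact: arc_integrableZ.
  move=> t /andP[t0 t1]; have e0 := expR_gt0 (- L t).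
  have h1 : - L t <= expR (- L t) by have := expR_ge1Dx (- L t); lra.
  have pi1 : pi^-1 <= 1 :> R by rewrite invf_le1//; lra.
  have pp : 0 < pi^-1 :> R by rewrite invr_gt0.
  have h2 : - (pi^-1 * L t) <= expR (- L t).
    rewrite -mulrN; apply: le_trans (ler_wpM2l (ltW pp) h1) _.
    by rewrite -[leRHS]mul1r ler_wpM2r// ltW.
  have h3 : `|rho * sin t / m2 t| <= expR (- L t).
    rewrite normrM normfV (gtr0_norm (m20 t)) ler_pdivrMr ?m20// -ler_sqr ?nnegrE//; last first.
      by rewrite mulr_ge0 ?(ltW e0) ?(ltW (m20 t)).
    rewrite real_normK ?num_real// [leRHS]exprMn invm_sqr [m2 t ^+ 2]expr2 mulrA mulVf ?mul1r; last by rewrite gt_eqF ?m20.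
    by rewrite /cauchy_sqr /cauchy_im sqrrN lerDr sqr_ge0.
  have h4 : `|1 - pi^-1 * t| <= 1.
    have : 0 <= pi^-1 * t by rewrite mulr_ge0// ltW.
    have : pi^-1 * t <= 2 by rewrite mulrC ler_pdivrMr.
    by move=> *; rewrite ler_norml; apply/andP; split; lra.
  have h5 : (1 - pi^-1 * t) * (rho * sin t / m2 t) <= expR (- L t).
    apply: le_trans (ler_norm _) _; rewrite normrM -[leRHS]mul1r; exact: ler_pM.
  by rewrite /D; lra.
move: le; rewrite IE arc_integralZ//; lra.
Qed.

Let extremal_factor_bounds c t : -1 <= c <= 1 -> 0 <= extremal_factor c t <= 4.
Proof.
move=> /andP[c1 c2]; rewrite /extremal_factor; set u := cos _.
have := cos_max (t - 2 * A t / p); rewrite -/u ler_norml => /andP[u1 u2].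
have cc : c ^+ 2 <= 1 by nra.
have uu : u ^+ 2 <= 1 by nra.
have cu : c * u <= 1 by nra.
apply/andP; split; last by lra.
rewrite (_ : 1 + c ^+ 2 + 2 * c * u = (1 + c * u) ^+ 2 + c ^+ 2 * (1 - u ^+ 2)); last by ring.
by apply: addr_ge0; [exact: sqr_ge0|apply: mulr_ge0; [exact: sqr_ge0|rewrite subr_ge0]].
Qed.

(** Replacing A by a quarter turn and t by 0 changes the cosine in the factor by at most 2 k each,
    and that cosine has a coefficient of modulus at most 2. *)
Let extremal_factor_near t k : 0 <= k -> pi / 2 - k <= `|A t| -> 1 - cos t <= k -> `|sin t| <= k ->
  extremal_factor (- cos (pi / p)) t <= sin (pi / p) ^+ 2 + 8 * k.
Proof.
move=> k0 hA hc hs; have pp : 0 < p^-1 < 1 by rewrite invr_gt0 p0 invf_lt1 ?p1// p0.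
have Al : `|A t| <= pi / 2.
  by rewrite ler_norml ltW ?atan_gtNpi2// ltW// atan_ltpi2.
set psi := 2 * A t / p; rewrite /extremal_factor -/psi.
have cN : cos psi = cos (2 * `|A t| / p).
  rewrite /psi; have [//|_] := ger0P (A t).
  by rewrite mulrN mulNr cosN.
have d1 : `|cos psi - cos (pi / p)| <= 2 * k.
  rewrite cN; apply: le_trans (cos_lipschitz _ _) _.
  rewrite (_ : 2 * `|A t| / p - pi / p = - (2 * (pi / 2 - `|A t|) * p^-1)); last by field; rewrite gt_eqF ?p0.
  rewrite normrN ger0_norm; last by rewrite !mulr_ge0 ?subr_ge0 ?invr_ge0 ?(ltW p0).
  rewrite -[leRHS]mulr1; apply: ler_pM; rewrite ?mulr_ge0 ?subr_ge0 ?invr_ge0 ?(ltW p0)//.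
    by rewrite ler_wpM2l//; lra.
  by case/andP: pp => _ /ltW.
have d2 : `|cos (t - psi) - cos psi| <= 2 * k.
  rewrite cosB (_ : _ - cos psi = - (cos psi * (1 - cos t)) + sin psi * sin t); last by ring.
  have c0 : 0 <= 1 - cos t by have := cos_max t; rewrite ler_norml subr_ge0 => /andP[].
  apply: le_trans (ler_normD _ _) _; rewrite normrN !normrM (ger0_norm c0).
  have -> : 2 * k = 1 * k + 1 * k by ring.
  by apply: lerD; apply: ler_pM => //; [exact: cos_max|exact: sin_max].
set c := cos (pi / p) in d1 *; have c2 := cos2Dsin2 (pi / p); rewrite -/c in c2.
have cl := cos_max (pi / p); rewrite -/c in cl.
have d3 : `|cos (t - psi) - c| <= 4 * k.
  rewrite (_ : _ - c = (cos (t - psi) - cos psi) + (cos psi - c)); last by ring.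
  by apply: le_trans (ler_normD _ _) _; lra.
have -> : 1 + (- c) ^+ 2 + 2 * - c * cos (t - psi) = (c ^+ 2 + sin (pi / p) ^+ 2) + c ^+ 2 - 2 * c * cos (t - psi).
  by rewrite c2; ring.
have h : - (c * (cos (t - psi) - c)) <= 4 * k.
  apply: le_trans (ler_norm _) _; rewrite normrN normrM -[leRHS]mul1r; exact: ler_pM.
by rewrite mulrBr -expr2 in h; move: h; lra.
Qed.

(** Where z is near 1 and |A| is near pi / 2, the factor is close to sin^2 (pi / p). Elsewhere exp
    (- L) is bounded by a term whose integral does not depend on rho: by the real part of 1 / (1 -
    rho z) over sin k if |A| < pi / 2 - k, and by 2 / k if z is away from 1. *)
Lemma extremal_integrand_le t k : 0 < k -> k <= 1 -> 2^-1 <= rho ->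
  expR (- L t) * extremal_factor (- cos (pi / p)) t `^ (p / 2) <=
  (sin (pi / p) ^+ 2 + 8 * k) `^ (p / 2) * expR (- L t) +
  4 `^ (p / 2) * ((sin k)^-1 * (cauchy_re rho t / m2 t) + 2 / k).
Proof.
move=> k0 k1 r2; set c := - cos (pi / p).
have c1 : -1 <= c <= 1 by have := cos_max (pi / p); rewrite -normrN ler_norml.
have /andP[E0 E4] := extremal_factor_bounds t c1.
have e0 := expR_gt0 (- L t); have p20 : 0 <= p / 2 by rewrite divr_ge0 ?(ltW p0).
have pi2 := @pi_ge2 R; have sk : 0 < sin k by apply: sin_gt0_pi; rewrite k0 /=; lra.
have vr0 : 0 <= cauchy_re rho t / m2 t by rewrite divr_ge0 ?ltW// cauchy_re_gt0.
have b1 : 0 <= (sin k)^-1 * (cauchy_re rho t / m2 t) by rewrite mulr_ge0// invr_ge0 ltW.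
have b2 : 0 <= 2 / k by rewrite divr_ge0// ltW.
have q0 : 0 <= 4 `^ (p / 2) :> R by exact: powR_ge0.
have a0 : 0 <= (sin (pi / p) ^+ 2 + 8 * k) `^ (p / 2) * expR (- L t) by rewrite mulr_ge0 ?powR_ge0// ltW.
have far : expR (- L t) <= (sin k)^-1 * (cauchy_re rho t / m2 t) + 2 / k ->
    expR (- L t) * extremal_factor c t `^ (p / 2) <=
    (sin (pi / p) ^+ 2 + 8 * k) `^ (p / 2) * expR (- L t) +
    4 `^ (p / 2) * ((sin k)^-1 * (cauchy_re rho t / m2 t) + 2 / k).
  move=> h; apply: ler_wpDl => //; rewrite mulrC; apply: ler_pM => //; rewrite ?powR_ge0 ?(ltW e0)//.
  exact: (ge0_ler_powR p20 E0 (le_trans E0 E4) E4).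
have [hA|hA] := leP (pi / 2 - k) `|A t|; last first.
  apply: far; apply: ler_wpDr => //.
  have ck : sin k <= cos (A t).
    have -> : sin k = cos (pi / 2 - k) by rewrite -cosN opprB cosBpihalf.
    have -> : cos (A t) = cos `|A t| by have [//|_] := ger0P (A t); rewrite cosN.
    by rewrite leNgt ltr_cos -?leNgt ?(ltW hA)// in_itv/=; apply/andP; split; move: (normr_ge0 (A t)); lra.
  have -> : cauchy_re rho t / m2 t = expR (- L t) * cos (A t).
    rewrite cauchy_reE -invm_sqr mulrC expr2 -mulrA; congr (_ * _).
    by rewrite mulrA -expRD addNr expR0 mul1r.
  by rewrite mulrCA -[leLHS]mulr1 ler_wpM2l ?(ltW e0)// mulrC ler_pdivlMr// mul1r.
have [hc|hc] := leP (1 - cos t) (k ^+ 2 / 2).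
  apply: ler_wpDr; first by rewrite mulr_ge0 ?addr_ge0.
  rewrite mulrC ler_wpM2r ?(ltW e0)//.
  have k22 : k ^+ 2 / 2 <= k by nra.
  have near : extremal_factor c t <= sin (pi / p) ^+ 2 + 8 * k.
    apply: extremal_factor_near => //; [exact: ltW|lra|].
    rewrite -ler_sqr ?nnegrE ?(ltW k0)// real_normK ?num_real//.
    have := cos2Dsin2 t; have := cos_max t; rewrite ler_norml => /andP[h1 h2] h3; nra.
  exact: (ge0_ler_powR p20 E0 (le_trans E0 near) near).
apply: far; apply: ler_wpDl => //.
rewrite -ler_sqr ?nnegrE ?(ltW e0)// invm_sqr -[leLHS]mul1r ler_pdivrMr ?m20//.
(* |1 - rho z|^2 = (1 - rho)^2 + 2 rho (1 - cos t), and 2 rho >= 1. *)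
have mk : k ^+ 2 / 2 <= m2 t.
  rewrite cauchy_sqrE; have := sqr_ge0 (1 - rho); nra.
apply: (@le_trans _ _ ((2 / k) ^+ 2 * (k ^+ 2 / 2))); last by rewrite ler_wpM2l ?sqr_ge0.
rewrite [leRHS](_ : _ = 2) ?ler1n//; by field; rewrite gt_eqF.
Qed.

End extremal_estimates.

(** * The lower bound and the limit of the optimal constants *)

Section riesz_lower.
Context {R : realType}.
Implicit Types (s p C k : R).

(** The integral I of |F|^p satisfies I <= q I + K, where [q] is the product to be bounded and [K]
    does not depend on rho. As I can be made arbitrarily large, q >= 1. *)
Lemma riesz_bound_approx s p C k : 0 < s -> 1 < p -> riesz_bound s p C -> 0 < k -> k <= 1 ->
  0 < C /\ 1 <= C `^ p * (sin (pi / p) ^+ 2 + 8 * k) `^ (p / 2).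
Proof.
move=> s0 p1 bd k0 k1.
have p0 : 0 < p := lt_trans ltr01 p1.
set q := C `^ p * _.
pose K := C `^ p * (4 `^ (p / 2) * ((sin k)^-1 * (2 * pi) + 2 / k * (2 * pi))).
have pi2 := @pi_ge2 R; have sk : 0 < sin k by apply: sin_gt0_pi; rewrite k0 /=; lra.
have K0 : 0 <= K.
  by rewrite !mulr_ge0 ?powR_ge0// addr_ge0// !mulr_ge0 ?invr_ge0 ?(ltW sk) ?(ltW k0) ?pi_ge0.
have main T : 1 <= T -> 0 < C /\ exists2 I, T <= I & I <= q * I + K.
  (* This turns the lower bound - ln (1 - rho) for I into T, and T >= 1 ensures rho >= 1 / 2. *)
  move=> T1; pose rho := 1 - expR (- T).
  have eT : expR (- T) <= 2^-1.
    by rewrite expRN lef_pV2 ?posrE ?expR_gt0//; have := expR_ge1Dx T; lra.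
  have eT0 := expR_gt0 (- T).
  have rho0 : 0 < rho by rewrite /rho; lra.
  have rho1 : rho < 1 by rewrite /rho; lra.
  have rho2 : 2^-1 <= rho by rewrite /rho; lra.
  have rE : 1 - rho = expR (- T) by rewrite /rho; ring.
  pose L := cauchy_log rho; pose c := - cos (pi / p).
  have Ig := arc_integral_inv_modulus_ge rho0 rho1; rewrite rE expRK opprK in Ig.
  have FE : (fun t => cabs (cauchy_root p rho (cis t)) `^ p) = fun t => expR (- L t).
    by apply/funext => t; exact: cabs_cauchy_root.
  have := @riesz_bound_extremal_integral R p rho c p1 rho0 rho1 s C s0 bd.
  rewrite FE => /(_ (lt_le_trans ltr01 (le_trans T1 Ig)))[C0 le]; split=> //.
  exists (arc_integral (fun t => expR (- L t))); first exact: Ig.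
  apply: le_trans le _; rewrite /q /K -mulrA -mulrDr.
  rewrite ler_wpM2l ?powR_ge0//.
  have Ii := continuous_arc_integrable (continuous_inv_modulus rho0 rho1).
  have Gc := continuous_extremal p c rho0 rho1.
  have [_ _ Gi] := Lp_ccontinuous p0 Gc.
  have re_i : arc_integrable (fun t => cauchy_re rho t / cauchy_sqr rho t).
    exact: continuous_arc_integrable (continuous_cauchy_re_div rho0 rho1).
  have reE := arc_integral_cauchy_re rho0 rho1.
  pose B t := (sin k)^-1 * (cauchy_re rho t / cauchy_sqr rho t) + 2 / k.
  have Bi : arc_integrable B by apply: arc_integrableD; [exact: arc_integrableZ|exact: arc_integrable_cst].
  have maj : arc_integrable (fun t => (sin (pi / p) ^+ 2 + 8 * k) `^ (p / 2) * expR (- L t) + 4 `^ (p / 2) * B t).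
    by apply: arc_integrableD; exact: arc_integrableZ.
  apply: le_trans (le_arc_integral Gi maj _) _.
    by move=> t _; rewrite cabs_extremal//; exact: extremal_integrand_le.
  rewrite arc_integralD; [|exact: arc_integrableZ|exact: arc_integrableZ].
  rewrite !arc_integralZ// /B arc_integralD; [|exact: arc_integrableZ|exact: arc_integrable_cst].
  by rewrite arc_integralZ// reE arc_integral_cst.
have [C0 _] := main 1 (lexx 1); split=> //; rewrite leNgt; apply/negP => q1.
have q1' : 0 < 1 - q by rewrite subr_gt0.
(* If q < 1, the inequality caps I at K / (1 - q); T is taken one above this cap. *)
have T1 : 1 <= 1 + K / (1 - q) by rewrite lerDl divr_ge0// ltW.
have [_ [I TI IK]] := main _ T1.
have : I <= K / (1 - q) by rewrite ler_pdivlMr//; lra.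
lra.
Qed.

(** Removing the exponent p / 2 leaves 1 <= C^2 (sin^2 (pi / p) + 8 k), and k tends to 0. *)
Lemma riesz_lower_bound s p C : 0 < s -> 1 < p -> riesz_bound s p C -> 1 / sin (pi / p) <= C.
Proof.
move=> s0 p1 bd; have p0 : 0 < p := lt_trans ltr01 p1.
have /andP[sp0 sp1] := sin_pi_div p1.
have [C0 _] := riesz_bound_approx s0 p1 bd ltr01 (lexx 1).
have sq k : 0 < k -> k <= 1 -> 1 <= C ^+ 2 * (sin (pi / p) ^+ 2 + 8 * k).
  move=> k0 k1; have [_] := riesz_bound_approx s0 p1 bd k0 k1.
  have S0 : 0 <= sin (pi / p) ^+ 2 + 8 * k by rewrite addr_ge0 ?sqr_ge0// mulr_ge0// ltW.
  rewrite -(sqr_powR_half p (ltW C0)) -(powRM _ (sqr_ge0 C) S0) => h.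
  rewrite leNgt; apply/negP => h1; move: h; rewrite leNgt => /negP; apply.
  have p20 : 0 < p / 2 by rewrite divr_gt0.
  have := gt0_ltr_powR p20 (mulr_ge0 (sqr_ge0 C) S0) (ler01 : (1 : R) \in Num.nneg) h1.
  by rewrite powR1.
rewrite ler_pdivrMr// -ler_sqr ?nnegrE ?mulr_ge0 ?(ltW C0) ?(ltW sp0)// expr1n exprMn.
apply/ler_addgt0Pr => e e0.
have C2 : 0 < C ^+ 2 by rewrite exprn_gt0.
pose k := Num.min 1 (e / (8 * C ^+ 2)).
have k0 : 0 < k by rewrite lt_min ltr01 divr_gt0// mulr_gt0.
have k1 : k <= 1 by rewrite ge_min lexx.
have ke : k <= e / (8 * C ^+ 2) by rewrite ge_min lexx orbT.
apply: le_trans (sq k k0 k1) _; rewrite mulrDr lerD2l.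
by rewrite ler_pdivlMr in ke; [move: ke; lra|rewrite mulr_gt0].
Qed.

(** Bernoulli's inequality (1 + 1 / s)^s >= 2, read off from the tangent line at 1. *)
Lemma two_powR_inv_le s : 1 < s -> 2 `^ s^-1 <= 1 + s^-1.
Proof.
move=> s1; have s0 : 0 < s := lt_trans ltr01 s1.
have y0 : 0 <= 1 + s^-1 by rewrite addr_ge0// invr_ge0 ltW.
have := powR_tangent s1 y0 ler01; rewrite !powR1 mulr1 addrAC subrr add0r mulfV ?gt_eqF// => h.
have -> : 1 + s^-1 = ((1 + s^-1) `^ s) `^ s^-1 by rewrite -powRrM mulfV ?gt_eqF// powRr1.
apply: ge0_ler_powR; rewrite ?nnegrE ?invr_ge0 ?powR_ge0 ?(ltW s0)//.
Qed.

Lemma riesz_const_bounds s p : 0 < s -> 1 < p ->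
  ((1 / sin (pi / p))%:E <= riesz_const s p <= (2 `^ s^-1 * (1 / sin (pi / p)))%:E)%E.
Proof.
move=> s0 p1; apply/andP; split.
  by apply: le_ereal_inf_tmp => _ [C bd <-]; rewrite lee_fin; exact: riesz_lower_bound bd.
by apply: ereal_inf_lbound; rewrite /=; exists (2 `^ s^-1 * (1 / sin (pi / p))) => //; exact: riesz_upper_bound.
Qed.

End riesz_lower.

Local Close Scope complex_scope.

Theorem theorem1p2 (R : realType) (p : R) (hp : 1 < p) :
  riesz_const s p @[s --> +oo] --> (1 / sin (pi / p))%:E.
Proof.
have /andP[sp0 _] := sin_pi_div hp; set a := 1 / sin (pi / p).
have a0 : 0 < a by rewrite divr_gt0.
apply: (@squeeze_cvge _ _ _ _ (fun=> a%:E) _ (fun s => (2 `^ s^-1 * a)%:E)).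
- near=> s; apply: riesz_const_bounds => //.
- exact: cvg_cst.
- apply: cvg_EFin; first exact: nearW.
  apply/cvgrPdist_le => e e0; near=> s.
  have s1 : 1 < s by near: s; apply: nbhs_pinfty_gt; exact: num_real.
  have s0 : 0 < s := lt_trans ltr01 s1.
  have se : a / e < s by near: s; apply: nbhs_pinfty_gt; exact: num_real.
  have ge1 : 1 <= 2 `^ s^-1 by rewrite -[leLHS](powRr0 2) ler_powR// ?ler1n// invr_ge0 ltW.
  rewrite distrC ger0_norm; last by rewrite subr_ge0 ler_peMl// ltW.
  rewrite -[X in _ - X]mul1r -mulrBl.
  apply: (@le_trans _ _ (s^-1 * a)).
    by rewrite ler_wpM2r ?(ltW a0)// lerBlDl two_powR_inv_le.
  by rewrite mulrC ler_pdivrMr// mulrC -ler_pdivrMr// ltW.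
Unshelve. all: by end_near. Qed.
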